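(* The invariant $\mathbf{Z}_{\mathbb{D}}$ determines the universal quantum $\mathfrak{sl}_2$ invariant and hence all colored Jones polynomials. That is, if $K$ and $K'$ are long knots with $\mathbf{Z}_{\mathbb{D}}(K)=\mathbf{Z}_{\mathbb{D}}(K')$, then the universal $\mathcal{U}_\hbar(\mathfrak{sl}_2)$ invariants of $K$ and $K'$ coincide, and for every $N\ge 1$ the $N$-colored Jones polynomials of $K$ and $K'$ coincide.
   Context: **The algebra $\mathbb{D}$.** Let $\mathbb{K}=\mathbb{Q}[\epsilon][[\hbar]]$ and $q=e^{\epsilon\hbar}$; all tensor products are over $\mathbb{K}$ and $\hbar$-adically completed. $\mathbb{D}$ is the $\hbar$-adically complete topological $\mathbb{K}$-algebra topologically generated by $\mathbf{y},\mathbf{b},\mathbf{a},\mathbf{x}$ with, writing $\mathbf{A}=e^{-\epsilon\hbar\mathbf{a}}$ and $\mathbf{B}=e^{-\hbar\mathbf{b}}$, relations $\mathbf{x}\mathbf{y}=q\mathbf{y}\mathbf{x}+\frac{1-\mathbf{A}\mathbf{B}}{\hbar}$, $[\mathbf{a},\mathbf{x}]=\mathbf{x}$, $[\mathbf{b},\mathbf{x}]=\epsilon\mathbf{x}$, $[\mathbf{a},\mathbf{y}]=-\mathbf{y}$, $[\mathbf{b},\mathbf{y}]=-\epsilon\mathbf{y}$, $[\mathbf{a},\mathbf{b}]=0$; the ordered monomials $\mathbf{y}^k\mathbf{b}^\ell\mathbf{a}^m\mathbf{x}^n$ form a topological basis. It is a ribbon Hopf algebra with $\Delta(\mathbf{y})=1\otimes\mathbf{y}+\mathbf{y}\otimes\mathbf{B}$,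 $\Delta(\mathbf{x})=1\otimes\mathbf{x}+\mathbf{x}\otimes\mathbf{A}$, $\mathbf{a},\mathbf{b}$ primitive, universal $R$-matrix $\mathbf{R}=\sum_{m,n\ge 0}\frac{\hbar^{m+n}}{[m]!\,n!}\,\mathbf{y}^m\mathbf{b}^n\otimes\mathbf{a}^n\mathbf{x}^m$ (where $[k]=\frac{1-q^k}{1-q}$, $[m]!=[1]\cdots[m]$) and spinner $\mathbf{C}=(\mathbf{A}\mathbf{B})^{1/2}$ (i.e. ribbon element $\mathbf{v}=\mathbf{C}^{-1}\mathbf{u}$ with $\mathbf{u}$ the Drinfeld element). **Universal invariant.** Let $H$ be a ribbon Hopf algebra with universal $R$-matrix $R$, Drinfeld element $u$, ribbon element $v$ and spinner $C=uv^{-1}$. A (framed) knot $K$ is presented by a diagram of a long knot (one strand) in a rectangle, oriented from the bottom edge to the top edge, isotoped so that at the endpoints and at every crossing both strands point vertically upwards. Removing the crossings cuts the strand into edges $e$, each with an integer rotation number $\mathrm{rot}(e)$ (counterclockwise positive). Assign $R^{\pm1}$ to each crossing of sign $\pm$, first tensor factor on the overpass, second on the underpass, and $C^{\mathrm{rot}(e)}$ to each edge $e$. The universal invariant $\mathbf{Z}_H(K)\in H$ is the product (summed over the terms of the tensors) of all these elements in order of appearance along the strand. **Quantum $\mathfrak{sl}_2$.** $\mathcal{U}_\hbar(\mathfrak{sl}_2)$ is topologically generated over $\mathbb{Q}[[\hbar]]$ by $H,E,F$ with $[H,E]=2E$, $[H,F]=-2F$, $[E,F]=\frac{q^{H/2}-q^{-H/2}}{q^{1/2}-q^{-1/2}}$,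 $q=e^\hbar$, with its standard ribbon Hopf algebra structure. The universal quantum $\mathfrak{sl}_2$ invariant is $\mathbf{Z}_{\mathcal{U}_\hbar(\mathfrak{sl}_2)}$; the $N$-colored Jones polynomial is obtained by evaluating it in the $N$-dimensional irreducible representation. *)

(* Defs.v *)
(* MathComp, with monalg (multinomials) for free algebras, boolp for classical
   decidability of equality on power series and of ideal membership. *)
From HB Require Import structures.
From mathcomp Require Import all_boot all_order all_algebra.
From mathcomp Require Import boolp finmap.
From mathcomp Require Import monalg.
Set Implicit Arguments.
Unset Strict Implicit.
Unset Printing Implicit Defensive.
Import GRing.Theory.
Local Open Scope ring_scope.
Local Open Scope quotient_scope.

(* A[[hbar]], hbar being central; [f n] is the coefficient of hbar^n.  It is
   a new type because bare functions to a ring carry the pointwise product. *)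
Record series (A : Type) := Series { scoef :> nat -> A }.

Section SeriesChoice.
Variable A : Type.
HB.instance Definition _ := gen_eqMixin (series A).
HB.instance Definition _ := gen_choiceMixin (series A).
End SeriesChoice.

Section SeriesRing.
Variable A : nzRingType.
Implicit Types f g h : series A.

Lemma seriesP f g : (forall n, f n = g n) -> f = g.
Proof. by case: f g => f [g] /= fg; congr Series; apply/funext. Qed.

Definition szero : series A := Series (fun=> 0).
Definition sopp f := Series (fun n => - f n).
Definition sadd f g := Series (fun n => f n + g n).

Fact saddA : associative sadd.
Proof. by move=> f g h; apply: seriesP => n; rewrite /= addrA. Qed.
Fact saddC : commutative sadd.
Proof. by move=> f g; apply: seriesP => n; rewrite /= addrC. Qed.
Fact sadd0 : left_id szero sadd.
Proof. by move=> f; apply: seriesP => n; rewrite /= add0r. Qed.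
Fact saddN : left_inverse szero sopp sadd.
Proof. by move=> f; apply: seriesP => n; rewrite /= addNr. Qed.

HB.instance Definition _ :=
  GRing.isZmodule.Build (series A) saddA saddC sadd0 saddN.

Definition sconst (a : A) : series A :=
  Series (fun n => if n == 0 then a else 0).
Definition smul f g : series A :=
  Series (fun n => \sum_(i < n.+1) f i * g (n - i)%N).

(* The ring axioms are inherited from those of {poly A} by truncation. *)
Let trunc n f : {poly A} := \poly_(i < n.+1) f i.

Let truncE n f i : (i <= n)%N -> (trunc n f)`_i = f i.
Proof. by move=> lein; rewrite coef_poly ltnS lein. Qed.

Let smulE n f g i : (i <= n)%N -> smul f g i = (trunc n f * trunc n g)`_i.
Proof.
move=> lein; rewrite coefM /=; apply: eq_bigr => j _.
rewrite !truncE //; first by rewrite (leq_trans (leq_subr _ _)).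
by rewrite (leq_trans _ lein) // -ltnS.
Qed.

Fact smulA : associative smul.
Proof.
move=> f g h; apply: seriesP => n.
transitivity ((trunc n f * (trunc n g * trunc n h))`_n).
  rewrite coefM; apply: eq_bigr => j _.
  by rewrite -smulE ?leq_subr // truncE // -ltnS.
rewrite mulrA coefM; apply/esym/eq_bigr => j _.
by rewrite -smulE ?(truncE _ (leq_subr _ _)) // -ltnS.
Qed.

Fact smul1 : left_id (sconst 1) smul.
Proof.
move=> f; apply: seriesP => n; rewrite /= big_ord_recl /= subn0 mul1r.
by rewrite big1 ?addr0 // => i _; rewrite mul0r.
Qed.

Fact smulr1 : right_id (sconst 1) smul.
Proof.
move=> f; apply: seriesP => n; rewrite /= big_ord_recr /= subnn mulr1.
by rewrite big1 ?add0r // => i _; rewrite subn_eq0 leqNgt ltn_ord /= mulr0.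
Qed.

Fact smulDl : left_distributive smul +%R.
Proof.
move=> f g h; apply: seriesP => n; rewrite /= -big_split.
by apply: eq_bigr => i _; rewrite mulrDl.
Qed.

Fact smulDr : right_distributive smul +%R.
Proof.
move=> f g h; apply: seriesP => n; rewrite /= -big_split.
by apply: eq_bigr => i _; rewrite mulrDr.
Qed.

Fact sone_neq0 : sconst 1 != 0 :> series A.
Proof.
by apply/eqP => /(congr1 (fun f : series A => f 0)) /eqP; rewrite /= oner_eq0.
Qed.

HB.instance Definition _ := GRing.Zmodule_isNzRing.Build (series A)
  smulA smul1 smulr1 smulDl smulDr sone_neq0.

Definition hbar : series A := Series (fun n => (n == 1)%:R).

(* f / hbar, for f with zero constant term. *)
Definition hdiv f : series A := Series (fun n => f n.+1).

(* \sum_(n >= 0) F n, for F n divisible by hbar^n. *)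
Definition ssum (F : nat -> series A) : series A :=
  Series (fun n => \sum_(m < n.+1) F m n).

(* The inverse of f, for f whose constant term has inverse u. *)
Definition sinv (u : A) f : series A :=
  ssum (fun n => (1 - sconst u * f) ^+ n) * sconst u.

(* f ^ r, for f with constant term 1. *)
Definition sexpz f (r : int) : series A :=
  match r with Posz n => f ^+ n | Negz n => sinv 1 f ^+ n.+1 end.

End SeriesRing.
Arguments hbar {A}.

Definition smap (A B : Type) (phi : A -> B) (f : series A) : series B :=
  Series (fun n => phi (f n)).

(* exp (z hbar) in k[[hbar]] *)
Definition kexp (k : comUnitRingType) (z : k) : series k :=
  Series (fun n => z ^+ n / n`!%:R).

(* exp (z hbar) in A[[hbar]] *)
Definition hexp (k : comUnitRingType) (A : lalgType k) (z : A) : series A :=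
  Series (fun n => (n`!%:R^-1 : k) *: z ^+ n).

(* The structure map k[[hbar]] -> A[[hbar]]. *)
Definition scal (k : comUnitRingType) (A : lalgType k) (c : series k) :
  series A := smap (fun a => a%:A) c.

Section Quotient.
Variable A : nzRingType.
Implicit Types f g : series A.

(* The hbar-adic closure of the two-sided ideal generated by rels. *)
Definition in_ideal (rels : seq (series A)) f : Prop :=
  exists2 s : seq (series A * series A * series A),
    all (fun t => t.1.2 \in rels) s & f = \sum_(t <- s) t.1.1 * t.1.2 * t.2.

Definition in_closed_ideal (rels : seq (series A)) f : Prop :=
  forall n, exists2 g, in_ideal rels g &
    forall i, (i < n)%N -> f i = g i.

Variable rels : seq (series A).

Lemma in_closed_ideal0 : in_closed_ideal rels 0.
Proof.
by move=> n; exists 0 => //; exists [::]; rewrite ?big_nil.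
Qed.

Lemma in_closed_idealD f g : in_closed_ideal rels f ->
  in_closed_ideal rels g -> in_closed_ideal rels (f + g).
Proof.
move=> If Ig n; have [f' [s sP ->] fE] := If n.
have [g' [t tP ->] gE] := Ig n; exists (\sum_(u <- s ++ t) u.1.1 * u.1.2 * u.2).
  by exists (s ++ t); rewrite ?all_cat ?sP.
by move=> i ltin; rewrite big_cat /= fE ?gE.
Qed.

Lemma in_closed_idealM h1 h2 f : in_closed_ideal rels f ->
  in_closed_ideal rels (h1 * f * h2).
Proof.
move=> If n; have [f' [s sP ->] fE] := If n.
exists (h1 * (\sum_(u <- s) u.1.1 * u.1.2 * u.2) * h2).
  exists [seq (h1 * t.1.1, t.1.2, t.2 * h2) | t <- s].
    by rewrite all_map; apply: sub_all sP.
  rewrite big_map mulr_sumr mulr_suml.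
  by apply: eq_bigr => -[[a r] b] _; rewrite !mulrA.
move=> i ltin /=; apply: eq_bigr => j _; congr (_ * _).
apply: eq_bigr => l _; congr (_ * _); apply: fE.
apply: leq_ltn_trans (leq_subr _ _) _.
by apply: leq_ltn_trans ltin; rewrite -ltnS.
Qed.

Lemma in_closed_idealN f : in_closed_ideal rels f -> in_closed_ideal rels (- f).
Proof. by move/(in_closed_idealM (-1) 1); rewrite mulr1 mulN1r. Qed.

Definition equiv_mod f g : bool := `[< in_closed_ideal rels (f - g) >].

Fact equiv_mod_refl : reflexive equiv_mod.
Proof. by move=> f; apply/asboolP; rewrite subrr; apply: in_closed_ideal0. Qed.
Fact equiv_mod_sym : symmetric equiv_mod.
Proof.
by move=> f g; apply: asbool_equiv_eq; split=> /in_closed_idealN; rewrite opprB.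
Qed.
Fact equiv_mod_trans : transitive equiv_mod.
Proof.
move=> g f h /asboolP Ifg /asboolP Igh; apply/asboolP.
by rewrite -(subrKA g); apply: in_closed_idealD.
Qed.

Canonical equiv_mod_equiv :=
  EquivRel equiv_mod equiv_mod_refl equiv_mod_sym equiv_mod_trans.

(* A[[hbar]] modulo the closed ideal; for A = freealg X below, this is the
   hbar-adically complete topological algebra generated by X with relations
   rels. *)
Definition presented := {eq_quot equiv_mod}.
HB.instance Definition _ := Choice.on presented.
HB.instance Definition _ := EqQuotient.on presented.

Lemma presentedP f g :
  reflect (in_closed_ideal rels (f - g)) (f == g %[mod presented]).
Proof. by rewrite eqmodE; apply: asboolP. Qed.

Definition pzero : presented := lift_cst presented 0.
Definition pone : presented := lift_cst presented 1.
Definition popp := lift_op1 presented -%R.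
Definition padd := lift_op2 presented +%R.
Definition pmul := lift_op2 presented *%R.
Canonical pi_pzero_morph := PiConst pzero.
Canonical pi_pone_morph := PiConst pone.

Lemma pi_popp : {morph \pi : f / - f >-> popp f}.
Proof.
move=> f; unlock popp; apply/eqP/presentedP.
rewrite -opprD; apply: in_closed_idealN.
by apply/presentedP; rewrite reprK.
Qed.
Canonical pi_popp_morph := PiMorph1 pi_popp.

Lemma pi_padd : {morph \pi : f g / f + g >-> padd f g}.
Proof.
move=> f g; unlock padd; apply/eqP/presentedP.
rewrite opprD addrACA; apply: in_closed_idealD;
  by apply/presentedP; rewrite reprK.
Qed.
Canonical pi_padd_morph := PiMorph2 pi_padd.

Lemma pi_pmul : {morph \pi : f g / f * g >-> pmul f g}.
Proof.
move=> f g; unlock pmul; apply/eqP/presentedP.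
set f' := repr _; set g' := repr _.
rewrite -(subrKA (f * g')) -mulrBr -mulrBl; apply: in_closed_idealD.
  rewrite -[_ * _]mulr1; apply: in_closed_idealM.
  by apply/presentedP; rewrite reprK.
rewrite -[_ - f']mul1r; apply: in_closed_idealM.
by apply/presentedP; rewrite reprK.
Qed.
Canonical pi_pmul_morph := PiMorph2 pi_pmul.

Fact paddA : associative padd.
Proof. by move=> x y z; rewrite -[x]reprK -[y]reprK -[z]reprK !piE addrA. Qed.
Fact paddC : commutative padd.
Proof. by move=> x y; rewrite -[x]reprK -[y]reprK !piE addrC. Qed.
Fact padd0 : left_id pzero padd.
Proof. by move=> x; rewrite -[x]reprK !piE add0r. Qed.
Fact paddN : left_inverse pzero popp padd.
Proof. by move=> x; rewrite -[x]reprK !piE addNr. Qed.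
HB.instance Definition _ :=
  GRing.isZmodule.Build presented paddA paddC padd0 paddN.

Fact pmulA : associative pmul.
Proof. by move=> x y z; rewrite -[x]reprK -[y]reprK -[z]reprK !piE mulrA. Qed.
Fact pmul1 : left_id pone pmul.
Proof. by move=> x; rewrite -[x]reprK !piE mul1r. Qed.
Fact pmulr1 : right_id pone pmul.
Proof. by move=> x; rewrite -[x]reprK !piE mulr1. Qed.
Fact pmulDl : left_distributive pmul +%R.
Proof.
move=> x y z; rewrite -[x]reprK -[y]reprK -[z]reprK.
by rewrite [LHS]piE [RHS]piE mulrDl.
Qed.
Fact pmulDr : right_distributive pmul +%R.
Proof.
move=> x y z; rewrite -[x]reprK -[y]reprK -[z]reprK.
by rewrite [LHS]piE [RHS]piE mulrDr.
Qed.
HB.instance Definition _ := GRing.Zmodule_isPzRing.Build presented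
  pmulA pmul1 pmulr1 pmulDl pmulDr.

End Quotient.

Section FreeAlgebra.
Variable k : comUnitRingType.

(* series (freealg X) is the hbar-adically complete topological k[[hbar]]-algebra
   topologically freely generated by X: only finitely many words occur in each
   degree in hbar. *)
Definition freealg (X : choiceType) := {malg k[{fmonom X}]}.
HB.instance Definition _ X := GRing.Lalgebra.on (freealg X).

Definition word (X : choiceType) (w : seq X) : freealg X := << FMonom w >>.
Definition gen (X : choiceType) (x : X) : series (freealg X) :=
  sconst (word [:: x]).

(* The linear map that acts on words by phi. *)
Definition on_words (X Y : choiceType) (phi : seq X -> seq Y) (f : freealg X) :
  freealg Y := \sum_(w <- msupp f) f@_w *: word (phi w).

End FreeAlgebra.

(* A topologically presented algebra H together with the part of its ribbon
   Hopf structure that enters the universal invariant.  The completed tensor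
   power of H with factors labelled by a set S is a quotient of
   series (freealg (rgen * S)), the letter (g, s) being g in the factor s; rmat
   represents the universal R-matrix, false labelling the first tensor factor,
   and rspin represents the spinner.  Both are 1 modulo hbar, so their inverses
   already exist before passing to the quotient. *)
Record ribbon_data (k : comUnitRingType) := RibbonData {
  rgen : choiceType;
  rrel : seq (series (freealg k rgen));
  rmat : series (freealg k (rgen * bool)%type);
  rspin : series (freealg k rgen)
}.

Definition ralg (k : comUnitRingType) (H : ribbon_data k) : Type :=
  presented (rrel H).

(* Long knot diagrams in a rectangle, as stacks of elementary pieces from bottom
   to top; positions are counted from the left, starting at 0.  [Cup j] (a local
   minimum) creates the strands at positions j and j + 1, [Cap j] (a local
   maximum) joins them, and [Cross s j] crosses them.  For s = true the strand
   that goes from bottom left to top right is the overpass; as both strands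
   will be required to point upwards, this is a positive crossing. *)
Inductive piece := Cup of nat | Cap of nat | Cross of bool & nat.

Definition piece_fits (w : nat) (p : piece) : bool :=
  match p with
  | Cup j => (j <= w)%N
  | Cap j | Cross _ j => (j.+1 < w)%N
  end.

Definition piece_width (w : nat) (p : piece) : nat :=
  match p with Cup _ => w.+2 | Cap _ => w.-2 | Cross _ _ => w end.

(* The numbers of strands at heights 0, ..., size d. *)
Definition widths (d : seq piece) : seq nat := 1 :: scanl piece_width 1 d.

Definition fits (d : seq piece) : bool :=
  all (fun h => piece_fits (nth 0 (widths d) h) (nth (Cup 0) d h))
      (iota 0 (size d)).

(* A position on the strand: height, position from the left, and whether the
   strand points upwards there. *)
Definition place := (nat * nat * bool)%type.

(* [Turn true] is a counterclockwise half-turn; [Pass h o] is a passage through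
   the crossing at height h, on the overpass iff o. *)
Inductive event := Pass of nat & bool | Turn of bool.

Definition step (d : seq piece) (p : place) : option (option event * place) :=
  let skip j i := if (i < j)%N then i else i.+2 in
  let unskip j i := if (i < j)%N then i else i.-2 in
  match p with
  | (h, i, true) =>
    if (h < size d)%N then
      match nth (Cup 0) d h with
      | Cup j => Some (None, (h.+1, skip j i, true))
      | Cap j =>
        if i == j then Some (Some (Turn false), (h, j.+1, false))
        else if i == j.+1 then Some (Some (Turn true), (h, j, false))
        else Some (None, (h.+1, unskip j i, true))
      | Cross s j =>
        if i == j then Some (Some (Pass h s), (h.+1, j.+1, true))
        else if i == j.+1 then Some (Some (Pass h (~~ s)), (h.+1, j, true))
        else Some (None, (h.+1, i, true))
      end
    else None
  | (h.+1, i, false) =>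
    match nth (Cup 0) d h with
    | Cup j =>
      if i == j then Some (Some (Turn true), (h.+1, j.+1, true))
      else if i == j.+1 then Some (Some (Turn false), (h.+1, j, true))
      else Some (None, (h, unskip j i, false))
    | Cap j => Some (None, (h, skip j i, false))
    | Cross _ j =>
      if (i == j) || (i == j.+1) then None else Some (None, (h, i, false))
    end
  | (0, _, false) => None
  end.

Fixpoint walk (d : seq piece) (n : nat) (p : place) :
  seq (place * option event) :=
  if n is n'.+1 then
    if step d p is Some (e, p') then (p, e) :: walk d n' p' else [:: (p, None)]
  else [::].

Definition strand (d : seq piece) : seq (place * option event) :=
  walk d (sumn (widths d)) (0, 0, true).

(* The strand enters at the bottom, never goes down through a crossing, leaves
   at the top, and is the only component. *)
Definition is_long_knot (d : seq piece) : bool :=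
  [&& fits d,
      last 0 (widths d) == 1,
      size (strand d) == sumn (widths d) &
      (last (0, 0, false) (map fst (strand d)) == (size d, 0, true))].

Record long_knot := LongKnot {
  diagram :> seq piece;
  long_knotP : is_long_knot diagram
}.

Definition events (d : seq piece) : seq event := pmap snd (strand d).

Definition passes (d : seq piece) : seq (nat * bool) :=
  pmap (fun e => if e is Pass h o then Some (h, o) else None) (events d).

Fixpoint edge_turns (t : int) (s : seq event) : seq int :=
  match s with
  | [::] => [:: t]
  | Turn c :: s' => edge_turns (if c then t + 1 else t - 1) s'
  | Pass _ _ :: s' => t :: edge_turns 0 s'
  end.

(* Rotation numbers of the edges in order.  Since each edge starts and ends
   pointing upwards, its number of half-turns is even. *)
Definition rotations (d : seq piece) : seq int :=
  [seq (t %/ 2)%Z | t <- edge_turns 0 (events d)].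

(* Height and sign of each crossing. *)
Definition crossings (d : seq piece) : seq (nat * bool) :=
  pmap (fun h => if nth (Cup 0) d h is Cross s _ then Some (h, s) else None)
       (iota 0 (size d)).

(* Tensor factors are labelled in order of appearance along the strand: 2e for
   the e-th edge, 2p + 1 for the p-th passage through a crossing. *)
Definition pass_slot (d : seq piece) (h : nat) (o : bool) : nat :=
  (index (h, o) (passes d)).*2.+1.

Section UniversalInvariant.
Variables (k : comUnitRingType) (H : ribbon_data k).

Definition place_slots (S : choiceType) (s : S -> nat)
    (f : series (freealg k (rgen H * S)%type)) :
  series (freealg k (rgen H * nat)%type) :=
  smap (on_words (map (fun x => (x.1, s x.2)))) f.

Definition crossing_elt (d : seq piece) (c : nat * bool) :=
  place_slots (fun under => pass_slot d c.1 (~~ under))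
    (if c.2 then rmat H else sinv 1 (rmat H)).

Definition edge_elt (e : nat) (r : int) :
  series (freealg k (rgen H * nat)%type) :=
  smap (on_words (map (fun g => (g, e.*2)))) (sexpz (rspin H) r).

(* Multiplication of all tensor factors in increasing order of their labels
   (path.sort is stable). *)
Definition merge_slots (f : series (freealg k (rgen H * nat)%type)) :
  series (freealg k (rgen H)) :=
  smap (on_words (fun w => map fst (sort (relpre snd leq) w))) f.

Definition universal_rep (d : seq piece) : series (freealg k (rgen H)) :=
  merge_slots
    ((\prod_(c <- crossings d) crossing_elt d c) *
     (\prod_(e < size (rotations d)) edge_elt e (nth 0 (rotations d) e))).

Definition universal_invariant (K : long_knot) : ralg H :=
  \pi_(presented (rrel H)) (universal_rep K).

End UniversalInvariant.

Section AlgebraD.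
Local Notation k := {poly rat}. (* Q[epsilon] *)
Let eps : k := 'X.

Inductive Dgen := Dy | Db | Da | Dx.
HB.instance Definition _ := gen_eqMixin Dgen.
HB.instance Definition _ := gen_choiceMixin Dgen.

Section Relations.
Let T := series (freealg k Dgen).
Let y : T := gen k Dy.
Let b : T := gen k Db.
Let a : T := gen k Da.
Let x : T := gen k Dx.
Let e : T := scal _ (sconst eps).
Let q : T := scal _ (kexp eps).
Let A : T := hexp (- eps *: word k [:: Da]).
Let B : T := hexp (- word k [:: Db]).

Definition Drel : seq T := [::
  x * y - (q * y * x + hdiv (1 - A * B));
  (a * x - x * a) - x;
  (b * x - x * b) - e * x;
  (a * y - y * a) + y;
  (b * y - y * b) + e * y;
  a * b - b * a].

(* (A B)^(1/2) *)
Definition Dspin : T :=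
  hexp (- (2%:R^-1 : k) *: (eps *: word k [:: Da] + word k [:: Db])).
End Relations.

(* (1 - q^n) / (1 - q) for q = e^(epsilon hbar), as 1 + q + ... + q^(n-1):
   1 - q is not invertible. *)
Definition Dint (n : nat) : series k := \sum_(i < n) kexp eps ^+ i.

Definition Dfact (n : nat) : series k := \prod_(i < n) Dint i.+1.

Definition DR : series (freealg k (Dgen * bool)%type) :=
  ssum (fun m => ssum (fun n =>
    scal _ (hbar ^+ (m + n) *
            sinv (m`! * n`!)%:R^-1 (Dfact m * sconst n`!%:R)) *
    (gen k (Dy, false) ^+ m * gen k (Db, false) ^+ n) *
    (gen k (Da, true) ^+ n * gen k (Dx, true) ^+ m))).

Definition D : ribbon_data k := RibbonData Drel DR Dspin.

End AlgebraD.

Section QuantumSl2.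

Inductive Ugen := UH | UE | UF.
HB.instance Definition _ := gen_eqMixin Ugen.
HB.instance Definition _ := gen_choiceMixin Ugen.

(* q^r *)
Definition qpow (r : rat) : series rat := kexp r.

(* (q^(1/2) - q^(-1/2)) / hbar, with constant term 1 *)
Definition Uden : series rat := hdiv (qpow (1 / 2) - qpow (- (1 / 2))).

Section Relations.
Let T := series (freealg rat Ugen).
Let H : T := gen rat UH.
Let E : T := gen rat UE.
Let F : T := gen rat UF.
(* q^(r H) *)
Let qH (r : rat) : T := hexp (r *: word rat [:: UH]).

Definition Urel : seq T := [::
  (H * E - E * H) - 2%:R * E;
  (H * F - F * H) + 2%:R * F;
  (E * F - F * E)
    - scal _ (sinv 1 Uden) * hdiv (qH (1 / 2) - qH (- (1 / 2)))].

Definition Uspin : T := qH (- (1 / 2)).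
End Relations.

(* (q^(n/2) - q^(-n/2)) / (q^(1/2) - q^(-1/2)) *)
Definition Uint (n : nat) : series rat :=
  \sum_(i < n) qpow ((n.-1%:R - 2%:R * i%:R) / 2%:R).

Definition Ufact (n : nat) : series rat := \prod_(i < n) Uint i.+1.

(* With K = q^(H/2), this is the ribbon Hopf algebra structure in which
   Delta E = E (x) 1 + K (x) E, Delta F = F (x) K^(-1) + 1 (x) F, H is primitive,
     R = q^(H (x) H / 4) \sum_n q^(n(n-1)/4) (q^(1/2) - q^(-1/2))^n / [n]!
                                F^n (x) E^n,
   and the spinner is K^(-1). *)
Definition UR : series (freealg rat (Ugen * bool)%type) :=
  hexp ((1 / 4 : rat) *: (word rat [:: (UH, false); (UH, true)])) *
  ssum (fun n =>
    scal _ (qpow ((n * n.-1)%:R / 4%:R) *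
            (qpow (1 / 2) - qpow (- (1 / 2))) ^+ n *
            sinv n`!%:R^-1 (Ufact n)) *
    (gen rat (UF, false) ^+ n * gen rat (UE, true) ^+ n)).

Definition Uh_sl2 : ribbon_data rat := RibbonData Urel UR Uspin.

(* The N-dimensional irreducible representation, on a basis v_0, ..., v_(N-1)
   with H v_j = (N - 1 - 2j) v_j, F v_j = v_(j+1) and E v_j = [j][N-j] v_(j-1);
   matrices act on column vectors. *)
Definition irrep (N : nat) (g : Ugen) : 'M[series rat]_N :=
  \matrix_(i, j)
    match g with
    | UH => if i == j then sconst (N.-1%:R - 2%:R * j%:R) else 0
    | UF => if i == j.+1 :> nat then 1 else 0
    | UE => if i.+1 == j :> nat then Uint j * Uint (N - j) else 0
    end.

Definition irrep_free (N : nat) (f : freealg rat Ugen) : 'M[series rat]_N :=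
  \sum_(w <- msupp f) sconst f@_w *: \prod_(g <- (w : seq Ugen)) irrep N g.

Definition irrep_series (N : nat) (f : series (freealg rat Ugen)) :
  'M[series rat]_N :=
  \matrix_(i, j) ssum (fun n => hbar ^+ n * irrep_free N (f n) i j).

(* The representation sends the closed ideal of Urel to 0, so evaluating it on
   universal_rep is evaluating it on the universal invariant.  The latter is
   central, hence acts by a scalar; the trace divided by N is this scalar.  It is the value at q = e^hbar of the colored Jones
   polynomial of the framed knot, normalized to 1 on the trivial long knot. *)
Definition colored_jones (N : nat) (K : long_knot) : series rat :=
  sconst N%:R^-1 * \tr (irrep_series N (universal_rep Uh_sl2 K)).

End QuantumSl2.

(* Main.v *)
From HB Require Import structures.
From mathcomp Require Import all_boot all_order all_algebra.
From mathcomp Require Import boolp finmap monalg ring zify.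
Require Import Defs.
Set Implicit Arguments.
Unset Strict Implicit.
Unset Printing Implicit Defensive.

(** Setting eps = 1 and
      y |-> F,   b, a |-> H / 2,   x |-> ((q^(1/2) - q^(-1/2)) / hbar) K^(-1) E,
    where K = q^(H/2), respects the relations of D: both A and B go to K^(-1),
    the weights of a and b become half the weights of H, and the first relation
    becomes [E, F] = (K - K^(-1)) / (q^(1/2) - q^(-1/2)) multiplied by
    ((q^(1/2) - q^(-1/2)) / hbar) K^(-1) ([phi_rels]).  The resulting map phi
    from D to quantum sl2 sends one universal invariant to the other, because
    it matches the two pieces of ribbon structure from which they are built.

    The spinner (A B)^(1/2) goes to K^(-1) ([phi_spin]).  As for the R-matrix,
    in sum_(m, n) hbar^(m+n) / ([m]! n!) y^m b^n (x) a^n x^m the sum over n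
    becomes Q = exp(hbar H (x) H / 4), placed between F^m and x^m.  Moving Q to
    the left past F^m creates 1 (x) K^m, which cancels the factors K^(-1)
    of phi(x)^m and leaves the power q^(m(m-1)/2) from their commutation with E;
    half of it turns [m]! into the symmetric quantum factorial, and the other
    half is the power q^(m(m-1)/4) in the R-matrix of sl2 ([FQX], [Rcoef],
    [RD_RU]).

    The universal invariant is a sum of products taken along the strand, whose
    factors come in pairs from crossings.  To substitute one R-matrix for the
    other inside such a product, all factors are kept apart as letters (t, s)
    of a free algebra, t being a series of the target algebra and s its place,
    or slot, on the strand; merging sorts the letters by slot and multiplies
    them.  The elements all of whose multiples merge into the closed ideal
    of relations of sl2 form a closed ideal [null].  It contains the
    relations of sl2 within each slot and the commutators of letters of distinct
    slots, since sorting is stable ([null_in_slot], [null_comm]).  Modulo [null]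
    the two slots of a crossing therefore carry a completed tensor square, and
    the computation above applies ([slot_R]).

    This needs the two passages through a crossing to have distinct slots:
    if the strand missed one of them, its slot would be meaningless.
    Now a long knot diagram is traversed without visiting a position twice, in
    the same or in opposite directions, and in as many steps as it has
    positions; hence every position is visited, in particular
    the two below a crossing ([long_knot_slots]).

    So phi maps Z_D(K) to Z_U(K) ([phi_universal]), and the first determines
    the second ([universal_sl2]).  The colored Jones polynomials follow because
    the irreducible representations kill the closed ideal ([irrep_rels],
    [irrep_series_eq]). *)

(** * Long knots pass twice through every crossing *)

Section Strand.
Variable d : seq piece.
Hypothesis fd : fits d.

Definition width (h : nat) : nat := nth 0 (widths d) h.

Lemma size_widths : size (widths d) = (size d).+1.
Proof. by rewrite /= size_scanl. Qed.

Lemma widthS h : h < size d -> width h.+1 = piece_width (width h) (nth (Cup 0) d h).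
Proof.
move=> hd; rewrite /width /widths /= nth_scanl // (take_nth (Cup 0)) // -cats1 foldl_cat /=.
by case: h hd => [|h] hd; rewrite ?take0 //= nth_scanl // ltnW.
Qed.

Lemma fitsP h : h < size d -> piece_fits (width h) (nth (Cup 0) d h).
Proof. by move=> hd; apply: (allP fd); rewrite mem_iota. Qed.

Definition valid (p : place) : bool := (p.1.1 <= size d) && (p.1.2 < width p.1.1).

Definition reverse (p : place) : place := (p.1, ~~ p.2).

Lemma step_up h i : step d (h, i, true) =
  if h < size d then
    match nth (Cup 0) d h with
    | Cup j => Some (None, (h.+1, if i < j then i else i.+2, true))
    | Cap j =>
      if i == j then Some (Some (Turn false), (h, j.+1, false))
      else if i == j.+1 then Some (Some (Turn true), (h, j, false))
      else Some (None, (h.+1, if i < j then i else i.-2, true))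
    | Cross s j =>
      if i == j then Some (Some (Pass h s), (h.+1, j.+1, true))
      else if i == j.+1 then Some (Some (Pass h (~~ s)), (h.+1, j, true))
      else Some (None, (h.+1, i, true))
    end
  else None.
Proof. by case: h. Qed.

Lemma step_valid p e p' : valid p -> step d p = Some (e, p') -> valid p'.
Proof.
case: p => [[h i] []] /andP[/= hd iw].
  rewrite -/(step d (h, i, true)) step_up; case: ifP => [ltd|//].
  have := fitsP ltd; have := widthS ltd.
  case E: (nth _ d h) => [j|j|s j] /= wE fE.
  - by case=> _ <-; rewrite /valid /= ltd wE; case: (ltnP i j); lia.
  - case: eqP => [ij|ij]; first by case=> _ <-; rewrite /valid /= hd; lia.
    case: eqP => [ij'|ij']; first by case=> _ <-; rewrite /valid /= hd; lia.
    by case=> _ <-; rewrite /valid /= ltd wE; case: (ltnP i j); lia.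
  - case: eqP => [ij|ij]; first by case=> _ <-; rewrite /valid /= ltd wE; lia.
    case: eqP => [ij'|ij']; first by case=> _ <-; rewrite /valid /= ltd wE; lia.
    by case=> _ <-; rewrite /valid /= ltd wE; lia.
case: h hd iw => // h ltd iw; have := fitsP ltd; have := widthS ltd.
case E: (nth _ d h) => [j|j|s j] /= wE fE.
- case: eqP => [ij|ij]; first by case=> _ <-; rewrite /valid /= ltd wE; lia.
  case: eqP => [ij'|ij']; first by case=> _ <-; rewrite /valid /= ltd wE; lia.
  by case=> _ <-; rewrite /valid /= ltnW //; case: (ltnP i j); lia.
- by case=> _ <-; rewrite /valid /= ltnW //; case: (ltnP i j); lia.
- by case: ifP => // _ [_ <-]; rewrite /valid /= ltnW //; lia.
Qed.

(** The positions form a graph whose edges can be traversed in both directions,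
    except that crossings cannot be entered downwards: traversing an edge from p
    to p' backwards ends at the reverse of p, and nothing else does. *)
Lemma step_back p e p' q e' : valid p -> valid q ->
  step d p = Some (e, p') -> step d q = Some (e', reverse p) -> q = reverse p'.
Proof.
have place_eq (h h' i i' : nat) (b b' : bool) : h = h' -> i = i' -> b = b' ->
    (h, i, b) = (h', i', b').
  by move=> -> -> ->.
case: p => [[h i] []]; case: q => [[hq k] []] /andP[hd iw] /andP[hqd kw];
  rewrite /= in hd iw hqd kw; rewrite 2?step_up /reverse /=.
- case: ifP => // ltd; case: ifP => // ltq.
  case Eq: (nth _ d hq) => [j'|j'|s' j']; [by move=> _ []| |
    by move=> _; case: ifP => _; [|case: ifP => _]; move=> []].
  case: (eqVneq k j') => kj; [|case: (eqVneq k j'.+1) => kj'; last by move=> _ []].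
    move=> st [_ hh ii]; move: st; rewrite -hh Eq -ii.
    rewrite (_ : (j'.+1 == j') = false) ?eqxx; last by lia.
    by case=> _ <- /=; apply: place_eq.
  move=> st [_ hh ii]; move: st; rewrite -hh Eq -ii eqxx.
  by case=> _ <- /=; apply: place_eq.
- case: ifP => // ltd; case: hq hqd kw => // hq hqd kw.
  have := widthS hqd; have := fitsP hqd.
  case Eq: (nth _ d hq) => [j'|j'|s' j'] /= fE wE.
  + case: (eqVneq k j') => kj; first by move=> _ [].
    case: (eqVneq k j'.+1) => kj'; first by move=> _ [].
    move=> st [_ hh ii]; move: st; rewrite -hh Eq -ii; case=> _ <- /=.
    apply: place_eq => //; case: (ltnP k j') => kj2; first by rewrite kj2.
    by case: ltnP; lia.
  + move=> st [_ hh ii]; move: st; rewrite -hh Eq -ii.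
    case: (ltnP k j') => kj; case: eqP => [|_]; try lia; case: eqP => [|_]; try lia.
      by rewrite kj; case=> _ <-.
    by rewrite ifF; last lia; case=> _ <-.
  + case: ifP => // kj st [_ hh ii]; move: st; rewrite -hh Eq -ii.
    by rewrite !ifN; try lia; case=> _ <- /=.
- case: h hd iw => // h hd iw; case: ifP => // ltq st.
  case Eq: (nth _ d hq) => [j'|j'|s' j'].
  + move=> [_ hh ii]; move: hh st => [<-]; rewrite Eq -ii.
    case: (ltnP k j') => kj; case: eqP => [|_]; try lia; case: eqP => [|_]; try lia.
      by rewrite kj; case=> _ <-.
    by rewrite ifF; last lia; case=> _ <-.
  + case: (eqVneq k j') => kj; first by move=> [].
    case: (eqVneq k j'.+1) => kj'; first by move=> [].
    move=> [_ hh ii]; move: hh st => [<-]; rewrite Eq -ii; case=> _ <- /=.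
    apply: place_eq => //; case: (ltnP k j') => kj2; first by rewrite kj2.
    by case: ltnP; lia.
  + case: (eqVneq k j') => kj.
      by move=> [_ hh ii]; move: hh st => [<-]; rewrite Eq -ii eqxx orbT.
    case: (eqVneq k j'.+1) => kj'.
      by move=> [_ hh ii]; move: hh st => [<-]; rewrite Eq -ii eqxx.
    move=> [_ hh ii]; move: hh st => [<-]; rewrite Eq -ii.
    by rewrite ifN; try lia; case=> _ <-.
- case: h hd iw => // h hd iw; case: hq hqd kw => // hq hqd kw st.
  case Eq: (nth _ d hq) => [j'|j'|s' j']; [|by move=> []|by case: ifP => // _ []].
  case: (eqVneq k j') => kj; [|case: (eqVneq k j'.+1) => kj'; last by move=> []].
    move=> [_ hh ii]; move: hh st => [<-]; rewrite Eq -ii.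
    rewrite (_ : (j'.+1 == j') = false) ?eqxx; last by lia.
    by case=> _ <- /=; apply: place_eq.
  move=> [_ hh ii]; move: hh st => [<-]; rewrite Eq -ii eqxx.
  by case=> _ <- /=; apply: place_eq.
Qed.

Lemma step_not_reverse p e : step d p <> Some (e, reverse p).
Proof.
case: p => [[h i] []].
  rewrite step_up; case: ifP => // _; case: (nth _ d h) => [j|j|s j] //=.
  - case: eqP => [ij|_]; first by case; lia.
    by case: eqP => [ij|_] //; case; lia.
  - by case: eqP => _ //; case: eqP.
case: h => // h /=; case: (nth _ d h) => [j|j|s j] //=; last by case: ifP.
case: eqP => [ij|_]; first by case; lia.
by case: eqP => [ij|_] //; case; lia.
Qed.

Definition start : place := (0, 0, true).
Definition stop : place := (size d, 0, true).
Definition entry (n : nat) : place * option event := nth (start, None) (strand d) n.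

Lemma nth_walk n p i x0 : i.+1 < size (walk d n p) ->
  step d (nth x0 (walk d n p) i).1 =
  Some ((nth x0 (walk d n p) i).2, (nth x0 (walk d n p) i.+1).1).
Proof.
elim: n p i => //= n IHn p [|i]; case E: (step d p) => [[e p']|] //=.
  by rewrite E; case: n {IHn} => //= n _; case: (step d p') => [[]|].
exact: IHn.
Qed.

Lemma walk_head n p x0 : 0 < size (walk d n p) -> (nth x0 (walk d n p) 0).1 = p.
Proof. by case: n => //= n; case: (step d p) => [[]|]. Qed.

Hypothesis size_strand : size (strand d) = sumn (widths d).
Hypothesis last_strand : last (0, 0, false) (map fst (strand d)) = stop.

Let N := size (strand d).

Lemma N_gt0 : 0 < N.
Proof. by rewrite /N size_strand. Qed.

Lemma entry_step i : i.+1 < N -> step d (entry i).1 = Some ((entry i).2, (entry i.+1).1).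
Proof. exact: nth_walk. Qed.

Lemma entry_start : (entry 0).1 = start.
Proof. exact/walk_head/N_gt0. Qed.

Lemma entry_stop : (entry N.-1).1 = stop.
Proof.
rewrite -last_strand (last_nth (0, 0, false)) size_map; have := N_gt0; rewrite /N /entry.
by case: (strand d) => //= x s _; rewrite -map_cons (nth_map (start, None)) //=.
Qed.

Lemma entry_valid i : i < N -> valid (entry i).1.
Proof.
elim: i => [|i IHi] iN; first by rewrite entry_start.
exact: step_valid (IHi (ltnW iN)) (entry_step iN).
Qed.

(** Having returned to an earlier entry, the walk would repeat itself and so reach
    the top before its last step; but no step leaves the top. *)
Lemma entry_neq i j : i < j < N -> (entry i).1 <> (entry j).1.
Proof.
case/andP=> ij jN ijE.
have shift t : j + t < N -> (entry (i + t)).1 = (entry (j + t)).1.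
  elim: t => [|t IHt] jtN; first by rewrite !addn0.
  rewrite !addnS in jtN *.
  have e1 := entry_step jtN; have e2 : (i + t).+1 < N by lia.
  by have := entry_step e2; rewrite IHt ?e1; [case|lia].
have := shift (N.-1 - j); rewrite subnKC; last lia.
rewrite entry_stop => /(_ _) stopE.
have /entry_step : (i + (N.-1 - j)).+1 < N by lia.
by rewrite stopE ?step_up ?ltnn //; lia.
Qed.

(** If the walk came back to a place in the opposite direction, it would have
    left the next place and come back to it in the opposite direction, in two steps
    fewer ([step_back]).  In the end it would
    reverse its direction on the spot. *)
Lemma entry_neq_reverse t i : i + t < N -> (entry (i + t)).1 <> reverse (entry i).1.
Proof.
elim/ltn_ind: t i => -[|[|t]] IHt i iN.
- by rewrite addn0; case: (entry i) => [[p []] e].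
- rewrite addn1 in iN *; move=> rE.
  by have := entry_step iN; rewrite rE => /step_not_reverse.
move=> rE; have iN1 : i.+1 < N by lia.
have itN : (i + t.+1).+1 < N by lia.
have := entry_step itN; rewrite -addnS rE => back.
have := step_back (entry_valid _) (entry_valid _) (entry_step iN1) back.
move=> /(_ _ _) E; have := IHt t _ i.+1; rewrite addSnnS; apply; try lia.
by apply: E; lia.
Qed.

Lemma places_uniq : uniq [seq x.1.1 | x <- strand d].
Proof.
apply/(uniqP (0, 0)) => i j; rewrite !inE size_map -/N => iN jN.
wlog ij : i j iN jN / i <= j.
  by move=> H E; case: (leqP i j) => [/H->//|/ltnW/H H']; apply/esym/H'.
rewrite !(nth_map (start, None)) // -/(entry i) -/(entry j) => ijE.
case: (ltngtP i j) ij => // ij _.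
have : (entry j).1 = (entry i).1 \/ (entry j).1 = reverse (entry i).1.
  rewrite /reverse; case: (entry i) (entry j) ijE => [[p b] e] [[p' b'] e'] /= ->.
  by case: b b' => [] []; [left|right|right|left].
case=> E; first by case: (@entry_neq i j); rewrite ?ij.
by case: (@entry_neq_reverse (j - i) i); rewrite ?subnKC // ltnW.
Qed.

(** The walk has as many entries as there are positions, and they are distinct. *)
Lemma place_visited h i : h <= size d -> i < width h ->
  exists2 n, n < N & (entry n).1.1 = (h, i).
Proof.
move=> hd iw; pose all_places := [seq (h, i) | h <- iota 0 (size d).+1, i <- iota 0 (width h)].
have size_all : size all_places = N.
  rewrite /N size_strand /all_places size_allpairs_dep; congr sumn.
  apply: (@eq_from_nth _ 0); first by rewrite size_map size_iota size_widths.
  rewrite size_map size_iota => k kd.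
  by rewrite (nth_map 0) ?size_iota // nth_iota // add0n size_iota.
have sub : {subset [seq x.1.1 | x <- strand d] <= all_places}.
  move=> p /(nthP (0, 0))[n]; rewrite size_map -/N => nN.
  rewrite (nth_map (start, None)) // -/(entry n) => <-.
  have := entry_valid nN; case: (entry n).1 => [[h' i'] b] /andP[/= h'd i'w].
  by apply/allpairsPdep; exists h', i'; rewrite !mem_iota.
have le_size : size all_places <= size [seq x.1.1 | x <- strand d] by rewrite size_all size_map.
have [_ allE] := uniq_min_size places_uniq sub le_size.
have : (h, i) \in [seq x.1.1 | x <- strand d].
  rewrite allE.
  by apply/allpairsPdep; exists h, i; rewrite !mem_iota.
case/(nthP (0, 0)) => n; rewrite size_map -/N => nN.
by rewrite (nth_map (start, None)) //; exists n.
Qed.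

(** The two positions below a crossing are visited, and upwards: pointing downwards
    they could only be reached through the crossing, which is excluded. *)
Lemma visited_up h s j i : h < size d -> nth (Cup 0) d h = Cross s j ->
  (i == j) || (i == j.+1) ->
  exists2 n, n < N & (entry n).2 = Some (Pass h (if i == j then s else ~~ s)).
Proof.
move=> hd hE ij; have fE := fitsP hd; rewrite hE /= in fE.
have iw : i < width h by case/orP: ij => /eqP->; lia.
have [n nN] := place_visited (ltnW hd) iw.
case nE: (entry n) => [[p b] e] /= pE; rewrite {}pE in nE; exists n => //.
case: b nE => nE.
  have nN1 : n.+1 < N.
    case: (ltngtP n.+1 N) nN => // nN1 _; have := entry_stop.
    by rewrite -nN1 nE /= => -[hd']; rewrite hd' ltnn in hd.
  have := entry_step nN1; rewrite nE step_up hd hE /=.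
  case: (eqVneq i j) ij => [_ _|_ /= ->]; first by case=> <-.
  by case=> <-.
case: n nE nN => [|n] nE nN; first by have := entry_start; rewrite nE.
have := entry_step nN; rewrite nE; case: (entry n).1 => [[h' i'] []].
  rewrite step_up; case: ifP => // _; case E: (nth _ d h') => [j'|j'|s' j'] //.
    case: ifP => _; first by case=> _ hh; rewrite hh hE in E.
    by case: ifP => _ //; case=> _ hh; rewrite hh hE in E.
  by case: ifP => _ //; case: ifP.
case: h' => // h' /=; case E: (nth _ d h') => [j'|j'|s' j'].
- case: ifP => _ //; case: ifP => _ //.
  by case=> _ hh; rewrite hh hE in E.
- by case=> _ hh; rewrite hh hE in E.
- case: ifP => // ij' [_ hh ii]; rewrite hh hE in E; case: E => _ jj.
  by rewrite ii -jj ij in ij'.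
Qed.

Lemma passesE : passes d =
  pmap (fun x : place * option event => if x.2 is Some (Pass h o) then Some (h, o) else None)
    (strand d).
Proof.
rewrite /passes /events; elim: (strand d) => //= -[p [[h o|c]|]] s IHs //=.
by rewrite IHs.
Qed.

Lemma mem_passes h o n : n < N -> (entry n).2 = Some (Pass h o) -> (h, o) \in passes d.
Proof.
rewrite passesE /N /entry; elim: (strand d) n => // x s IHs [|n] /=.
  by move=> _ ->; rewrite mem_head.
move=> ns nE; have := IHs n ns nE; case: x => p [[h' o'|c]|] //= hs.
by rewrite in_cons hs orbT.
Qed.

(** Slots are indices in the list of passages, which are informative only for
    passages that occur in it. *)
Lemma crossing_slots c : c \in crossings d -> pass_slot d c.1 true != pass_slot d c.1 false.
Proof.
case: c => h s /=; rewrite /crossings.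
have -> : ((h, s) \in pmap (fun h => if nth (Cup 0) d h is Cross s _ then Some (h, s) else None)
    (iota 0 (size d))) =
  ((h < size d) && (if nth (Cup 0) d h is Cross s' _ then s == s' else false)).
  rewrite mem_pmap; apply/mapP/andP => [[h']|[hd]].
    rewrite mem_iota => h'd; case E: (nth _ d h') => [j|j|s' j] // [-> ->].
    by rewrite E.
  case E: (nth _ d h) => [j|j|s' j] // /eqP->; exists h; rewrite ?mem_iota //.
  by rewrite E.
case/andP => hd; case E: (nth _ d h) => [j|j|s' j] // _.
have [n1 n1N /mem_passes] := @visited_up h s' j j hd E (introT orP (or_introl (eqxx j))).
have [n2 n2N /mem_passes] := @visited_up h s' j j.+1 hd E (introT orP (or_intror (eqxx j.+1))).
rewrite eqxx (_ : (j.+1 == j) = false); last by lia.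
move=> /(_ n2N) p2 /(_ n1N) p1.
have both o : (h, o) \in passes d by case: o s' p1 p2 {E} => [] [].
apply/eqP => -[/double_inj ix].
by have := congr1 (nth (0, true) (passes d)) ix; rewrite !nth_index.
Qed.
End Strand.

Lemma long_knot_slots (K : long_knot) c : c \in crossings K ->
  pass_slot K c.1 true != pass_slot K c.1 false.
Proof.
case/and4P: (long_knotP K) => fK _ /eqP sK /eqP lK.
exact: crossing_slots.
Qed.

Import GRing.Theory.
Local Open Scope ring_scope.
Local Open Scope quotient_scope.

(** * Power series in hbar *)

(** Infinite sums and products of series are handled through this truncated
    equality, for which they are finite. *)
Definition eq_upto (A : Type) (N : nat) (f g : series A) : Prop :=
  forall n, (n < N)%N -> f n = g n.

Section Truncation.
Variable A : nzRingType.
Implicit Types f g h : series A.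

Lemma eq_uptoP f g : (forall N, eq_upto N f g) -> f = g.
Proof. by move=> fg; apply: seriesP => n; apply: (fg n.+1). Qed.

Lemma eq_upto_sym N f g : eq_upto N f g -> eq_upto N g f.
Proof. by move=> fg n /fg. Qed.

Lemma eq_upto_trans N g f h : eq_upto N f g -> eq_upto N g h -> eq_upto N f h.
Proof. by move=> fg gh n ltnN; rewrite fg ?gh. Qed.

Lemma eq_uptoW M N f g : (M <= N)%N -> eq_upto N f g -> eq_upto M f g.
Proof. by move=> leMN fg n ltnM; apply/fg/(leq_trans ltnM). Qed.

Lemma coefSB f g n : (f - g) n = f n - g n. Proof. by []. Qed.
Lemma coefSM f g n : (f * g) n = \sum_(i < n.+1) f i * g (n - i)%N.
Proof. by []. Qed.
Lemma coefS1 n : (1 : series A) n = (n == 0%N)%:R.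
Proof. by rewrite /=; case: eqP. Qed.

Lemma coef_ssum (F : nat -> series A) n : ssum F n = \sum_(m < n.+1) F m n.
Proof. by []. Qed.

Lemma coefS_sum I (r : seq I) (P : pred I) (F : I -> series A) n :
  (\sum_(i <- r | P i) F i) n = \sum_(i <- r | P i) F i n.
Proof. by elim/big_rec2: _ => //= i x y _ ->. Qed.

Lemma eq_uptoM N f f' g g' :
  eq_upto N f f' -> eq_upto N g g' -> eq_upto N (f * g) (f' * g').
Proof.
move=> ff gg n ltnN /=; apply: eq_bigr => i _; congr (_ * _).
  by apply/ff/(leq_ltn_trans _ ltnN); rewrite -ltnS.
by apply/gg/(leq_ltn_trans _ ltnN)/leq_subr.
Qed.

Lemma eq_upto_sum N I (r : seq I) (P : pred I) (F G : I -> series A) :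
  (forall i, P i -> eq_upto N (F i) (G i)) ->
  eq_upto N (\sum_(i <- r | P i) F i) (\sum_(i <- r | P i) G i).
Proof.
by move=> FG n ltnN; rewrite !coefS_sum; apply: eq_bigr => i Pi; apply: FG.
Qed.

Lemma eq_upto0D M N f g :
  eq_upto M f 0 -> eq_upto N g 0 -> eq_upto (M + N) (f * g) 0.
Proof.
move=> f0 g0 n ltn /=; apply: big1 => i _.
have [ltiM|leMi] := ltnP i M; first by rewrite f0 ?mul0r.
by rewrite g0 ?mulr0 //; have := ltn_ord i; lia.
Qed.

Lemma eq_upto0Ml N f g : eq_upto N f 0 -> eq_upto N (f * g) 0.
Proof. by move=> f0; rewrite -[N]addn0; apply: eq_upto0D. Qed.

Lemma eq_upto0Mr N f g : eq_upto N g 0 -> eq_upto N (f * g) 0.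
Proof. by move=> g0; rewrite -[N]add0n; apply: eq_upto0D. Qed.

Lemma eq_upto0X N f : f 0%N = 0 -> eq_upto N (f ^+ N) 0.
Proof.
move=> f0; elim: N => [//|N IHN]; rewrite exprS -add1n.
by apply: eq_upto0D => // -[].
Qed.

Lemma coef_hbarM f n : (hbar * f) n = if n is m.+1 then f m else 0.
Proof.
rewrite coefSM; case: n => [|n]; first by rewrite big_ord1 mul0r.
by rewrite 2!big_ord_recl /= mul0r mul1r add0r subn1 big1 ?addr0 // => i; rewrite mul0r.
Qed.

Lemma coef_Mhbar f n : (f * hbar) n = if n is m.+1 then f m else 0.
Proof.
rewrite coefSM; case: n => [|n]; first by rewrite big_ord1 mulr0.
rewrite 2!big_ord_recr /= subnn mulr0 addr0 subSnn mulr1 big1 ?add0r //.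
move=> i _; have ltin := ltn_ord i.
by rewrite (_ : (n.+1 - i == 1)%N = false) ?mulr0 //; lia.
Qed.

Lemma hbarC f : hbar * f = f * hbar.
Proof. by apply: seriesP => n; rewrite coef_hbarM coef_Mhbar. Qed.

Lemma hbarXC f n : hbar ^+ n * f = f * hbar ^+ n.
Proof. exact/esym/commrX/esym/hbarC. Qed.

Lemma hbarX_mulACA m n f g :
  hbar ^+ m * f * (hbar ^+ n * g) = hbar ^+ (m + n) * (f * g).
Proof. by rewrite -mulrA [f * _]mulrA -hbarXC -[hbar ^+ n * f * g]mulrA mulrA -exprD. Qed.

Lemma hbarX_mul3 m n f g h :
  hbar ^+ m * f * g * (hbar ^+ n * h) = hbar ^+ (m + n) * (f * g * h).
Proof. by rewrite -[hbar ^+ m * f * g]mulrA hbarX_mulACA. Qed.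

Lemma coef_hbarXM f m n :
  (hbar ^+ m * f) n = if (n < m)%N then 0 else f (n - m)%N.
Proof.
elim: m n => [|m IHm] [|n]; rewrite ?mul1r ?subn0 // exprS -mulrA coef_hbarM //.
Qed.

Lemma eq_upto0_hbarX f n : eq_upto n (hbar ^+ n * f) 0.
Proof. by move=> i ltin; rewrite coef_hbarXM ltin. Qed.

Lemma hbar_inj : injective (fun f => hbar * f).
Proof.
by move=> f g /= fg; apply: seriesP => n; move/(congr1 (fun h => scoef h n.+1)): fg;
  rewrite !coef_hbarM.
Qed.

Lemma hdivK f : f 0%N = 0 -> hbar * hdiv f = f.
Proof. by move=> f0; apply: seriesP => -[|n]; rewrite coef_hbarM. Qed.

Lemma ssum_upto (F : nat -> series A) N : (forall m, eq_upto m (F m) 0) ->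
  eq_upto N (ssum F) (\sum_(m < N) F m).
Proof.
move=> F0 n ltnN /=; rewrite coefS_sum.
rewrite (big_ord_widen N (fun m => F m n) ltnN).
rewrite big_mkcond; apply: eq_bigr => m _; case: ltnP => // ltnm.
by rewrite F0.
Qed.

Lemma ssum_upto0 (F : nat -> series A) N : (forall m, eq_upto N (F m) 0) -> eq_upto N (ssum F) 0.
Proof. by move=> F0 n ltnN /=; apply: big1 => m _; apply: F0. Qed.

Lemma eq_ssum (F G : nat -> series A) : (forall m, F m = G m) -> ssum F = ssum G.
Proof.
by move=> FG; apply: seriesP => n; apply: eq_bigr => m _; rewrite FG.
Qed.

Lemma ssum_mull g F : (forall m, eq_upto m (F m) 0) ->
  ssum (fun m => g * F m) = g * ssum F.
Proof.
move=> F0; apply: eq_uptoP => N; apply: (@eq_upto_trans _ (g * \sum_(m < N) F m)).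
  by rewrite mulr_sumr; apply: ssum_upto => m; apply: eq_upto0Mr.
by apply: eq_uptoM => //; apply/eq_upto_sym/ssum_upto.
Qed.

Lemma ssum_mulr g F : (forall m, eq_upto m (F m) 0) ->
  ssum (fun m => F m * g) = ssum F * g.
Proof.
move=> F0; apply: eq_uptoP => N; apply: (@eq_upto_trans _ ((\sum_(m < N) F m) * g)).
  by rewrite mulr_suml; apply: ssum_upto => m; apply: eq_upto0Ml.
by apply: eq_uptoM => //; apply/eq_upto_sym/ssum_upto.
Qed.

Fact sconst_is_zmod_morphism : zmod_morphism (@sconst A).
Proof. by move=> a b; apply: seriesP => -[|n] //=; rewrite subrr. Qed.

Fact sconst_is_monoid_morphism : monoid_morphism (@sconst A).
Proof.
split=> // a b; apply: seriesP => n.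
rewrite coefSM big_ord_recl subn0 big1 ?addr0 /=; last by move=> i _; rewrite mul0r.
by case: eqP; rewrite // mulr0.
Qed.
HB.instance Definition _ := GRing.isZmodMorphism.Build A (series A) (@sconst A)
  sconst_is_zmod_morphism.
HB.instance Definition _ := GRing.isMonoidMorphism.Build A (series A) (@sconst A)
  sconst_is_monoid_morphism.

Lemma sconstM (a b : A) : sconst (a * b) = sconst a * sconst b.
Proof. exact: rmorphM. Qed.

Lemma sconstD (a b : A) : sconst (a + b) = sconst a + sconst b.
Proof. exact: raddfD. Qed.

Lemma sconst0 : sconst (0 : A) = 0. Proof. exact: raddf0. Qed.

Lemma sconst1 : sconst (1 : A) = 1. Proof. by []. Qed.

Lemma coef_sconstM a f n : (sconst a * f) n = a * f n.
Proof.
rewrite coefSM big_ord_recl subn0 big1 ?addr0 //= => i _; exact: mul0r.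
Qed.

Lemma coef_Msconst a f n : (f * sconst a) n = f n * a.
Proof.
rewrite coefSM big_ord_recr subnn big1 ?add0r //= => [|i _]; rewrite ?add0r //.
by rewrite subn_eq0 leqNgt ltn_ord mulr0.
Qed.

Lemma coef_hbarX_sconst (a : A) m n : (hbar ^+ m * sconst a) n = if n == m then a else 0.
Proof.
rewrite coef_hbarXM; case: ltngtP => //= [ltmn|->]; last by rewrite subnn.
by rewrite subn_eq0 leqNgt ltmn.
Qed.

Lemma series_expand f : f = ssum (fun n => hbar ^+ n * sconst (f n)).
Proof.
apply: seriesP => n; rewrite coef_ssum big_ord_recr coef_hbarX_sconst eqxx.
rewrite big1 => [|i _]; first exact/esym/add0r.
by rewrite coef_hbarX_sconst (gtn_eqF (ltn_ord i)).
Qed.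

Lemma series_expand_upto f N :
  eq_upto N f (\sum_(n < N) hbar ^+ n * sconst (f n)).
Proof.
rewrite {1}[f]series_expand; apply: ssum_upto => m; exact: eq_upto0_hbarX.
Qed.

(** The geometric series. *)
Lemma sumX_upto f N : f 0%N = 0 ->
  eq_upto N ((1 - f) * ssum (fun n => f ^+ n)) 1.
Proof.
move=> f0; apply: (@eq_upto_trans _ ((1 - f) * \sum_(n < N) f ^+ n)).
  by apply: eq_uptoM => //; apply: ssum_upto => m; apply: eq_upto0X.
have -> : (1 - f) * \sum_(n < N) f ^+ n = 1 - f ^+ N.
  by rewrite -opprB mulNr -subrX1 opprB.
by move=> n ltnN; rewrite coefSB (eq_upto0X f0 ltnN) subr0.
Qed.

Lemma sinv_mulr (u : A) f : f 0%N * u = 1 -> u * f 0%N = 1 -> f * sinv u f = 1.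
Proof.
move=> fu uf; rewrite /sinv; set g := 1 - sconst u * f; set S := ssum _.
have g0 : g 0%N = 0 by rewrite coefSB coef_sconstM uf subrr.
have : sconst u * (f * S) = 1.
  rewrite mulrA -[sconst u * f](subKr 1) -/g.
  by apply: eq_uptoP => N; apply: sumX_upto.
move/(congr1 (fun h => sconst (f 0%N) * h * sconst u)).
by rewrite mulr1 mulrA -!sconstM fu sconst1 mul1r -mulrA.
Qed.

Lemma sinv_mull (u : A) f : f 0%N * u = 1 -> u * f 0%N = 1 -> sinv u f * f = 1.
Proof.
move=> fu uf; rewrite /sinv; set g := 1 - sconst u * f; set S := ssum _.
have g0 : g 0%N = 0 by rewrite coefSB coef_sconstM uf subrr.
have gS : GRing.comm g S.
  by rewrite /GRing.comm /S -ssum_mull -?ssum_mulr => [|m|m];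
    [apply: eq_ssum => m; rewrite -exprS exprSr|exact: eq_upto0X..].
rewrite -mulrA -[sconst u * f](subKr 1) -/g mulrBr mulr1 -gS -{1}[S]mul1r -mulrBl.
by apply: eq_uptoP => N; apply: sumX_upto.
Qed.

Lemma sinv1_mulr f : f 0%N = 1 -> f * sinv 1 f = 1.
Proof. by move=> f0; apply: sinv_mulr; rewrite f0 mulr1. Qed.

Lemma sinv1_mull f : f 0%N = 1 -> sinv 1 f * f = 1.
Proof. by move=> f0; apply: sinv_mull; rewrite f0 mulr1. Qed.

Lemma sinv1E f g : f 0%N = 1 -> f * g = 1 -> sinv 1 f = g.
Proof.
by move=> f0 fg; rewrite -[LHS]mulr1 -fg mulrA sinv1_mull // mul1r.
Qed.

Lemma coef0M f g : (f * g) 0%N = f 0%N * g 0%N.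
Proof. by rewrite coefSM big_ord1. Qed.

Lemma coef0X f n : (f ^+ n) 0%N = f 0%N ^+ n.
Proof. by elim: n => [//|n IHn]; rewrite !exprS coef0M IHn. Qed.

End Truncation.

Lemma smulC (A : comNzRingType) : commutative (@GRing.mul (series A)).
Proof.
move=> f g; apply: seriesP => n; rewrite !coefSM (reindex_inj rev_ord_inj) /=.
apply: eq_bigr => i _; rewrite mulrC subSS subKn //; exact: leq_ord.
Qed.
HB.instance Definition _ (A : comNzRingType) :=
  GRing.PzRing_hasCommutativeMul.Build (series A) (@smulC A).

Section Smap.
Variables (A B : nzRingType) (phi : {additive A -> B}).

Fact smap_is_zmod_morphism : zmod_morphism (smap phi).
Proof. by move=> f g; apply: seriesP => n; rewrite /= raddfB. Qed.
HB.instance Definition _ := GRing.isZmodMorphism.Build (series A) (series B)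
  (smap phi) smap_is_zmod_morphism.

Lemma smap_ssum F : smap phi (ssum F) = ssum (fun n => smap phi (F n)).
Proof. by apply: seriesP => n /=; rewrite raddf_sum. Qed.

Lemma smap_sconst a : smap phi (sconst a) = sconst (phi a).
Proof. by apply: seriesP => n /=; case: eqP => // _; rewrite raddf0. Qed.

Lemma smap_hbarX n f : smap phi (hbar ^+ n * f) = hbar ^+ n * smap phi f.
Proof.
apply: seriesP => i; transitivity (phi ((hbar ^+ n * f) i)); first by [].
by rewrite !coef_hbarXM; case: ifP => // _; rewrite raddf0.
Qed.

End Smap.

Section SmapRing.
Variables (A B : nzRingType) (phi : {rmorphism A -> B}).

Fact smap_is_monoid_morphism : monoid_morphism (smap phi).
Proof.
split=> [|f g]; first by rewrite -[RHS](rmorph1 (@sconst B)) -(rmorph1 phi) smap_sconst.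
by apply: seriesP => n; rewrite /= rmorph_sum; apply: eq_bigr => i _; rewrite rmorphM.
Qed.
HB.instance Definition _ := GRing.isMonoidMorphism.Build (series A) (series B)
  (smap phi) smap_is_monoid_morphism.

Lemma smap_hbar : smap phi hbar = hbar.
Proof. by apply: seriesP => n /=; rewrite rmorph_nat. Qed.

Lemma smap_sinv1 (f : series A) : f 0%N = 1 -> smap phi (sinv 1 f) = sinv 1 (smap phi f).
Proof.
move=> f0; apply/esym/sinv1E; first by rewrite /= f0 rmorph1.
by rewrite -rmorphM sinv1_mulr // rmorph1.
Qed.

Lemma smap_sexpz (f : series A) r : f 0%N = 1 -> smap phi (sexpz f r) = sexpz (smap phi f) r.
Proof. by move=> f0; case: r => n; rewrite /sexpz rmorphXn /= ?smap_sinv1. Qed.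

End SmapRing.

(** * Extending a ring morphism A -> B[[hbar]] to A[[hbar]] *)

(** The hbar-linear extension of rho, convergent because of the factors hbar^n. *)
Definition ext (A B : nzRingType) (rho : A -> series B) (f : series A) : series B :=
  ssum (fun n => hbar ^+ n * rho (f n)).

Section Ext.
Variables (A B : nzRingType) (rho : {additive A -> series B}).
Implicit Types f g : series A.
Local Notation ext := (ext rho).

Fact ext_is_zmod_morphism : zmod_morphism ext.
Proof.
move=> f g; apply: seriesP => n; rewrite coefSB !coef_ssum -sumrB; apply: eq_bigr => i _.
by rewrite coefSB raddfB mulrBr.
Qed.
HB.instance Definition _ := GRing.isZmodMorphism.Build (series A) (series B)
  ext ext_is_zmod_morphism.

Lemma ext_upto N f g : eq_upto N f g -> eq_upto N (ext f) (ext g).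
Proof.
move=> fg n ltnN /=; apply: eq_bigr => i _; rewrite fg //.
by apply: leq_ltn_trans ltnN; rewrite -ltnS.
Qed.

Lemma ext_hbarX_sconst n a : ext (hbar ^+ n * sconst a) = hbar ^+ n * rho a.
Proof.
apply: eq_uptoP => N; apply: (@eq_upto_trans _ _ (\sum_(m < N + n.+1)
   hbar ^+ m * rho ((hbar ^+ n * sconst a) m))).
  apply: (@eq_uptoW _ _ (N + n.+1)); first exact: leq_addr.
  by apply: ssum_upto => m; apply: eq_upto0_hbarX.
have ltn : (n < N + n.+1)%N by lia.
rewrite (bigD1 (Ordinal ltn)) // big1 ?addr0; last first.
  move=> i neq; have /negPf ni : (i : nat) != n := neq.
  by rewrite coef_hbarX_sconst ni raddf0 mulr0.
by rewrite coef_hbarX_sconst eqxx [X in eq_upto _ X]addr0.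
Qed.

Lemma ext_sconst a : ext (sconst a) = rho a.
Proof. by have := ext_hbarX_sconst 0 a; rewrite !mul1r. Qed.

End Ext.

Section ExtRing.
Variables (A B : nzRingType) (rho : {rmorphism A -> series B}).
Implicit Types f g : series A.
Local Notation ext := (ext rho).

Lemma ext_expand N f : eq_upto N (ext f) (\sum_(n < N) hbar ^+ n * rho (f n)).
Proof. by apply: ssum_upto => m; apply: eq_upto0_hbarX. Qed.

(** Up to hbar^N, both factors are finite sums of terms hbar^n a, on which rho is
    multiplicative, and hbar is central. *)
Fact ext_is_monoid_morphism : monoid_morphism ext.
Proof.
split=> [|f g]; first by rewrite -sconst1 ext_sconst; exact: rmorph1.
apply: eq_uptoP => N.
have fE : eq_upto N f (\sum_(n < N) hbar ^+ n * sconst (f n)).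
  exact: series_expand_upto.
have gE : eq_upto N g (\sum_(n < N) hbar ^+ n * sconst (g n)).
  exact: series_expand_upto.
apply: (eq_upto_trans (ext_upto rho (eq_uptoM fE gE))).
apply: (@eq_upto_trans _ _ ((\sum_(n < N) hbar ^+ n * rho (f n)) *
                            (\sum_(n < N) hbar ^+ n * rho (g n)))); last first.
  by apply: eq_uptoM; apply/eq_upto_sym/ext_expand.
rewrite !mulr_suml raddf_sum; apply: eq_upto_sum => i _.
rewrite !mulr_sumr raddf_sum; apply: eq_upto_sum => j _.
have E : ext (hbar ^+ i * sconst (f i) * (hbar ^+ j * sconst (g j))) =
         hbar ^+ i * rho (f i) * (hbar ^+ j * rho (g j)).
  rewrite !hbarX_mulACA -sconstM ext_hbarX_sconst; congr (_ * _); exact: rmorphM.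
by move=> n _; rewrite -E.
Qed.
HB.instance Definition _ := GRing.isMonoidMorphism.Build (series A) (series B)
  ext ext_is_monoid_morphism.

Lemma ext_coef0 f : (ext f) 0%N = rho (f 0%N) 0%N.
Proof. by rewrite coef_ssum big_ord1 expr0 mul1r. Qed.

Lemma ext_hbar : ext hbar = hbar.
Proof.
transitivity (hbar * rho 1); last by rewrite (rmorph1 rho) mulr1.
by rewrite -(ext_hbarX_sconst rho 1 1) sconst1 mulr1.
Qed.

Lemma ext_hbarM f : ext (hbar * f) = hbar * ext f.
Proof. by rewrite rmorphM /= ext_hbar. Qed.

Lemma ext_hdiv f : f 0%N = 0 -> ext (hdiv f) = hdiv (ext f).
Proof.
move=> f0; apply: hbar_inj; rewrite -ext_hbarM !hdivK //.
by rewrite ext_coef0 f0 (raddf0 rho).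
Qed.

Lemma ext_sinv1 f : f 0%N = 1 -> ext (sinv 1 f) = sinv 1 (ext f).
Proof.
move=> f0; apply/esym/sinv1E; first by rewrite ext_coef0 f0 (rmorph1 rho).
by rewrite -rmorphM sinv1_mulr // rmorph1.
Qed.

Lemma ext_sexpz f r : f 0%N = 1 -> ext (sexpz f r) = sexpz (ext f) r.
Proof. by move=> f0; case: r => n; rewrite /sexpz rmorphXn /= ?ext_sinv1. Qed.

End ExtRing.

(** * Closed ideals *)

(** A predicate, since some of the ideals below are not presented by relations: the
    preimage of an ideal under a morphism, and [null]. *)
Record closed_ideal (A : nzRingType) (I : series A -> Prop) : Prop := ClosedIdeal {
  closed_ideal0 : I 0;
  closed_idealD : forall f g, I f -> I g -> I (f + g);
  closed_idealM : forall h1 h2 f, I f -> I (h1 * f * h2);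
  closed_ideal_lim : forall f, (forall N, exists2 g, I g & eq_upto N f g) -> I f
}.

Definition continuous (A B : nzRingType) (Phi : series A -> series B) : Prop :=
  forall N f g, eq_upto N f g -> eq_upto N (Phi f) (Phi g).

Lemma forall_in_cons (T : eqType) (P : T -> Prop) a (s : seq T) :
  P a -> {in s, forall r, P r} -> {in a :: s, forall r, P r}.
Proof. by move=> Pa Ps r; rewrite in_cons => /predU1P[->|/Ps]. Qed.

Lemma forall_in_nil (T : eqType) (P : T -> Prop) : {in [::] : seq T, forall r, P r}.
Proof. by []. Qed.

Section ClosedIdeal.
Variables (A : nzRingType) (I : series A -> Prop).
Hypothesis cI : closed_ideal I.
Implicit Types f g h : series A.

Lemma closed_idealMl h f : I f -> I (h * f).
Proof. by move=> If; rewrite -[_ * _]mulr1; apply: closed_idealM. Qed.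

Lemma closed_idealMr h f : I f -> I (f * h).
Proof. by move=> If; rewrite -[f]mul1r; apply: closed_idealM. Qed.

Lemma closed_idealN f : I f -> I (- f).
Proof. by move=> If; rewrite -mulN1r; apply: closed_idealMl. Qed.

Lemma closed_idealB f g : I f -> I g -> I (f - g).
Proof. by move=> If Ig; apply: closed_idealD => //; apply: closed_idealN. Qed.

Lemma closed_ideal_sum J (r : seq J) (P : pred J) (F : J -> series A) :
  (forall i, P i -> I (F i)) -> I (\sum_(i <- r | P i) F i).
Proof.
by move=> IF; elim/big_ind: _ => //; [apply: closed_ideal0|apply: closed_idealD].
Qed.

Lemma closed_ideal_ssum (F : nat -> series A) :
  (forall n, eq_upto n (F n) 0) -> (forall n, I (F n)) -> I (ssum F).
Proof.
move=> F0 IF; apply: closed_ideal_lim => // N; exists (\sum_(n < N) F n).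
  by apply: closed_ideal_sum.
exact: ssum_upto.
Qed.

Lemma cong_mul f f' g g' : I (f - f') -> I (g - g') -> I (f * g - f' * g').
Proof.
move=> If Ig; rewrite -(subrKA (f' * g)) -mulrBl -mulrBr.
by apply: closed_idealD => //; [apply: closed_idealMr|apply: closed_idealMl].
Qed.

Lemma cong_sinv1 f g : f 0%N = 1 -> g 0%N = 1 ->
  I (f - g) -> I (sinv 1 f - sinv 1 g).
Proof.
move=> f0 g0 fg.
have -> : sinv 1 f - sinv 1 g = sinv 1 f * (g - f) * sinv 1 g.
  by rewrite mulrBr mulrBl sinv1_mull // mul1r -mulrA sinv1_mulr // mulr1.
by apply: closed_idealM => //; rewrite -opprB; apply: closed_idealN.
Qed.

(** A closed ideal contains the closed ideal of rels as soon as it contains rels. *)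
Lemma closed_ideal_presented rels f :
  {in rels, forall r, I r} -> in_closed_ideal rels f -> I f.
Proof.
move=> Irels If; apply: closed_ideal_lim => // N; have [g [s sP ->] fg] := If N.
exists (\sum_(t <- s) t.1.1 * t.1.2 * t.2) => //.
rewrite big_seq; apply: closed_ideal_sum => t ts; apply: closed_idealM => //.
by apply/Irels/(allP sP).
Qed.

End ClosedIdeal.

Lemma closed_ideal_preim (A B : nzRingType) (Phi : {rmorphism series A -> series B}) I :
  continuous Phi -> closed_ideal I -> closed_ideal (fun f => I (Phi f)).
Proof.
move=> cPhi cI; split=> [|f g|h1 h2 f|f lim].
- by rewrite rmorph0; apply: closed_ideal0.
- by rewrite rmorphD; apply: closed_idealD.
- by rewrite !rmorphM; apply: closed_idealM.
- apply: (closed_ideal_lim cI) => N; have [g Ig fg] := lim N.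
  by exists (Phi g) => //; apply: cPhi.
Qed.

Section Presented.
Variables (A : nzRingType) (rels : seq (series A)).
Implicit Types f g h : series A.

Lemma in_closed_ideal_closed : closed_ideal (in_closed_ideal rels).
Proof.
split; [exact: in_closed_ideal0|exact: in_closed_idealD|exact: in_closed_idealM|].
move=> f lim N; have [g /(_ N)[h Ih gh] fg] := lim N; exists h => //.
by move=> i ltiN; rewrite fg ?gh.
Qed.

Lemma in_closed_ideal_rel r : r \in rels -> in_closed_ideal rels r.
Proof.
move=> r_rel N; exists r => //; exists [:: (1, r, 1)]; first by rewrite /= r_rel.
by rewrite big_seq1 mul1r mulr1.
Qed.

Definition proj f : presented rels := \pi f.

Fact proj_is_zmod_morphism : zmod_morphism proj.
Proof. by move=> f g; rewrite /proj !piE. Qed.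
Fact proj_is_monoid_morphism : monoid_morphism proj.
Proof. by split=> [|f g]; rewrite /proj !piE. Qed.
HB.instance Definition _ := GRing.isZmodMorphism.Build (series A) (presented rels)
  proj proj_is_zmod_morphism.
HB.instance Definition _ := GRing.isMonoidMorphism.Build (series A) (presented rels)
  proj proj_is_monoid_morphism.

Lemma projP f g : proj f = proj g <-> in_closed_ideal rels (f - g).
Proof. by split=> [/eqP/presentedP|/presentedP/eqP]. Qed.

Lemma proj_rel f g : f - g \in rels -> proj f = proj g.
Proof. by move=> fg; apply/projP/in_closed_ideal_rel. Qed.

Lemma proj_comm f g h : (f * g - g * f) - h \in rels ->
  proj f * proj g - proj g * proj f = proj h.
Proof. by move=> /proj_rel <-; rewrite rmorphB !rmorphM. Qed.

Lemma proj_swap f g : f * g - g * f \in rels -> proj f * proj g = proj g * proj f.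
Proof. by move=> /proj_rel; rewrite !rmorphM. Qed.

Lemma proj_commN f g h : (f * g - g * f) + h \in rels ->
  proj f * proj g - proj g * proj f = - proj h.
Proof. by rewrite -{1}[h]opprK => /proj_comm ->; rewrite rmorphN. Qed.

(** The projection commutes with infinite sums, in the only form that makes sense
    without a topology on the quotient. *)
Lemma proj_ssum (F G : nat -> series A) :
  (forall n, eq_upto n (F n) 0) -> (forall n, eq_upto n (G n) 0) ->
  (forall n, proj (F n) = proj (G n)) -> proj (ssum F) = proj (ssum G).
Proof.
move=> F0 G0 FG; apply/projP.
have -> : ssum F - ssum G = ssum (fun n => F n - G n).
  by apply: seriesP => n; rewrite coefSB !coef_ssum -sumrB.
apply: (closed_ideal_ssum in_closed_ideal_closed) => n.
  by move=> i ltin; rewrite coefSB F0 ?G0 ?subr0.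
by apply/projP.
Qed.

(** An identity between two series in a presented algebra can be checked
    coefficientwise, although the quotient has no coefficients. *)
Lemma proj_coef f g : (forall n, proj (sconst (f n)) = proj (sconst (g n))) ->
  proj f = proj g.
Proof.
move=> fg; rewrite [f]series_expand [g]series_expand; apply: proj_ssum => n.
- exact: eq_upto0_hbarX.
- exact: eq_upto0_hbarX.
- by rewrite !rmorphM /= fg.
Qed.

End Presented.

(** * Series over an algebra *)

Section SeriesAlgebra.
Variables (k : comNzRingType) (A : algType k).
Implicit Types f g : series A.

Definition sscale (c : k) f : series A := Series (fun n => c *: f n).

Fact sscaleA a b f : sscale a (sscale b f) = sscale (a * b) f.
Proof. by apply: seriesP => n; apply: scalerA. Qed.
Fact sscale1 : left_id 1 sscale.
Proof. by move=> f; apply: seriesP => n; apply: scale1r. Qed.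
Fact sscaleDr : right_distributive sscale +%R.
Proof. by move=> c f g; apply: seriesP => n; apply: scalerDr. Qed.
Fact sscaleDl f : {morph sscale^~ f : a b / a + b}.
Proof. by move=> a b; apply: seriesP => n; apply: scalerDl. Qed.
HB.instance Definition _ := GRing.Zmodule_isLmodule.Build k (series A)
  sscaleA sscale1 sscaleDr sscaleDl.

Fact sscaleAl c f g : c *: (f * g) = c *: f * g.
Proof.
by apply: seriesP => n; rewrite /= scaler_sumr; apply: eq_bigr => i _; rewrite scalerAl.
Qed.
HB.instance Definition _ := GRing.Lmodule_isLalgebra.Build k (series A) sscaleAl.

Fact sscaleAr c f g : c *: (f * g) = f * (c *: g).
Proof.
by apply: seriesP => n; rewrite /= scaler_sumr; apply: eq_bigr => i _; rewrite scalerAr.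
Qed.
HB.instance Definition _ := GRing.Lalgebra_isAlgebra.Build k (series A) sscaleAr.

Lemma coefSZ c f n : (c *: f) n = c *: f n. Proof. by []. Qed.

Lemma sconstZ c a : sconst (c *: a) = c *: sconst a.
Proof. by apply: seriesP => n; rewrite coefSZ /=; case: eqP; rewrite // scaler0. Qed.

End SeriesAlgebra.

Section Scal.
Variables (k : comUnitRingType) (A : algType k).
Implicit Types (c d : series k) (f : series A).

Lemma scalE c : scal A c = smap (in_alg A) c. Proof. by []. Qed.

Lemma scalM c d : scal A (c * d) = scal A c * scal A d.
Proof. by rewrite !scalE rmorphM. Qed.

Lemma scal1 : scal A 1 = 1.
Proof. by rewrite scalE rmorph1. Qed.

Lemma scalX c n : scal A (c ^+ n) = scal A c ^+ n.
Proof. by rewrite !scalE rmorphXn. Qed.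

Lemma scal_hbar : scal A hbar = hbar.
Proof. by rewrite scalE smap_hbar. Qed.

Lemma scalC c f : scal A c * f = f * scal A c.
Proof.
apply: seriesP => n; rewrite !coefSM (reindex_inj rev_ord_inj) /=.
apply: eq_bigr => i _; rewrite subSS subKn; last exact: leq_ord.
by rewrite -scalerAl -scalerAr mul1r mulr1.
Qed.

Lemma scal_sconst a : scal A (sconst a) = a%:A.
Proof. by rewrite scalE smap_sconst /= sconstZ. Qed.

Lemma scal_sconstM a f : scal A (sconst a) * f = a *: f.
Proof. by rewrite scal_sconst -scalerAl mul1r. Qed.
End Scal.

(** * Free algebras *)

Section FreeAlg.
Variables (k : comUnitRingType) (X : choiceType).
Implicit Types (f g : freealg k X) (w : seq X).

Lemma wordM w1 w2 : word k w1 * word k w2 = word k (w1 ++ w2).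
Proof.
rewrite /word [LHS]malgM_def fgmulUU mulr1; congr (<< _ *g _ >>).
by apply/val_inj; rewrite /= fmM.
Qed.

Lemma word0 : word k [::] = 1 :> freealg k X.
Proof. by rewrite /word; congr (<< _ *g _ >>); apply/val_inj; rewrite /= fm1. Qed.

Lemma word_prod w : word k w = \prod_(x <- w) word k [:: x].
Proof.
elim: w => [|x w IHw]; first by rewrite big_nil word0.
by rewrite big_cons -IHw wordM.
Qed.

Lemma freealgE f : f = \sum_(w <- msupp f) f@_w *: word k w.
Proof.
rewrite {1}[f]monalgE; apply: eq_bigr => w _.
by rewrite -mul_malgC malgM_def fgmulUU mulr1 mul1m; congr (<< _ *g _ >>); case: w.
Qed.

Lemma freealg_ind (P : freealg k X -> Prop) :
  P 0 -> (forall f g, P f -> P g -> P (f + g)) ->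
  (forall c w, P (c *: word k w)) -> forall f, P f.
Proof.
by move=> P0 PD PZ f; rewrite [f]freealgE; elim/big_ind: _ => // w _; apply: PZ.
Qed.

Lemma malg_scaleAr (c : k) (f g : {malg k[{fmonom X}]}) : c *: (f * g) = f * (c *: g).
Proof.
apply/malgP => w; rewrite mcoeffZ.
rewrite [in LHS](mcoeffMlw w (fsubset_refl (msupp f)) (fsubset_refl (msupp g))).
rewrite [RHS](mcoeffMlw w (fsubset_refl (msupp f)) (msuppZ_le c g)).
rewrite mulr_sumr; apply: eq_bigr => v _; rewrite mulr_sumr; apply: eq_bigr => u _.
by rewrite mcoeffZ mulrCA mulrnAr.
Qed.

Fact freealg_scaleAr (c : k) f g : c *: (f * g) = f * (c *: g).
Proof. exact: malg_scaleAr. Qed.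
HB.instance Definition _ := GRing.Lalgebra_isAlgebra.Build k (freealg k X)
  freealg_scaleAr.
End FreeAlg.

Lemma mmap_scale (K : choiceType) (R S : nzRingType) (f : {rmorphism R -> S})
    (h : K -> S) c (g : {malg R[K]}) : mmap f h (c *: g) = f c * mmap f h g.
Proof.
rewrite (mmapEw (msuppZ_le c g)) mmapE mulr_sumr; apply: eq_bigr => w _.
by rewrite mcoeffZ mulrA; congr (_ * _); exact: (rmorphM f).
Qed.

Section FreeEval.
Variables (k : comUnitRingType) (k' : comNzRingType) (tau : {rmorphism k -> k'}).
Variables (X : choiceType) (B : algType k') (l : X -> B).
Implicit Types (f g : freealg k X) (w : seq X).

Definition eval_word (w : {fmonom X}) : B := \prod_(x <- (w : seq X)) l x.

Fact eval_word_is_mmorphism : mmorphism eval_word.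
Proof.
by split=> [v w|]; rewrite /eval_word ?fmM ?big_cat // fm1 big_nil.
Qed.
HB.instance Definition _ := isMultiplicative.Build _ _ eval_word
  eval_word_is_mmorphism.

Definition feval f : B := mmap (in_alg B \o tau) eval_word f.

Lemma feval_scale_word c w : feval (c *: word k w) = tau c *: \prod_(x <- w) l x.
Proof.
by rewrite /feval mmap_scale mmapU /= rmorph1 scale1r mul1r -scalerAl mul1r.
Qed.

Lemma feval_word w : feval (word k w) = \prod_(x <- w) l x.
Proof. by rewrite -[word k w]scale1r feval_scale_word rmorph1 scale1r. Qed.

Lemma fevalZ c f : feval (c *: f) = tau c *: feval f.
Proof. by rewrite /feval mmap_scale /= -scalerAl mul1r. Qed.

Fact feval_is_zmod_morphism : zmod_morphism feval.
Proof. exact: mmap_is_additive. Qed.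
HB.instance Definition _ := GRing.isZmodMorphism.Build (freealg k X) B
  feval feval_is_zmod_morphism.

Fact feval_is_monoid_morphism : monoid_morphism feval.
Proof.
have comm_tau (g : {malg k[{fmonom X}]}) (m m' : {fmonom X}) :
    GRing.comm ((in_alg B \o tau) g@_m) (eval_word m').
  by rewrite /GRing.comm /= -scalerAl -scalerAr mul1r mulr1.
have [M o] := commr_mmap_is_multiplicative comm_tau.
by split.
Qed.
HB.instance Definition _ := GRing.isMonoidMorphism.Build (freealg k X) B
  feval feval_is_monoid_morphism.

Lemma feval_letter x : feval (word k [:: x]) = l x.
Proof. by rewrite feval_word big_seq1. Qed.

End FreeEval.

Section OnWords.
Variables (k : comUnitRingType) (X Y : choiceType) (phi : seq X -> seq Y).
Implicit Types (f g : freealg k X) (w : seq X).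

Lemma on_wordsE : @on_words k X Y phi =
  mmap (in_alg (freealg k Y)) (fun w : {fmonom X} => word k (phi w)).
Proof.
by apply/funext => f; apply: eq_bigr => w _; rewrite /= -scalerAl mul1r.
Qed.

Fact on_words_is_zmod_morphism : zmod_morphism (@on_words k X Y phi).
Proof. by rewrite on_wordsE; apply: mmap_is_additive. Qed.
HB.instance Definition _ := GRing.isZmodMorphism.Build (freealg k X) (freealg k Y)
  (@on_words k X Y phi) on_words_is_zmod_morphism.

Lemma on_wordsZ c f : on_words phi (c *: f) = c *: on_words phi f.
Proof. by rewrite on_wordsE mmap_scale /= -scalerAl mul1r. Qed.

Lemma on_words_word w : on_words phi (word k w) = word k (phi w).
Proof. by rewrite on_wordsE mmapU /= scale1r mul1r. Qed.
End OnWords.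

(** The maps to be compared are semilinear along various changes of scalars tau,
    and those that merge slots are not multiplicative; so this is an
    extensionality principle in terms of words rather than of letters. *)
Lemma freealg_ext (k : comUnitRingType) (X : choiceType) (k' : pzRingType)
    (V : lmodType k') (tau : k -> k') (F G : {additive freealg k X -> V}) :
  (forall c f, F (c *: f) = tau c *: F f) -> (forall c f, G (c *: f) = tau c *: G f) ->
  (forall w, F (word k w) = G (word k w)) -> F =1 G.
Proof.
move=> FZ GZ FG f; elim/freealg_ind: f => [|f g IHf IHg|c w]; first by rewrite !raddf0.
  by rewrite 2!raddfD; apply: congr2.
by rewrite FZ GZ FG.
Qed.

Section Rename.
Variables (k k' : comUnitRingType) (tau : {rmorphism k -> k'}).
Variables (X Y : choiceType) (h : X -> Y).

(** The scalars change from Q[epsilon] to Q together with the letters. *)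
Definition rename : freealg k X -> freealg k' Y :=
  feval tau (fun x => word k' [:: h x]).
HB.instance Definition _ := GRing.RMorphism.on rename.

Lemma rename_word w : rename (word k w) = word k' (map h w).
Proof. by rewrite /rename feval_word [RHS]word_prod big_map. Qed.

Lemma renameZ c f : rename (c *: f) = tau c *: rename f.
Proof. exact: fevalZ. Qed.
End Rename.

Lemma on_words_map (k : comUnitRingType) (X Y : choiceType) (h : X -> Y) :
  on_words (map h) =1 rename idfun h :> (freealg k X -> freealg k Y).
Proof.
apply: (@freealg_ext _ _ _ _ idfun) => [c f|c f|w]; first exact: on_wordsZ.
  exact: renameZ.
by rewrite [LHS]on_words_word [RHS]rename_word.
Qed.

(** * Exponentials *)

Lemma coef0_hexp (k : comUnitRingType) (A : lalgType k) (z : A) : hexp z 0%N = 1.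
Proof. by rewrite /= expr0 invr1 scale1r. Qed.

Section Hexp.
Variable A : algType rat.
Implicit Types z w : A.

Lemma natr_fact_neq0 n : (n`!%:R : rat) != 0.
Proof. by rewrite Num.Theory.pnatr_eq0 -lt0n fact_gt0. Qed.

Lemma coef_hexp z n : hexp z n = (n`!%:R^-1 : rat) *: z ^+ n. Proof. by []. Qed.

(** The binomial theorem.  Only the images of z and w under p are assumed to
    commute, since in a free algebra nothing commutes before projecting. *)
Lemma rmorph_coef_hexpD (P : pzRingType) (p : {rmorphism A -> P}) z w n :
  GRing.comm (p z) (p w) ->
  p (hexp (z + w) n) = \sum_(i < n.+1) p (hexp z i) * p (hexp w (n - i)%N).
Proof.
move=> zw; pose c (a : rat) := p a%:A.
have pZ a x : p (a *: x) = c a * p x.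
  by rewrite /c -rmorphM -scalerAl mul1r.
have cC a x : c a * p x = p x * c a.
  by rewrite /c -!rmorphM -scalerAl -scalerAr mul1r mulr1.
have cM a b : c (a * b) = c a * c b.
  by rewrite /c -rmorphM -scalerAl mul1r scalerA.
rewrite coef_hexp pZ rmorphXn rmorphD exprDn_comm // mulr_sumr.
rewrite (reindex_inj rev_ord_inj) /=; apply: eq_bigr => i _.
have lein := leq_ord i; rewrite subSS subKn // bin_sub //.
have cX a : c a * p z ^+ i = p z ^+ i * c a by rewrite -rmorphXn; apply: cC.
rewrite !pZ !rmorphXn -mulrA [p z ^+ i * (_ * _)]mulrA -cX -mulrA mulrA -cM.
set x := p z ^+ i * _.
have -> : x *+ 'C(n, i) = c 'C(n, i)%:R * x.
  by rewrite /c scaler_nat rmorphMn rmorph1 mulr_natl.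
rewrite mulrA -cM; congr (c _ * _).
have := bin_fact lein; move/(congr1 (fun m => m%:R : rat)); rewrite !natrM => E.
have n0 := natr_fact_neq0 n; have i0 := natr_fact_neq0 i.
have ni0 := natr_fact_neq0 (n - i).
apply: (mulfI n0); rewrite mulVKf // -{1}E.
by field; rewrite i0 ni0.
Qed.

Lemma hexpD z w : GRing.comm z w -> hexp (z + w) = hexp z * hexp w.
Proof.
move=> zw; apply: seriesP => n.
by have := @rmorph_coef_hexpD A idfun z w n zw; rewrite /= => ->.
Qed.

Lemma comm_scale (a b : rat) z : GRing.comm (a *: z) (b *: z).
Proof. by rewrite /GRing.comm -!scalerAl -!scalerAr scalerA mulrC -scalerA. Qed.

Lemma hexp0 : hexp (0 : A) = 1.
Proof.
apply: seriesP => n; rewrite coef_hexp coefS1; case: n => [|n].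
  by rewrite expr0 invr1 scale1r.
by rewrite expr0n scaler0.
Qed.

Lemma hexpN z : hexp z * hexp (- z) = 1.
Proof.
by rewrite -hexpD ?subrr ?hexp0 //; apply/commrN.
Qed.

Section Quotient.
Variable rels : seq (series A).
Local Notation p := (proj rels).

Lemma proj_hexpD z w : GRing.comm (p (sconst z)) (p (sconst w)) ->
  p (hexp (z + w)) = p (hexp z) * p (hexp w).
Proof.
move=> zw; rewrite -rmorphM; apply: proj_coef => n.
have := @rmorph_coef_hexpD _ (p \o @sconst A) z w n zw; rewrite [LHS]/= => ->.
rewrite coefSM (rmorph_sum (@sconst A)) rmorph_sum; apply: eq_bigr => i _ /=.
by rewrite -rmorphM -sconstM.
Qed.

(** If f z = w f, then f z^n = w^n f for all n. *)
Lemma proj_hexp_comm f z w : p f * p (sconst z) = p (sconst w) * p f ->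
  p f * p (hexp z) = p (hexp w) * p f.
Proof.
move=> fz; rewrite -!rmorphM [hexp z]series_expand [hexp w]series_expand.
rewrite -ssum_mull -?ssum_mulr; first apply: proj_ssum => n; try move=> m.
- exact/eq_upto0Mr/eq_upto0_hbarX.
- exact/eq_upto0Ml/eq_upto0_hbarX.
- rewrite mulrA -hbarXC -!mulrA !(rmorphM _ (hbar ^+ n)); congr (_ * _).
  rewrite !coef_hexp !sconstZ -scalerAl -scalerAr -!scal_sconstM !(rmorphM _ (scal _ _)).
  congr (_ * _); rewrite !rmorphM !rmorphXn /=.
  elim: n => [|n IHn]; first by rewrite !expr0 mulr1 mul1r.
  by rewrite exprSr mulrA IHn -mulrA fz exprSr !mulrA.
- exact: eq_upto0_hbarX.
- exact: eq_upto0_hbarX.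
Qed.

Lemma proj_hexp_scale_comm a b z :
  p (sconst (a *: z)) * p (hexp (b *: z)) = p (hexp (b *: z)) * p (sconst (a *: z)).
Proof.
by apply: proj_hexp_comm; rewrite -!(rmorphM (proj _)) -!sconstM comm_scale.
Qed.

(** If f has weight u under z, that is z f = f z + u f, then f z = (z - u) f, so
    that f exp(hbar z) = exp(hbar (z - u)) f, and u commutes with z. *)
Lemma proj_hexp_shift f z u :
  p (sconst z) * p f - p f * p (sconst z) = p (sconst u) * p f ->
  GRing.comm (p (sconst u)) (p (sconst z)) ->
  p f * p (hexp z) = p (hexp (- u)) * p (hexp z) * p f.
Proof.
move=> zf uz; rewrite -proj_hexpD; last first.
  by rewrite raddfN /= [p (- _)]raddfN; apply/commr_sym/commrN/commr_sym.
apply: proj_hexp_comm; rewrite sconstD (raddfN (@sconst A)) rmorphD rmorphN mulrDl mulNr -zf.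
by rewrite opprB /= subrK.
Qed.

Lemma proj_scaleE c f : p (c *: f) = p c%:A * p f.
Proof. by rewrite -rmorphM -scalerAl mul1r. Qed.

Lemma proj_scale_comm c f : p c%:A * p f = p f * p c%:A.
Proof. by rewrite -!rmorphM -scalerAl -scalerAr mul1r mulr1. Qed.

Lemma proj_commZ d (f g h : series A) : p f * p g - p g * p f = p h ->
  p (d *: f) * p g - p g * p (d *: f) = p (d *: h).
Proof.
move=> fg; rewrite [RHS]proj_scaleE -fg mulrBr !mulrA -proj_scaleE.
by congr (_ - _); rewrite proj_scale_comm // -mulrA -proj_scaleE.
Qed.

Lemma proj_hexp_weight c d z f :
  p (sconst z) * p f - p f * p (sconst z) = p (c *: f) ->
  p f * p (hexp (d *: z)) = p (hexp (- (d * c))%:A) * p (hexp (d *: z)) * p f.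
Proof.
move=> /(proj_commZ d); rewrite -sconstZ scalerA => zf; rewrite scaleNr.
apply: proj_hexp_shift; first by rewrite zf proj_scaleE sconstZ.
by rewrite sconstZ; apply: proj_scale_comm.
Qed.
End Quotient.
End Hexp.

Lemma scal_kexp (A : algType rat) (r : rat) : scal A (kexp r) = hexp r%:A.
Proof.
apply: seriesP => n; rewrite coef_hexp /=.
by rewrite mulrC -scalerA -[r%:A]/(in_alg A r) -rmorphXn.
Qed.

(** What makes exponentials over k meaningful. *)
Definition fact_unit (k : unitRingType) := forall n, n`!%:R \is a @GRing.unit k.

Lemma fact_unit_rat : fact_unit rat.
Proof. by move=> n; rewrite unitfE natr_fact_neq0. Qed.

Lemma fact_unit_poly : fact_unit {poly rat}.
Proof.
by move=> n; rewrite -polyC_natr poly_unitE size_polyC coefC natr_fact_neq0 /= fact_unit_rat.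
Qed.

Section HexpMap.
Variables (k : comUnitRingType) (tau : {rmorphism k -> rat}) (A : algType k) (B : algType rat).
Hypothesis dk : fact_unit k.

Lemma rmorph_invfact n : tau (n`!%:R^-1) = n`!%:R^-1.
Proof. by rewrite rmorphV ?dk // rmorph_nat. Qed.

Lemma smap_hexp (phi : {rmorphism A -> B}) z :
  (forall c a, phi (c *: a) = tau c *: phi a) -> smap phi (hexp z) = hexp (phi z).
Proof.
by move=> phiZ; apply: seriesP => n; rewrite /= phiZ rmorphXn rmorph_invfact.
Qed.

Lemma smap_kexp z : smap tau (kexp z) = kexp (tau z).
Proof. by apply: seriesP => n; rewrite /= rmorphM rmorphXn rmorph_invfact. Qed.

Lemma smap_scal (phi : {rmorphism A -> B}) c :
  (forall c a, phi (c *: a) = tau c *: phi a) ->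
  smap phi (scal A c) = scal B (smap tau c).
Proof. by move=> phiZ; apply: seriesP => n; rewrite /= phiZ rmorph1. Qed.
End HexpMap.

Section HexpExt.
Variables (A B : algType rat) (rho : {rmorphism A -> series B}).
Hypothesis rhoZ : forall c a, rho (c *: a) = c *: rho a.

Lemma ext_hexp z w : rho z = sconst w -> ext rho (hexp z) = hexp w.
Proof.
move=> rz; rewrite [RHS]series_expand; apply: eq_ssum => n.
by rewrite coef_hexp rhoZ rmorphXn /= rz -rmorphXn -sconstZ.
Qed.

Lemma extZ c f : ext rho (c *: f) = c *: ext rho f.
Proof.
apply: seriesP => n; rewrite coefSZ !coef_ssum scaler_sumr; apply: eq_bigr => i _.
by rewrite coefSZ rhoZ -scalerAr.
Qed.

Lemma ext_scal c : ext rho (scal A c) = scal B c.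
Proof.
rewrite [RHS]series_expand; apply: eq_ssum => n.
by rewrite /= rhoZ rmorph1 sconstZ.
Qed.
End HexpExt.

(** * Multiplying tensor factors in the order of their labels *)

Section Flatten.
Variable X : eqType.
Implicit Types (u v : seq (X * nat)) (w : seq X).

Definition by_slot : rel (X * nat) := relpre snd leq.

Definition flat u : seq X := map fst (sort by_slot u).

Lemma by_slot_total : total by_slot.
Proof. by move=> x y; apply: leq_total. Qed.

Lemma by_slot_trans : transitive by_slot.
Proof. by move=> y x z; apply: leq_trans. Qed.

Lemma sorted_split s u : sorted by_slot u ->
  u = [seq x <- u | x.2 < s]%N ++ [seq x <- u | x.2 == s] ++ [seq x <- u | s < x.2]%N.
Proof.
elim: u => //= x u IHu xu.
have /IHu uE := path_sorted xu.
have lexu : all (by_slot x) u by apply: order_path_min xu; apply: by_slot_trans.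
case: ltngtP => /= sx; first by rewrite {1}uE.
- have none (P : pred nat) : (forall i, P i -> (i <= s)%N) ->
    [seq y <- u | P y.2] = [::].
    move=> Ps; apply/eqP; rewrite -[_ == _]negbK -has_filter -all_predC.
    apply: sub_all lexu => y lexy /=; apply: contraTN (leq_trans sx lexy) => Py.
    by rewrite -leqNgt Ps.
  rewrite (none (fun i => i < s)%N) => [|i /ltnW //].
  rewrite (none (eq_op^~ s)) => [|i /eqP-> //] /=.
  by congr (_ :: _); apply/esym/all_filterP; apply: sub_all lexu => y; apply: leq_trans.
- have -> : [seq y <- u | (y.2 < s)%N] = [::].
    apply/eqP; rewrite -[_ == _]negbK -has_filter -all_predC.
    by apply: sub_all lexu => y lexy /=; rewrite -leqNgt -sx.
  congr (_ :: _); rewrite {1}uE.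
  suff -> : [seq y <- u | (y.2 < s)%N] = [::] by [].
  apply/eqP; rewrite -[_ == _]negbK -has_filter -all_predC.
  by apply: sub_all lexu => y lexy /=; rewrite -leqNgt -sx.
Qed.

Definition flat_left s u v : seq X :=
  map fst [seq x <- sort by_slot (u ++ v) | x.2 < s]%N ++
  map fst [seq x <- u | x.2 == s].

Definition flat_right s u v : seq X :=
  map fst [seq x <- v | x.2 == s] ++
  map fst [seq x <- sort by_slot (u ++ v) | s < x.2]%N.

Lemma filter_slot (P : pred nat) s w :
  [seq x <- [seq (x, s) | x <- w] | P x.2] = if P s then [seq (x, s) | x <- w] else [::].
Proof. by elim: w => [|x w /= ->]; case: (P s). Qed.

Lemma sort_filter_slot s u : sort by_slot [seq x <- u | x.2 == s] = [seq x <- u | x.2 == s].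
Proof.
apply: sorted_sort; first exact: by_slot_trans.
elim: u => //= x u IHu; case: eqP => //= xs; rewrite path_sortedE; last exact: by_slot_trans.
rewrite IHu andbT; apply/allP => y; rewrite mem_filter => /andP[/eqP ys _].
by rewrite /by_slot /= xs ys.
Qed.

(** Sorting is stable, so the letters of one slot end up together and in their
    original order; what surrounds them does not depend on w.  Hence relations
    within one slot survive merging. *)
Lemma flat_slot s u w v :
  flat (u ++ [seq (x, s) | x <- w] ++ v) = flat_left s u v ++ w ++ flat_right s u v.
Proof.
have fs := filter_sort by_slot_total by_slot_trans.
rewrite /flat (sorted_split s (sort_sorted by_slot_total _)) /flat_left /flat_right.
rewrite !fs sort_filter_slot !filter_cat.
rewrite (filter_slot (fun i => i < s)%N) (filter_slot (eq_op^~ s)).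
rewrite (filter_slot (fun i => s < i)%N).
rewrite ltnn eqxx /= !map_cat -!map_comp (@eq_map _ _ _ id) // map_id !catA.
by [].
Qed.

(** Adjacent letters of distinct slots commute after sorting: isolating the slot of
    x, the position of y only matters to the two surrounding words, which are
    obtained by filtering x out. *)
Lemma flat_swap x y u v : x.2 != y.2 ->
  flat (u ++ [:: x; y] ++ v) = flat (u ++ [:: y; x] ++ v).
Proof.
move=> neq; case: x neq => x s /= neq.
have -> : u ++ [:: (x, s); y] ++ v = u ++ [seq (z, s) | z <- [:: x]] ++ (y :: v) by [].
have -> : u ++ [:: y; (x, s)] ++ v = (rcons u y) ++ [seq (z, s) | z <- [:: x]] ++ v.
  by rewrite cat_rcons.
rewrite !flat_slot /flat_left /flat_right cat_rcons filter_rcons /=.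
by rewrite eq_sym (negPf neq).
Qed.
End Flatten.

Lemma flat_map (X Y : eqType) (h : X -> Y) (w : seq (X * nat)) :
  flat [seq (h x.1, x.2) | x <- w] = map h (flat w).
Proof.
rewrite /flat /by_slot sort_map -!map_comp; congr (map _ (sort _ w)).
Qed.

(** * The slot algebra *)

Lemma mul_regroup (R : pzRingType) (a b c d e : R) :
  a * (b * c * d) * e = (a * b) * c * (d * e).
Proof. by rewrite !mulrA. Qed.

Section Merge.
Variables (k : comUnitRingType) (X : choiceType).
Implicit Types (f : series (freealg k (X * nat)%type)).

Definition merge : series (freealg k (X * nat)%type) -> series (freealg k X) :=
  smap (@on_words k _ _ (@flat X)).
HB.instance Definition _ := GRing.Additive.on merge.

Lemma coef_merge f n : merge f n = on_words (@flat X) (f n).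
Proof. by []. Qed.

Lemma merge_hbarX n f : merge (hbar ^+ n * f) = hbar ^+ n * merge f.
Proof. exact: smap_hbarX. Qed.

Lemma mergeZ c f : merge (c *: f) = c *: merge f.
Proof. by apply: seriesP => i; apply: on_wordsZ. Qed.

Lemma merge_word w : merge (sconst (word k w)) = sconst (word k (flat w)).
Proof. by rewrite /merge smap_sconst /= on_words_word. Qed.
End Merge.

Lemma merge_rename (k k' : comUnitRingType) (tau : {rmorphism k -> k'})
    (X Y : choiceType) (h : X -> Y) f :
  merge (smap (rename tau (fun x : X * nat => (h x.1, x.2))) f) =
  smap (rename tau h) (merge f).
Proof.
apply: seriesP => n; rewrite /merge /=; move: (f n) => {f}.
have := @freealg_ext k (X * nat)%type k' (freealg k' Y) tau
  (on_words (@flat Y) \o rename tau (fun x : X * nat => (h x.1, x.2)))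
  (rename tau h \o on_words (@flat X)); apply=> [c f|c f|w].
- exact: etrans (congr1 _ (renameZ _ _ _ _)) (on_wordsZ _ _ _).
- exact: etrans (congr1 _ (on_wordsZ _ _ _)) (renameZ _ _ _ _).
- by rewrite [LHS]/= [RHS]/= rename_word !on_words_word rename_word flat_map.
Qed.

(** Truncated series are combinations of words; this is the corresponding
    induction principle, for properties that are closed in the hbar-adic sense. *)
Lemma series_free_ind (k : comUnitRingType) (X : choiceType)
    (Q : series (freealg k X) -> Prop) :
  Q 0 -> (forall f g, Q f -> Q g -> Q (f + g)) ->
  (forall f, (forall N, exists2 g, Q g & eq_upto N f g) -> Q f) ->
  (forall n c w, Q (c *: (hbar ^+ n * sconst (word k w)))) ->
  forall f, Q f.
Proof.
move=> Q0 QD Qlim Qw f; apply: Qlim => N.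
exists (\sum_(n < N) hbar ^+ n * sconst (f n)); last exact: series_expand_upto.
elim/big_ind: _ => // n _; elim/freealg_ind: (f n) => [|g1 g2 Q1 Q2|c w].
- by rewrite sconst0 mulr0.
- by rewrite sconstD mulrDr; apply: QD.
- by rewrite sconstZ -scalerAr; apply: Qw.
Qed.

Section Null.
Variables (B : algType rat) (I : series B -> Prop).
Hypothesis cI : closed_ideal I.
Local Notation T := (series B).
Local Notation S := (series (freealg rat (T * nat)%type)).

(** The tautological map: letters of this free algebra are themselves series over
    B, and ev multiplies them in B[[hbar]]. *)
Definition ev : series (freealg rat T) -> T := ext (feval idfun (fun t : T => t)).
HB.instance Definition _ := GRing.RMorphism.on ev.

Lemma ev_gen t : ev (gen rat t) = t.
Proof. exact: etrans (ext_sconst _ _) (feval_letter _ _ _). Qed.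

Lemma evZ c f : ev (c *: f) = c *: ev f.
Proof. by apply: extZ => {}c t; apply: fevalZ. Qed.

Let emD (f g : S) : ev (merge (f + g)) = ev (merge f) + ev (merge g).
Proof. by rewrite (raddfD (@merge rat _)) (raddfD ev). Qed.

Let em0 : ev (merge (0 : S)) = 0.
Proof. by rewrite (raddf0 (@merge rat _)) (raddf0 ev). Qed.

Let em_upto N (f g : S) : eq_upto N f g -> eq_upto N (ev (merge f)) (ev (merge g)).
Proof.
by move=> fg; apply: ext_upto => n ltnN; apply: (congr1 (on_words _)); apply: fg.
Qed.

(** Quantifying over the multipliers u and v makes this an ideal, the largest one
    whose elements merge into I, although merging is not multiplicative. *)
Definition null (f : S) : Prop := forall u v : S, I (ev (merge (u * f * v))).

Lemma null_closed : closed_ideal null.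
Proof.
split=> [u v|f g nf ng u v|h1 h2 f nf u v|f lim u v].
- by rewrite mulr0 mul0r em0; apply: closed_ideal0.
- by rewrite mulrDr mulrDl emD; apply: closed_idealD.
- have -> : u * (h1 * f * h2) * v = (u * h1) * f * (h2 * v); last exact: nf.
  by move: (u : S) h1 (f : S) h2 v => a b c d e; exact: mul_regroup.
- apply: (closed_ideal_lim cI) => N; have [g ng fg] := lim N.
  exists (ev (merge (u * g * v))); first exact: ng.
  exact: em_upto (eq_uptoM (eq_uptoM (fun _ _ => erefl) fg) (fun _ _ => erefl)).
Qed.

(** By bilinearity and continuity of u f v in u and v, multipliers that are words
    suffice. *)
Lemma null_words (f : S) :
  (forall u v, I (ev (merge (sconst (word rat u) * f * sconst (word rat v))))) -> null f.
Proof.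
have IZ c (t : T) : I t -> I (c *: t).
  by move=> It; rewrite -[t]mul1r scalerAl; apply: closed_idealMl.
have Ilim (h : S -> S) : (forall N u u', eq_upto N u u' -> eq_upto N (h u) (h u')) ->
    forall u, (forall N, exists2 g, I (ev (merge (h g))) & eq_upto N u g) -> I (ev (merge (h u))).
  move=> hN u lim; apply: (closed_ideal_lim cI) => N; have [g ig ug] := lim N.
  exists (ev (merge (h g))); first exact: ig.
  exact/em_upto/hN.
move=> Iw u v; elim/series_free_ind: u => [|u1 u2 I1 I2|u lim|n c u].
- by rewrite !mul0r em0; apply: closed_ideal0.
- by rewrite !mulrDl emD; apply: closed_idealD.
- apply: (Ilim (fun u => u * f * v)) lim => N u1 u2 u12.
  exact: eq_uptoM (eq_uptoM u12 (fun _ _ => erefl)) (fun _ _ => erefl).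
elim/series_free_ind: v => [|v1 v2 I1 I2|v lim|m d v].
- by rewrite !mulr0 em0; apply: closed_ideal0.
- by rewrite !mulrDr emD; apply: closed_idealD.
- by apply: Ilim lim => N v1 v2 v12; apply: eq_uptoM (fun _ _ => erefl) v12.
rewrite -!scalerAl -scalerAr mergeZ evZ mergeZ evZ; apply/IZ/IZ.
rewrite hbarX_mul3 merge_hbarX rmorphM.
exact: closed_idealMl.
Qed.

(** One algebra is put into a single slot s. *)
Definition in_slot (s : nat) : series (freealg rat T) -> S :=
  smap (rename idfun (fun t : T => (t, s))).
HB.instance Definition _ s := GRing.RMorphism.on (in_slot s).

Lemma merge_in_slot s u f v :
  merge (sconst (word rat u) * in_slot s f * sconst (word rat v)) =
  sconst (word rat (flat_left s u v)) * f * sconst (word rat (flat_right s u v)).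
Proof.
apply: seriesP => n; rewrite coef_Msconst coef_sconstM.
rewrite coef_merge coef_Msconst coef_sconstM [in_slot s f n]/=; move: (f n) => {}f.
elim/freealg_ind: f => [|f g IHf IHg|c w].
- by rewrite (raddf0 (rename _ _)) !mulr0 !mul0r (raddf0 (on_words _)).
- rewrite (raddfD (rename _ _)) 2!mulrDr 2!mulrDl (raddfD (on_words _)).
  exact: (congr2 +%R IHf IHg).
- rewrite renameZ -!scalerAr -!scalerAl on_wordsZ; congr (_ *: _).
  by rewrite rename_word !wordM on_words_word -!catA flat_slot /flat_left -!catA.
Qed.

(** The relations hold in each slot ([flat_slot]). *)
Lemma null_in_slot s f : I (ev f) -> null (in_slot s f).
Proof.
move=> If; apply: null_words => u v; rewrite merge_in_slot !rmorphM.
exact: closed_idealM.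
Qed.

Lemma null_words_eq (f g : S) :
  (forall u v, merge (sconst (word rat u) * f * sconst (word rat v)) =
               merge (sconst (word rat u) * g * sconst (word rat v))) -> null (f - g).
Proof.
move=> fg; apply: null_words => u v; rewrite mulrBr mulrBl.
have -> : merge (sconst (word rat u) * f * sconst (word rat v) -
                 sconst (word rat u) * g * sconst (word rat v)) = 0.
  apply: etrans (raddfB (@merge rat _) _ _) _.
  exact: etrans (congr1 (fun h => h - _) (fg u v)) (subrr _).
by rewrite (raddf0 ev); apply: closed_ideal0.
Qed.

Lemma genM (x y : T * nat) : gen rat x * gen rat y = sconst (word rat [:: x; y]).
Proof. by rewrite /gen -sconstM wordM. Qed.

Lemma merge_word3 (u w v : seq (T * nat)) :
  merge (sconst (word rat u) * sconst (word rat w) * sconst (word rat v)) =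
  sconst (word rat (flat (u ++ w ++ v))).
Proof. by rewrite -sconstM wordM -sconstM wordM merge_word -catA. Qed.

(** Distinct slots behave like distinct tensor factors ([flat_swap]). *)
Lemma null_comm (t t' : T) s s' : s != s' ->
  null (gen rat (t, s) * gen rat (t', s') - gen rat (t', s') * gen rat (t, s)).
Proof.
move=> neq; have swap u v :
    merge (sconst (word rat u) * (gen rat (t, s) * gen rat (t', s')) * sconst (word rat v)) =
    merge (sconst (word rat u) * (gen rat (t', s') * gen rat (t, s)) * sconst (word rat v)).
  have E x y : merge (sconst (word rat u) * (gen rat x * gen rat y) * sconst (word rat v)) =
               sconst (word rat (flat (u ++ [:: x; y] ++ v))).
    by rewrite genM merge_word3.
  by apply: etrans (E _ _) (etrans _ (esym (E _ _))); rewrite (@flat_swap _ (t, s)).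
exact: null_words_eq swap.
Qed.

End Null.

(** * The homomorphism from D to quantum sl2 *)

Local Notation Useries := (series (freealg rat Ugen)).
Local Notation at_eps1 := (horner_eval (1 : rat)).

Definition word_H : freealg rat Ugen := word rat [:: UH].

(** The images of x, A and B in terms of K = q^(H/2): A and B go to K^(-1), and x to
    ((q^(1/2) - q^(-1/2)) / hbar) K^(-1) E. *)
Definition phi_gen (g : Dgen) : Useries :=
  match g with
  | Dy => gen rat UF
  | Db | Da => sconst ((1 / 2 : rat) *: word_H)
  | Dx => scal _ Uden * hexp (- (1 / 2) *: word_H) * gen rat UE
  end.

Lemma kexp0E (r : rat) : kexp r 0%N = 1.
Proof. by rewrite /= expr0 invr1 mulr1. Qed.

Lemma Uden0 : Uden 0%N = 1.
Proof.
by rewrite /Uden /qpow /hdiv /= !expr1 /= (_ : 1`! = 1%N) // invr1.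
Qed.

(** phi in two steps: first every letter g becomes the single letter phi_gen g, then
    these letters are multiplied.  The first step makes sense for tensor
    factors that are still unmultiplied. *)
Definition spell : series (freealg {poly rat} Dgen) -> series (freealg rat Useries) :=
  smap (rename at_eps1 phi_gen).
HB.instance Definition _ := GRing.RMorphism.on spell.

Definition phi : series (freealg {poly rat} Dgen) -> Useries := @ev _ \o spell.
HB.instance Definition _ := GRing.RMorphism.on phi.

Lemma spell_sconst a : spell (sconst a) = sconst (rename at_eps1 phi_gen a).
Proof. exact: smap_sconst. Qed.

Lemma phi_genE g : phi (gen _ g) = phi_gen g.
Proof.
have E : rename at_eps1 phi_gen (word {poly rat} [:: g]) = word rat [:: phi_gen g].
  exact: rename_word.
rewrite -(ev_gen (phi_gen g)) /phi /= /gen spell_sconst.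
by rewrite E.
Qed.

Lemma phi_scal c : phi (scal _ c) = scal _ (smap at_eps1 c).
Proof.
have -> : phi (scal _ c) = ev (scal _ (smap at_eps1 c)).
  by congr ev; apply: smap_scal => d a; apply: renameZ.
by apply: ext_scal => d a; apply: fevalZ.
Qed.

Lemma phi_sconst z : phi (sconst z) = feval idfun id (rename at_eps1 phi_gen z).
Proof. exact: etrans (congr1 (@ev _) (spell_sconst z)) (ext_sconst _ _). Qed.

Lemma phi_hexp z w : phi (sconst z) = sconst w -> phi (hexp z) = hexp w.
Proof.
rewrite phi_sconst => zw.
have E : spell (hexp z) = hexp (rename at_eps1 phi_gen z).
  by apply: (smap_hexp fact_unit_poly) => c a; apply: renameZ.
apply: etrans (congr1 (@ev _) E) _.
by apply: ext_hexp => // c a; apply: fevalZ.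
Qed.

Lemma phi_sconstZ c a : phi (sconst (c *: a)) = c.[1] *: phi (sconst a).
Proof.
rewrite 2!phi_sconst; apply: etrans (congr1 _ (renameZ _ _ _ _)) _.
exact: fevalZ.
Qed.

Lemma phi_hdiv (f : series (freealg {poly rat} Dgen)) :
  f 0%N = 0 -> phi (hdiv f) = hdiv (phi f).
Proof.
move=> f0.
have E : (spell f) 0%N = 0.
  by apply: etrans (congr1 (rename at_eps1 phi_gen) f0) _; apply: raddf0.
exact: etrans (erefl (ev (hdiv (spell f)))) (ext_hdiv _ E).
Qed.

Definition qH (r : rat) : Useries := hexp (r *: word_H).

Lemma phi_A : phi (hexp (- ('X : {poly rat}) *: word {poly rat} [:: Da])) = qH (- (1 / 2)).
Proof.
apply: phi_hexp; rewrite phi_sconstZ hornerN hornerX.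
apply: etrans (congr1 _ (phi_genE Da)) _.
by rewrite -sconstZ scalerA mulN1r.
Qed.

Lemma phi_B : phi (hexp (- word {poly rat} [:: Db])) = qH (- (1 / 2)).
Proof.
rewrite -[- word _ _]scaleN1r; apply: phi_hexp; rewrite phi_sconstZ hornerN hornerC.
apply: etrans (congr1 _ (phi_genE Db)) _.
by rewrite -sconstZ scalerA mulN1r.
Qed.

Lemma phi_spin : phi Dspin = Uspin.
Proof.
apply: phi_hexp; rewrite phi_sconstZ.
have c2 : (- (2%:R^-1 : {poly rat})).[1] = - (1 / 2) :> rat.
  by rewrite hornerN mul1r; congr (- _); apply: (rmorph_invfact at_eps1 fact_unit_poly 2).
rewrite c2 sconstD.
have phiD f g : phi (f + g) = phi f + phi g by apply: raddfD.
rewrite phiD phi_sconstZ hornerX scale1r.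
have -> : phi (sconst (word {poly rat} [:: Da])) + phi (sconst (word {poly rat} [:: Db])) =
  phi_gen Da + phi_gen Db := congr2 +%R (phi_genE Da) (phi_genE Db).
by rewrite /phi_gen -sconstD -scalerDl -sconstZ scalerA; congr (sconst (_ *: _)).
Qed.

(** With c = (q^(1/2) - q^(-1/2)) / hbar and L = K^(-1), moving f to the left past L
    costs qi, whence the q-commutator of c L e and f is c L [e, f]. *)
Lemma rel_xy (P : pzRingType) (c ci q qi L e f h : P) :
  c * ci = 1 -> q * qi = 1 -> c * f = f * c -> qi * c = c * qi ->
  c * L = L * c ->
  f * L = qi * L * f -> e * f - f * e = ci * h ->
  c * L * e * f = q * f * (c * L * e) + L * h.
Proof.
move=> cci qqi cf qic cL fL ef.
have -> : q * f * (c * L * e) = c * L * (f * e).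
  transitivity (q * (f * c) * L * e); first by rewrite !mulrA.
  transitivity (q * c * (f * L) * e); first by rewrite -cf !mulrA.
  transitivity (q * (c * qi) * L * f * e); first by rewrite fL !mulrA.
  by rewrite -qic !mulrA qqi mul1r.
apply/eqP; rewrite addrC -subr_eq; apply/eqP.
by rewrite -mulrA -mulrBr ef cL mulrA -(mulrA L) cci mulr1.
Qed.

(** K^(-1) (K - K^(-1)) = 1 - K^(-2), divided by hbar. *)
Lemma hdiv_inverse (A : nzRingType) (K L : series A) :
  K 0%N = 1 -> L 0%N = 1 -> L * K = 1 -> L * hdiv (K - L) = hdiv (1 - L * L).
Proof.
move=> K0 L0 LK; apply: hbar_inj; rewrite mulrA hbarC -mulrA hdivK; last first.
  by rewrite coefSB K0 L0 subrr.
rewrite hdivK; last by rewrite coefSB coefS1 coef0M L0 mulr1 subrr.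
by rewrite mulrBr LK.
Qed.

Lemma qH0 r : qH r 0%N = 1.
Proof. exact: coef0_hexp. Qed.

Lemma qH_inv : qH (- (1 / 2)) * qH (1 / 2) = 1.
Proof. by have := hexpN (- (1 / 2) *: word_H); rewrite -scaleNr opprK. Qed.

Local Notation p := (proj Urel).
Local Notation gU g := (gen rat (g : Ugen)).

Lemma scaler2 (A : algType rat) (f : series A) : 2%:R * f = (2%:R : rat) *: f.
Proof. by rewrite mulr_natl scaler_nat. Qed.

Lemma Urel_HE : p (sconst word_H) * p (gU UE) - p (gU UE) * p (sconst word_H) =
  p ((2%:R : rat) *: gU UE).
Proof. by apply: proj_comm; rewrite -scaler2 mem_head. Qed.

Lemma Urel_HF : p (sconst word_H) * p (gU UF) - p (gU UF) * p (sconst word_H) =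
  p ((- 2%:R : rat) *: gU UF).
Proof.
rewrite scaleNr [RHS](raddfN (@proj _ Urel)).
by apply: proj_commN; rewrite -scaler2 in_cons mem_head orbT.
Qed.

Lemma Urel_EF : p (gU UE) * p (gU UF) - p (gU UF) * p (gU UE) =
  p (scal _ (sinv 1 Uden)) * p (hdiv (qH (1 / 2) - qH (- (1 / 2)))).
Proof.
rewrite -[RHS](rmorphM (@proj _ Urel)).
by apply: proj_comm; rewrite 2!in_cons mem_head !orbT.
Qed.

(** The element phi(x) = c L e has the weight of its last factor, because the
    factors c and L commute with h. *)
Lemma weight_scaled (P : pzRingType) (h c L e : P) :
  h * c = c * h -> h * L = L * h -> h * e - e * h = e ->
  h * (c * L * e) - (c * L * e) * h = c * L * e.
Proof.
move=> hc hL he.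
have -> : h * (c * L * e) = c * L * (h * e).
  by rewrite !mulrA hc -(mulrA c h L) hL !mulrA.
by rewrite -(mulrA (c * L)) -mulrBr he.
Qed.

Lemma half_weight (x : Useries) c d : (1 / 2) * c = d ->
  p (sconst word_H) * p x - p x * p (sconst word_H) = p (c *: x) ->
  p (sconst ((1 / 2 : rat) *: word_H)) * p x - p x * p (sconst ((1 / 2 : rat) *: word_H)) =
  p (d *: x).
Proof. by move=> <- /(proj_commZ (1 / 2)); rewrite -sconstZ scalerA. Qed.

Lemma halfH_F : p (phi_gen Da) * p (phi_gen Dy) - p (phi_gen Dy) * p (phi_gen Da) =
  - p (phi_gen Dy).
Proof.
rewrite -[RHS](raddfN (@proj _ Urel)) -scaleN1r.
by apply: half_weight Urel_HF; field.
Qed.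

Lemma halfH_x : p (phi_gen Da) * p (phi_gen Dx) - p (phi_gen Dx) * p (phi_gen Da) =
  p (phi_gen Dx).
Proof.
have E : p (phi_gen Dx) = p (scal _ Uden) * p (qH (- (1 / 2))) * p (gU UE).
  by rewrite -2!rmorphM.
rewrite E; apply: weight_scaled.
- by rewrite -2!rmorphM scalC.
- exact: proj_hexp_scale_comm.
- by rewrite -[RHS](congr1 p (scale1r _)); apply: half_weight Urel_HE; field.
Qed.

Lemma F_qH : p (gU UF) * p (qH (- (1 / 2))) =
  p (scal _ (kexp (-1))) * p (qH (- (1 / 2))) * p (gU UF).
Proof.
have := proj_hexp_weight (- (1 / 2)) Urel_HF.
rewrite scal_kexp; suff -> : - (- (1 / 2) * - 2%:R) = -1 :> rat by [].
by field.
Qed.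

Lemma kexpD (r s : rat) : kexp (r + s) = kexp r * kexp s.
Proof.
have E t : kexp t = @hexp _ rat^o t.
  by apply: seriesP => n; rewrite /= mulrC.
by rewrite !E; exact: (@hexpD rat^o r s (mulrC r s)).
Qed.

Lemma kexp0 : kexp (0 : rat) = 1.
Proof.
apply: seriesP => -[|n]; first exact: kexp0E.
by rewrite /= expr0n mul0r.
Qed.

Lemma phi_xy :
  p (phi_gen Dx) * p (phi_gen Dy) = p (scal _ (kexp 1)) * p (phi_gen Dy) * p (phi_gen Dx) +
   p (hdiv (1 - qH (- (1 / 2)) * qH (- (1 / 2)))).
Proof.
rewrite -(hdiv_inverse (qH0 (1 / 2)) (qH0 _) qH_inv).
have pE f g : p (f * g) = p f * p g by apply: rmorphM.
have E : p (phi_gen Dx) = p (scal _ Uden) * p (qH (- (1 / 2))) * p (gU UE).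
  by rewrite -2!pE.
rewrite [X in _ = _ + X]pE.
rewrite E.
have uden : p (scal _ Uden) * p (scal _ (sinv 1 Uden)) = 1.
  by rewrite -pE -scalM (sinv1_mulr Uden0) scal1 rmorph1.
have qq : p (scal _ (kexp 1)) * p (scal _ (kexp (-1))) = 1.
  by rewrite -pE -scalM -kexpD subrr kexp0 scal1 rmorph1.
have pC c f : p (scal _ c) * p f = p f * p (scal _ c) by rewrite -2!pE scalC.
exact: rel_xy uden qq (pC _ _) (pC _ _) (pC _ _) F_qH Urel_EF.
Qed.

(** The relation of x and y is that of E and F ([rel_xy]), and a and b have half the
    weights of H, which are 2 and - 2. *)
Lemma phi_rels : {in Drel, forall r, in_closed_ideal Urel (phi r)}.
Proof.
pose pp : {rmorphism series (freealg {poly rat} Dgen) -> presented Urel} :=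
  (@proj _ Urel) \o phi.
suff H : {in Drel, forall r, pp r = 0}.
  by move=> r /H pr0; rewrite -[phi r]subr0; apply/projP; rewrite rmorph0.
have ppg g : pp (gen _ g) = p (phi_gen g) by apply: (congr1 p (phi_genE g)).
have ppe : pp (scal _ (sconst 'X)) = 1.
  apply: etrans (congr1 p (phi_scal _)) _.
  have -> : smap at_eps1 (sconst ('X : {poly rat})) = 1.
    by rewrite smap_sconst /= /horner_eval hornerX.
  by rewrite scal1 rmorph1.
have ppq : pp (scal _ (kexp 'X)) = p (scal _ (kexp 1)).
  apply: etrans (congr1 p (phi_scal _)) _.
  by rewrite (smap_kexp _ fact_unit_poly) /= /horner_eval hornerX.
have gx := ppg Dx; have gy := ppg Dy; have ga := ppg Da; have gb := ppg Db.
have comm_rel (R : nzRingType) (P : pzRingType) (f : {rmorphism R -> P}) x y z :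
  f x * f y - f y * f x = f z -> f (x * y - y * x - z) = 0.
  by move=> E; rewrite !rmorphB !rmorphM E subrr.
have comm_relN (R : nzRingType) (P : pzRingType) (f : {rmorphism R -> P}) x y z :
  f x * f y - f y * f x = - f z -> f (x * y - y * x + z) = 0.
  by move=> E; rewrite rmorphD rmorphB !rmorphM E addNr.
have coef0_1subM (A : nzRingType) (x y : series A) :
  x 0%N = 1 -> y 0%N = 1 -> (1 - x * y) 0%N = 0.
  by move=> x0 y0; rewrite coefSB coef0M x0 y0 mulr1 subrr.
have map_1subM (R P : pzRingType) (f : {rmorphism R -> P}) x y :
  f (1 - x * y) = 1 - f x * f y by rewrite rmorphB rmorph1 rmorphM.
have comm0_rel (R : nzRingType) (P : pzRingType) (f : {rmorphism R -> P}) x y :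
  f x = f y -> f (x * y - y * x) = 0.
  by move=> E; rewrite rmorphB !rmorphM E subrr.
have xy_rel (R : nzRingType) (P : pzRingType) (f : {rmorphism R -> P}) x y q d :
  f x * f y = f q * f y * f x + f d -> f (x * y - (q * y * x + d)) = 0.
  by move=> E; rewrite rmorphB rmorphD !rmorphM E subrr.
rewrite /Drel; apply: forall_in_cons.
  apply: xy_rel.
  rewrite ppq gx gy; apply: etrans phi_xy _; congr (_ + p _).
  apply: esym; apply: etrans (phi_hdiv _) _.
    exact: coef0_1subM (coef0_hexp _) (coef0_hexp _).
  apply: (congr1 (@hdiv _)); apply: etrans (map_1subM _ _ phi _ _) _.
  have congr_1sub (a a' b b' : Useries) : a = a' -> b = b' -> 1 - a * b = 1 - a' * b'.
    by move=> -> ->.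
  apply: congr_1sub; [exact: phi_A|exact: phi_B].
apply: forall_in_cons.
  by apply: comm_rel; rewrite ga gx; apply: halfH_x.
apply: forall_in_cons.
  by apply: comm_rel; rewrite rmorphM ppe mul1r gb gx; apply: halfH_x.
apply: forall_in_cons.
  by apply: comm_relN; rewrite ga gy; apply: halfH_F.
apply: forall_in_cons.
  by apply: comm_relN; rewrite rmorphM ppe mul1r gb gy; apply: halfH_F.
apply: forall_in_cons; last exact: forall_in_nil.
by apply: comm0_rel; rewrite ga gb.
Qed.

(** * The R-matrix *)

Lemma kexp_natmul (r : rat) n : kexp (n%:R * r) = kexp r ^+ n.
Proof.
elim: n => [|n IHn]; first by rewrite mul0r kexp0.
by rewrite -natr1 mulrDl mul1r kexpD IHn exprSr.
Qed.

(** The quantum integers of D at eps = 1; they differ from the symmetric ones by a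
    power of q. *)
Definition D1int (n : nat) : series rat := \sum_(i < n) kexp 1 ^+ i.
Definition D1fact (n : nat) : series rat := \prod_(i < n) D1int i.+1.

Lemma smap_Dfact n : smap at_eps1 (Dfact n) = D1fact n.
Proof.
rewrite /Dfact rmorph_prod; apply: eq_bigr => i _.
rewrite /Dint [LHS]rmorph_sum; apply: eq_bigr => j _.
rewrite rmorphXn; congr (_ ^+ _).
by rewrite /= (smap_kexp _ fact_unit_poly) /= /horner_eval hornerX.
Qed.

Lemma D1int_Uint n : D1int n.+1 = kexp (n%:R / 2) * Uint n.+1.
Proof.
rewrite /D1int /Uint mulr_sumr (reindex_inj rev_ord_inj) /=.
apply: eq_bigr => i _; rewrite subSS /qpow -kexpD -kexp_natmul mulr1.
by congr kexp; rewrite natrB ?leq_ord //; field.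
Qed.

(** The exponents (i - 1) / 2 for i = 1, ..., n add up to n (n - 1) / 4. *)
Lemma D1fact_Ufact n : D1fact n = kexp ((n * n.-1)%:R / 4%:R) * Ufact n.
Proof.
elim: n => [|n IHn]; first by rewrite /D1fact /Ufact !big_ord0 mul0r kexp0 mulr1.
rewrite /D1fact /Ufact !big_ord_recr /= -/(D1fact n) -/(Ufact n) IHn D1int_Uint.
rewrite mulrACA -kexpD; congr (kexp _ * _).
case: n {IHn} => [|n]; first by rewrite !mul0r addr0.
by rewrite /= !natrM -!natr1; field.
Qed.

Lemma Uint0 n : Uint n 0%N = n%:R.
Proof.
rewrite /Uint coefS_sum (eq_bigr (fun=> 1)) => [|i _]; last exact: kexp0E.
by rewrite sumr_const card_ord.
Qed.

Lemma Ufact0 n : Ufact n 0%N = n`!%:R.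
Proof.
elim: n => [|n IHn]; first by rewrite /Ufact big_ord0.
by rewrite /Ufact big_ord_recr coef0M -/(Ufact n) IHn Uint0 factS mulnC natrM.
Qed.

Lemma D1fact0 n : D1fact n 0%N = n`!%:R.
Proof. by rewrite D1fact_Ufact coef0M kexp0E mul1r Ufact0. Qed.

Lemma sinv_fact (f : series rat) n : f 0%N = n`!%:R -> f * sinv n`!%:R^-1 f = 1.
Proof.
move=> f0; apply: sinv_mulr; rewrite f0.
  by rewrite divff // natr_fact_neq0.
by rewrite mulVf // natr_fact_neq0.
Qed.

Lemma hbar_Uden : hbar * Uden = qpow (1 / 2) - qpow (- (1 / 2)).
Proof. by apply: hdivK; rewrite coefSB !kexp0E subrr. Qed.

(** Half of q^(m(m-1)/2) is absorbed by the asymmetry of [m]! ([D1fact_Ufact]). *)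
Lemma Rcoef m :
  hbar ^+ m * sinv m`!%:R^-1 (D1fact m) * Uden ^+ m * kexp ((m * m.-1)%:R / 2%:R) =
  qpow ((m * m.-1)%:R / 4%:R) * (qpow (1 / 2) - qpow (- (1 / 2))) ^+ m *
    sinv m`!%:R^-1 (Ufact m).
Proof.
rewrite -hbar_Uden exprMn /qpow.
have dd := sinv_fact (D1fact0 m); have uu := sinv_fact (Ufact0 m).
set di := sinv _ (D1fact m) in dd *; set ui := sinv _ (Ufact m) in uu *.
have -> : (m * m.-1)%:R / 2%:R = (m * m.-1)%:R / 4%:R + (m * m.-1)%:R / 4%:R :> rat by field.
rewrite kexpD; set k := kexp _ in dd *.
have kd : k * di = ui.
  rewrite -[LHS]mulr1 -uu mulrA; rewrite -[RHS]mul1r -dd D1fact_Ufact -/k; ring.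
rewrite -kd; ring.
Qed.

(** The inverse of a series is built from the inverse of its constant term, which
    ring morphisms need not commute with formally; the two sides agree because
    both are inverse to the same series. *)
Lemma smap_Dcoef m n :
  smap at_eps1 (sinv (m`! * n`!)%:R^-1 (Dfact m * sconst n`!%:R)) =
  sinv m`!%:R^-1 (D1fact m) * sconst n`!%:R^-1.
Proof.
have Df : smap at_eps1 (Dfact m * sconst n`!%:R) = D1fact m * sconst n`!%:R.
  by rewrite rmorphM /= smap_Dfact smap_sconst /= rmorph_nat.
have D0 : Dfact m 0%N = m`!%:R.
  elim: m {Df} => [|m IHm]; first by rewrite /Dfact big_ord0.
  rewrite /Dfact big_ord_recr coef0M -/(Dfact m) IHm factS mulnC natrM; congr (_ * _).
  rewrite /Dint coefS_sum (eq_bigr (fun=> 1)) => [|i _].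
    by rewrite sumr_const card_ord.
  by rewrite coef0X /= expr0 invr1 mulr1 expr1n.
have u : (m`! * n`!)%:R \is a @GRing.unit {poly rat}.
  by rewrite natrM unitrM !fact_unit_poly.
have inv : smap at_eps1 (Dfact m * sconst n`!%:R) *
   smap at_eps1 (sinv (m`! * n`!)%:R^-1 (Dfact m * sconst n`!%:R)) = 1.
  rewrite -rmorphM sinv_mulr ?rmorph1 // coef_Msconst D0 -natrM ?mulrV ?mulVr //.
rewrite Df in inv; set s := smap _ _ in inv *.
have dd := sinv_fact (D1fact0 m); set di := sinv _ (D1fact m) in dd *.
have nn : sconst (n`!%:R : rat) * sconst n`!%:R^-1 = 1.
  by rewrite -sconstM divff ?natr_fact_neq0.
rewrite -[RHS]mulr1 -inv -[LHS]mulr1 -[X in s * X]mulr1 -{1}dd -nn; ring.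
Qed.

(** The heart of the comparison of R-matrices, for F = F (x) 1, E = 1 (x) E,
    Q = exp(hbar H (x) H / 4), K = 1 (x) q^(H/2) and L its inverse.  It is stated in
    an arbitrary ring, where nothing but these relations is at hand. *)
Section RingIdentity.
Variables (P : pzRingType) (F Q K L E c q : P).
Hypotheses (FQ : F * Q = K * Q * F) (FK : F * K = K * F) (FL : F * L = L * F).
Hypotheses (KL : K * L = 1) (KcL : K * L = L * K) (LQ : L * Q = Q * L).
Hypotheses (EL : E * L = q * L * E).
Hypotheses (cC : forall z, c * z = z * c) (qC : forall z, q * z = z * q).

Lemma FX_Q n : F ^+ n * Q = K ^+ n * Q * F ^+ n.
Proof.
elim: n => [|n IHn]; first by rewrite !mul1r mulr1.
have FKn : F * K ^+ n = K ^+ n * F by apply/commrX.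
by rewrite exprS -mulrA IHn !mulrA FKn -(mulrA _ F) FQ (exprSr K) !mulrA.
Qed.

Lemma E_LX n : E * L ^+ n = q ^+ n * L ^+ n * E.
Proof.
elim: n => [|n IHn]; first by rewrite !mul1r mulr1.
rewrite (exprSr L) mulrA IHn -mulrA EL (exprSr q).
by rewrite !mulrA -(mulrA (q ^+ n) (L ^+ n) q) -qC !mulrA.
Qed.

Lemma LE_X n : (L * E) ^+ n = q ^+ 'C(n, 2) * L ^+ n * E ^+ n.
Proof.
elim: n => [|n IHn]; first by rewrite !mulr1.
have qX m z : q ^+ m * z = z * q ^+ m by apply/esym/commrX/esym/qC.
rewrite exprS IHn binS bin1 exprD.
transitivity (q ^+ 'C(n, 2) * L * (E * L ^+ n) * E ^+ n).
  by rewrite !mulrA -(mulrA L E) -qX -!mulrA [L * (q ^+ _ * _)]mulrA -qX -!mulrA.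
rewrite E_LX (exprS L) (exprS E) !mulrA -(mulrA (q ^+ 'C(n, 2)) L) -(qX n L).
by rewrite !mulrA.
Qed.

(** Passing Q through F^n creates K^n, which cancels the L^n that (L E)^n contains;
    the power of q comes from sorting (L E)^n. *)
Lemma FQX n : F ^+ n * Q * (c * L * E) ^+ n =
  c ^+ n * q ^+ 'C(n, 2) * Q * F ^+ n * E ^+ n.
Proof.
have qX m z : q ^+ m * z = z * q ^+ m by apply/esym/commrX/esym/qC.
have cX m z : c ^+ m * z = z * c ^+ m by apply/esym/commrX/esym/cC.
have FLn : F ^+ n * L ^+ n = L ^+ n * F ^+ n by apply/commrX/esym/commrX.
have LnQ : L ^+ n * Q = Q * L ^+ n by apply/esym/commrX.
have KLn : K ^+ n * L ^+ n = 1 by rewrite -exprMn_comm // KL expr1n.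
rewrite -(mulrA c) (exprMn_comm _ (cC _)) LE_X FX_Q.
transitivity (c ^+ n * q ^+ 'C(n, 2) * (K ^+ n * Q * (F ^+ n * L ^+ n) * E ^+ n)).
  by rewrite mulrA -cX -!mulrA; congr (_ * _); rewrite !mulrA -qX !mulrA.
by rewrite FLn !mulrA -(mulrA _ Q (L ^+ n)) -LnQ mulrA -(mulrA _ (K ^+ n)) KLn mulr1.
Qed.
End RingIdentity.

(** The two R-matrices agree in any presented algebra in which h1, h2 and X are given
    by the formulas for phi(b) (x) 1, 1 (x) phi(a) and 1 (x) phi(x). *)
Section RMatrix.
Variables (A : algType rat) (rels : seq (series A)).
Variables (H1 H2 : A) (F E h1 h2 X : series A).
Local Notation p := (proj rels).
Hypotheses (ph1 : p h1 = p ((1 / 2 : rat) *: sconst H1))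
           (ph2 : p h2 = p ((1 / 2 : rat) *: sconst H2))
           (pX : p X = p (scal A Uden) * p (hexp (- (1 / 2) *: H2)) * p E).
Hypotheses (HF : p (sconst H1) * p F - p F * p (sconst H1) = p ((- 2%:R : rat) *: F))
           (HE : p (sconst H2) * p E - p E * p (sconst H2) = p ((2%:R : rat) *: E))
           (FH : p F * p (sconst H2) = p (sconst H2) * p F)
           (HH : p (sconst H1) * p (sconst H2) = p (sconst H2) * p (sconst H1)).

Let Q : series A := hexp ((1 / 4 : rat) *: (H1 * H2)).
Let K : series A := hexp ((1 / 2 : rat) *: H2).
Let L : series A := hexp (- (1 / 2 : rat) *: H2).

Let pM f g : p (f * g) = p f * p g. Proof. exact: rmorphM. Qed.
Let pXn f n : p (f ^+ n) = p f ^+ n. Proof. exact: rmorphXn. Qed.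

Lemma proj_central c (z : presented rels) : p (scal A c) * z = z * p (scal A c).
Proof. by rewrite -[z]reprK -/(p _) -!pM scalC. Qed.

Let proj_scale2_comm a b f g : GRing.comm (p f) (p g) ->
  GRing.comm (p (a *: f)) (p (b *: g)).
Proof.
move=> fg; have E' : p (f * g) = p (g * f) by rewrite !pM.
rewrite /GRing.comm -!pM -!scalerAl -!scalerAr !scalerA [b * a]mulrC.
by rewrite [LHS]proj_scaleE [RHS]proj_scaleE E'.
Qed.

Let HH2 : GRing.comm (p (sconst H2)) (p (sconst (H1 * H2))).
Proof. by rewrite /GRing.comm !sconstM !pM mulrA HH. Qed.

Let FQ : p F * p Q = p K * p Q * p F.
Proof.
have HHF : p (sconst (H1 * H2)) * p F - p F * p (sconst (H1 * H2)) =
         p ((- 2%:R : rat) *: (sconst H2 * F)).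
  rewrite !sconstM !pM -mulrA -FH !mulrA -mulrBl HF proj_scaleE.
  by rewrite -mulrA FH -pM -proj_scaleE.
have := @proj_hexp_shift _ rels F ((1 / 4 : rat) *: (H1 * H2)) (- (1 / 2) *: H2).
rewrite scaleNr opprK; apply.
  rewrite sconstZ (proj_commZ _ HHF) scalerA -scaleNr sconstZ -pM -scalerAl.
  by congr (p (_ *: _)); field.
rewrite -scaleNr !sconstZ; apply: proj_scale2_comm.
exact: HH2.
Qed.

Let KL : p K * p L = 1.
Proof. by rewrite -pM /L scaleNr hexpN rmorph1. Qed.

Let LK : p L * p K = 1.
Proof.
have := hexpN (- (1 / 2) *: H2).
by rewrite -scaleNr opprK -/K -/L -pM => ->; rewrite rmorph1.
Qed.

Let F_K : p F * p K = p K * p F.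
Proof.
apply: proj_hexp_comm; rewrite sconstZ -[p F]/(p F) -[F]scale1r.
exact: proj_scale2_comm.
Qed.

Let F_L : p F * p L = p L * p F.
Proof.
apply: proj_hexp_comm; rewrite sconstZ -[F]scale1r.
exact: proj_scale2_comm.
Qed.

Let L_Q : p L * p Q = p Q * p L.
Proof.
apply: proj_hexp_comm; apply/esym/proj_hexp_comm; rewrite !sconstZ.
exact/proj_scale2_comm/commr_sym/HH2.
Qed.

Let E_L : p E * p L = p (scal A (kexp 1)) * p L * p E.
Proof.
have := proj_hexp_weight (- (1 / 2)) HE; rewrite scal_kexp.
by rewrite (_ : - (- (1 / 2) * 2%:R) = 1 :> rat) //; field.
Qed.

(** The factors 1 / 2 of both halves of H combine to the 1 / 4 of Q. *)
Let Qterm n : p (h1 ^+ n) * p (h2 ^+ n) = p (sconst ((1 / 4 : rat) *: (H1 * H2)) ^+ n).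
Proof.
rewrite !pXn ph1 ph2 -exprMn_comm; last exact: proj_scale2_comm.
congr (_ ^+ n); rewrite -pM sconstZ sconstM -scalerAl -scalerAr scalerA.
by congr (p (_ *: _)); field.
Qed.

Variables (cd : nat -> nat -> series rat).
Hypothesis cdE : forall m n, cd m n = sinv m`!%:R^-1 (D1fact m) * sconst n`!%:R^-1.

Let RDt m := ssum (fun n =>
    scal A (hbar ^+ (m + n) * cd m n) * (F ^+ m * h1 ^+ n) * (h2 ^+ n * X ^+ m)).

Let RD := ssum RDt.

Let RU := Q * ssum (fun n =>
    scal A (qpow ((n * n.-1)%:R / 4%:R) *
            (qpow (1 / 2) - qpow (- (1 / 2))) ^+ n *
            sinv n`!%:R^-1 (Ufact n)) * (F ^+ n * E ^+ n)).

Let scal_hbarX m c : scal A (hbar ^+ m * c) = hbar ^+ m * scal A c.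
Proof. by rewrite scalM scalX scal_hbar. Qed.

Let coef_upto m c f : eq_upto m (scal A (hbar ^+ m * c) * f) 0.
Proof. by rewrite scal_hbarX -mulrA; apply: eq_upto0_hbarX. Qed.

Let sD m := scal A (hbar ^+ m * sinv m`!%:R^-1 (D1fact m)).

(** The sum over the powers of b and a is the exponential series of Q. *)
Let inner m : p (RDt m) = p (sD m * (F ^+ m * Q * X ^+ m)).
Proof.
set s := sD m.
have up n : eq_upto n (hbar ^+ n * sconst (Q n)) 0 by apply: eq_upto0_hbarX.
have QE : s * (F ^+ m * Q * X ^+ m) =
  ssum (fun n => s * (F ^+ m * (hbar ^+ n * sconst (Q n)) * X ^+ m)).
  rewrite ssum_mull => [|n]; last exact/eq_upto0Ml/eq_upto0Mr/up.
  rewrite ssum_mulr => [|n]; last exact/eq_upto0Mr/up.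
  by rewrite ssum_mull -?series_expand.
rewrite QE; apply: proj_ssum => n.
- by rewrite -mulrA addnC exprD -[hbar ^+ n * _ * _]mulrA; apply: coef_upto.
- by apply/eq_upto0Mr/eq_upto0Ml/eq_upto0Mr/up.
pose t := scal A (hbar ^+ n * sconst (n`!%:R^-1 : rat)).
have tC f : t * f = f * t by apply: scalC.
have -> : scal A (hbar ^+ (m + n) * cd m n) = s * t.
  by rewrite cdE exprD mulrACA scalM.
have -> : s * t * (F ^+ m * h1 ^+ n) * (h2 ^+ n * X ^+ m) =
          s * (F ^+ m * (t * (h1 ^+ n * h2 ^+ n)) * X ^+ m).
  by rewrite -!mulrA; congr (_ * _); rewrite !mulrA (tC (F ^+ m)).
rewrite 3!pM [RHS]pM (pM (F ^+ m * _)) (pM (F ^+ m)).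
congr (_ * (_ * _ * _)).
rewrite [LHS]pM [X in _ * X]pM Qterm -pM; congr (p _).
rewrite /t scal_hbarX -mulrA scal_sconstM coef_hexp; set z := (1 / 4) *: _.
rewrite [RHS](congr1 _ (sconstZ _ (z ^+ n))); congr (_ * (_ *: _)).
exact/esym/(rmorphXn (@sconst A)).
Qed.

Lemma RD_RU : p RD = p RU.
Proof.
pose r m := scal A (qpow ((m * m.-1)%:R / 4%:R) *
   (qpow (1 / 2) - qpow (- (1 / 2))) ^+ m * sinv m`!%:R^-1 (Ufact m)).
have r_upto m f : eq_upto m (r m * f) 0.
  have pull (a u s : series rat) : a * (hbar ^+ m * u) * s = hbar ^+ m * (a * u * s).
    by rewrite mulrCA !mulrA.
  by rewrite /r -hbar_Uden exprMn pull; apply: coef_upto.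
rewrite /RU -ssum_mull => [|m]; last exact: r_upto.
apply: proj_ssum => m.
- apply: ssum_upto0 => n; rewrite exprD -!mulrA; apply: coef_upto.
- apply: eq_upto0Mr; exact: r_upto.
rewrite inner.
have cC (z : presented rels) : p (scal A Uden) * z = z * p (scal A Uden) by apply: proj_central.
have qC (z : presented rels) : p (scal A (kexp 1)) * z = z * p (scal A (kexp 1)).
  exact: proj_central.
have XE : p (F ^+ m * Q * X ^+ m) =
    p (scal A (Uden ^+ m * kexp 1 ^+ 'C(m, 2))) * p Q * p (F ^+ m * E ^+ m).
  have := FQX FQ F_K F_L KL (etrans KL (esym LK)) L_Q E_L cC qC m.
  rewrite -pX -(pXn F) -(pXn X) -(pXn E) => E1; apply: etrans (pM _ _) _.
  apply: etrans (congr1 (fun z => z * _) (pM _ _)) _; apply: etrans E1 _.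
  rewrite [X in _ = _ * X]pM [RHS]mulrA; congr (_ * _ * _ * _).
  by rewrite -(pXn (scal A Uden)) -(pXn (scal A _)) -2!scalX -pM -scalM.
pose u := scal A (Uden ^+ m * kexp 1 ^+ 'C(m, 2)).
have rE : r m = sD m * u.
  rewrite /sD /u -scalM mulrA -kexp_natmul mulr1 /r -Rcoef; congr (scal _ (_ * kexp _)).
  have E2 : ('C(m, 2) * 2 = m * m.-1)%N.
    by elim: (m) => [|[|n] IHn] //; rewrite binS bin1 mulnDl IHn /=; nia.
  by rewrite -E2 natrM mulfK.
have uC z : p u * z = z * p u by apply: proj_central.
have sC z : p (sD m) * z = z * p (sD m) by apply: proj_central.
apply: etrans (pM _ _) _; rewrite XE -/u.
apply/esym; apply: etrans (pM _ _) _; apply: etrans (congr1 _ (pM _ _)) _.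
by rewrite -/(r m) rE (pM (sD m)) !mulrA -sC -(mulrA _ _ (p u)) -uC !mulrA.
Qed.
End RMatrix.

Section MapR.
Variables (k : comUnitRingType) (tau : {rmorphism k -> rat}) (A : algType k) (B : algType rat).
Variable psi : {rmorphism A -> B}.
Hypothesis dk : fact_unit k.
Hypothesis psiZ : forall c a, psi (c *: a) = tau c *: psi a.
Local Notation Psi := (smap psi).

Lemma smap_RD (d : nat -> nat -> series k) (y b a x : series A) (y' b' a' x' : series B) :
  Psi y = y' -> Psi b = b' -> Psi a = a' -> Psi x = x' ->
  Psi (ssum (fun m => ssum (fun n =>
    scal A (hbar ^+ (m + n) * d m n) * (y ^+ m * b ^+ n) * (a ^+ n * x ^+ m)))) =
  ssum (fun m => ssum (fun n =>
    scal B (hbar ^+ (m + n) * smap tau (d m n)) * (y' ^+ m * b' ^+ n) *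
      (a' ^+ n * x' ^+ m))).
Proof.
move=> <- <- <- <-.
rewrite smap_ssum; apply: eq_ssum => m; rewrite smap_ssum; apply: eq_ssum => n.
rewrite !rmorphM !rmorphXn /= (smap_scal _ psiZ); congr (scal _ _ * _ * _).
by rewrite rmorphM rmorphXn /= smap_hbar.
Qed.

Lemma smap_RU (z : A) (d : nat -> series k) (y x : series A) (z' : B) (y' x' : series B) :
  psi z = z' -> Psi y = y' -> Psi x = x' ->
  Psi (hexp z * ssum (fun n => scal A (d n) * (y ^+ n * x ^+ n))) =
  hexp z' * ssum (fun n => scal B (smap tau (d n)) * (y' ^+ n * x' ^+ n)).
Proof.
move=> <- <- <-.
rewrite rmorphM /= (smap_hexp dk _ psiZ) smap_ssum; congr (_ * _); apply: eq_ssum => n.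
by rewrite !rmorphM !rmorphXn /= (smap_scal _ psiZ).
Qed.
End MapR.

Lemma smap_id (A : nzRingType) (f : series A) : smap idfun f = f.
Proof. exact: seriesP. Qed.

Lemma smap_rename_gen (k k' : comUnitRingType) (tau : {rmorphism k -> k'})
    (X Y : choiceType) (h : X -> Y) x :
  smap (rename tau h) (gen k x) = gen k' (h x).
Proof. by rewrite /gen smap_sconst; congr sconst; apply: rename_word. Qed.

Section HomRel.
Variables (A B : algType rat) (Psi : {rmorphism series A -> series B}).
Hypothesis PsiZ : forall c f, Psi (c *: f) = c *: Psi f.
Implicit Types (f g u l e : series A)(c : rat).

Lemma hom_scale c f g (f' g' : series B) : Psi f = f' -> Psi g = g' ->
  Psi (f - c *: g) = f' - c *: g'.
Proof. by move=> <- <-; rewrite rmorphB PsiZ. Qed.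

Lemma hom_mul3 f u l e (f' u' l' e' : series B) : Psi f = f' -> Psi u = u' -> Psi l = l' ->
  Psi e = e' -> Psi (f - u * l * e) = f' - u' * l' * e'.
Proof. by move=> <- <- <- <-; rewrite rmorphB !rmorphM. Qed.

Lemma hom_weight c f g (f' g' : series B) : Psi f = f' -> Psi g = g' ->
  Psi (f * g - g * f - c *: g) = f' * g' - g' * f' - c *: g'.
Proof. by move=> <- <-; rewrite !rmorphB PsiZ !rmorphM. Qed.
End HomRel.

Section SlotR.
Local Notation I := (in_closed_ideal Urel).
Local Notation SA := (freealg rat (Useries * nat)%type).
Local Notation nullU := (@null (freealg rat Ugen) I).
Variable sl : bool -> nat.
Hypothesis sl_neq : sl false != sl true.

Definition slotD : series (freealg {poly rat} (Dgen * bool)%type) -> series SA :=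
  smap (rename at_eps1 (fun x : Dgen * bool => (phi_gen x.1, sl x.2))).
Definition slotU : series (freealg rat (Ugen * bool)%type) -> series SA :=
  smap (rename idfun (fun x : Ugen * bool => (gen rat x.1, sl x.2))).

Definition left_letter (t : Useries) : series SA := gen rat (t, sl false).
Definition right_letter (t : Useries) : series SA := gen rat (t, sl true).
Definition left_H : SA := word rat [:: (gen rat UH, sl false)].
Definition right_H : SA := word rat [:: (gen rat UH, sl true)].

(** The consequences of the relations of sl2 in the two slots on which the comparison of
    R-matrices rests.  Being a finite list, they define a presented algebra, where
    [RD_RU] applies, whereas [null] is not presented by relations. *)
Definition Rrels : seq (series SA) := [::
  left_letter (phi_gen Db) - (1 / 2 : rat) *: sconst left_H;
  right_letter (phi_gen Da) - (1 / 2 : rat) *: sconst right_H;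
  right_letter (phi_gen Dx) - scal _ Uden * hexp (- (1 / 2) *: right_H) * right_letter (gen rat UE);
  (sconst left_H * left_letter (gen rat UF) - left_letter (gen rat UF) * sconst left_H)
    - (- 2%:R : rat) *: left_letter (gen rat UF);
  (sconst right_H * right_letter (gen rat UE) - right_letter (gen rat UE) * sconst right_H)
    - (2%:R : rat) *: right_letter (gen rat UE);
  left_letter (gen rat UF) * sconst right_H - sconst right_H * left_letter (gen rat UF);
  sconst left_H * sconst right_H - sconst right_H * sconst left_H].

Lemma in_slotZ s c (f : series (freealg rat Useries)) : in_slot s (c *: f) = c *: in_slot s f.
Proof. by apply: seriesP => n; apply: renameZ. Qed.

Lemma in_slot_gen s (t : Useries) : in_slot s (gen rat t) = gen rat (t, s).
Proof. exact: smap_rename_gen. Qed.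

Lemma in_slot_scal s c : in_slot s (scal (freealg rat Useries) c) = scal SA c.
Proof.
have H := @smap_scal rat idfun (freealg rat Useries) SA (rename idfun (fun t => (t, s))) c.
by rewrite /in_slot H ?smap_id // => e a; apply: renameZ.
Qed.

Lemma in_slot_hexp s c (t : Useries) :
  in_slot s (hexp (c *: word rat [:: t])) = hexp (c *: word rat [:: (t, s)]).
Proof.
apply: etrans (smap_hexp fact_unit_rat _ _) _; first by move=> e a; apply: renameZ.
apply: (congr1 (@hexp _ _)); apply: etrans (renameZ _ _ _ _) _.
by congr (_ *: _); apply: rename_word.
Qed.

Lemma ev_scal c : ev (scal (freealg rat Useries) c) = scal (freealg rat Ugen) c.
Proof. by apply: ext_scal => e a; apply: fevalZ. Qed.

Lemma ev_hexp c : ev (hexp (c *: word rat [:: gen rat UH])) = hexp (c *: word_H).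
Proof.
apply: ext_hexp => [e a|]; first exact: fevalZ.
apply: etrans (fevalZ _ _ _ _) _; rewrite sconstZ; congr (_ *: _).
exact: feval_letter.
Qed.

Lemma null_slot s f g : I (ev f) -> in_slot s f = g -> nullU g.
Proof. by move=> If <-; apply: null_in_slot => //; apply: in_closed_ideal_closed. Qed.

(** Each relation either lives in one slot, where it evaluates into the ideal of sl2, or
    is a commutator between the two slots, which are distinct. *)
Lemma Rrels_null : {in Rrels, forall r, nullU r}.
Proof.
have cI := in_closed_ideal_closed Urel.
have I0 : I 0 by apply: closed_ideal0.
have null_half s (f : Useries) : f = (1 / 2 : rat) *: gen rat UH ->
    nullU (gen rat (f, s) - (1 / 2 : rat) *: gen rat (gen rat UH, s)).
  move=> fE; apply: null_slot;
    last exact: (hom_scale (in_slotZ s) _ (in_slot_gen s f) (in_slot_gen s _)).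
  by rewrite (hom_scale (@evZ _) _ (ev_gen f) (ev_gen _)) fE subrr.
rewrite /Rrels; apply: forall_in_cons.
  by apply: null_half; apply: sconstZ.
apply: forall_in_cons.
  by apply: null_half; apply: sconstZ.
apply: forall_in_cons.
  apply: null_slot; last exact: (hom_mul3 (in_slot_gen _ _) (in_slot_scal _ _)
    (in_slot_hexp _ _ _) (in_slot_gen _ _)).
  rewrite (hom_mul3 (ev_gen (phi_gen Dx)) (ev_scal _) (ev_hexp _) (ev_gen _)).
  by rewrite subrr.
apply: forall_in_cons.
  apply: null_slot; last exact: (hom_weight (in_slotZ _) _ (in_slot_gen _ _) (in_slot_gen _ _)).
  rewrite (hom_weight (@evZ _) _ (ev_gen (gen rat UH)) (ev_gen (gen rat UF))).
  rewrite scaleNr opprK -scaler2.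
  by apply: in_closed_ideal_rel; rewrite in_cons mem_head orbT.
apply: forall_in_cons.
  apply: null_slot; last exact: (hom_weight (in_slotZ _) _ (in_slot_gen _ _) (in_slot_gen _ _)).
  rewrite (hom_weight (@evZ _) _ (ev_gen (gen rat UH)) (ev_gen (gen rat UE))).
  by rewrite -scaler2; apply: in_closed_ideal_rel; rewrite mem_head.
apply: forall_in_cons.
  exact: null_comm.
apply: forall_in_cons; last exact: forall_in_nil.
exact: null_comm.
Qed.

Lemma slotD_DR : slotD DR = ssum (fun m => ssum (fun n =>
    scal SA (hbar ^+ (m + n) * smap at_eps1 (sinv (m`! * n`!)%:R^-1 (Dfact m * sconst n`!%:R))) *
    (left_letter (gen rat UF) ^+ m * left_letter (phi_gen Db) ^+ n) *
    (right_letter (phi_gen Da) ^+ n * right_letter (phi_gen Dx) ^+ m))).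
Proof.
have Z := renameZ at_eps1 (fun x : Dgen * bool => (phi_gen x.1, sl x.2)).
have g x : slotD (gen _ x) = gen rat (phi_gen x.1, sl x.2) by apply: smap_rename_gen.
exact: (smap_RD Z _ (g (Dy, false)) (g (Db, false)) (g (Da, true)) (g (Dx, true))).
Qed.

Lemma slotU_UR : slotU UR = hexp ((1 / 4 : rat) *: (left_H * right_H)) * ssum (fun n =>
    scal SA (qpow ((n * n.-1)%:R / 4%:R) *
            (qpow (1 / 2) - qpow (- (1 / 2))) ^+ n *
            sinv n`!%:R^-1 (Ufact n)) *
    (left_letter (gen rat UF) ^+ n * right_letter (gen rat UE) ^+ n)).
Proof.
have Z := @renameZ rat rat idfun _ _ (fun x : Ugen * bool => (gen rat x.1, sl x.2)).
have g x : slotU (gen _ x) = gen rat (gen rat x.1, sl x.2) by apply: smap_rename_gen.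
have hh : rename idfun (fun x : Ugen * bool => (gen rat x.1, sl x.2))
    ((1 / 4 : rat) *: word rat [:: (UH, false); (UH, true)]) = (1 / 4 : rat) *: (left_H * right_H).
  by rewrite Z rename_word /left_H /right_H wordM.
pose d n := qpow ((n * n.-1)%:R / 4%:R) * (qpow (1 / 2) - qpow (- (1 / 2))) ^+ n *
            sinv n`!%:R^-1 (Ufact n).
have E := smap_RU fact_unit_rat Z d hh (g (UF, false)) (g (UE, true)).
apply: etrans E _.
congr (_ * _); apply: eq_ssum => n; congr (scal _ _ * _); exact: smap_id.
Qed.

Lemma slot_R : nullU (slotD DR - slotU UR).
Proof.
have cN : closed_ideal nullU by apply: null_closed; apply: in_closed_ideal_closed.
apply: (closed_ideal_presented cN Rrels_null); apply/projP.
rewrite slotD_DR slotU_UR; apply: RD_RU.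
- exact/proj_rel/(@mem_nth _ 0 Rrels 0 isT).
- exact/proj_rel/(@mem_nth _ 0 Rrels 1 isT).
- rewrite -2!(rmorphM (@proj _ Rrels)).
  exact/proj_rel/(@mem_nth _ 0 Rrels 2 isT).
- exact/proj_comm/(@mem_nth _ 0 Rrels 3 isT).
- exact/proj_comm/(@mem_nth _ 0 Rrels 4 isT).
- exact/proj_swap/(@mem_nth _ 0 Rrels 5 isT).
- exact/proj_swap/(@mem_nth _ 0 Rrels 6 isT).
- exact: smap_Dcoef.
Qed.
End SlotR.

(** * Comparison of the universal invariants *)

Section CongHom.
Variables (A B C : nzRingType) (I : series C -> Prop).
Variables (Phi : {rmorphism series A -> series C}) (Psi : {rmorphism series B -> series C}).
Hypothesis cI : closed_ideal I.

Lemma cong_homM f f' g g' : I (Phi f - Psi g) -> I (Phi f' - Psi g') ->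
  I (Phi (f * f') - Psi (g * g')).
Proof. by rewrite !rmorphM; apply: cong_mul. Qed.

Lemma cong_hom_prod (J : eqType) (r : seq J) (F : J -> series A) (G : J -> series B) :
  (forall i, i \in r -> I (Phi (F i) - Psi (G i))) ->
  I (Phi (\prod_(i <- r) F i) - Psi (\prod_(i <- r) G i)).
Proof.
elim: r => [|i r IHr] FG.
  by rewrite !big_nil !rmorph1 subrr; apply: closed_ideal0.
rewrite !big_cons; apply: cong_homM; first by apply: FG; rewrite mem_head.
by apply: IHr => j jr; apply: FG; rewrite in_cons jr orbT.
Qed.
End CongHom.

Lemma smap_comp (A B C : Type) (g : B -> C) (f : A -> B) (h : A -> C) (s : series A) :
  g \o f =1 h -> smap g (smap f s) = smap h s.
Proof. by move=> gf; rewrite /smap; congr Series; apply/funext => n; apply: gf. Qed.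

Lemma smap_rename_comp (k k' k'' : comUnitRingType) (tau : {rmorphism k -> k'})
    (tau' : {rmorphism k' -> k''}) (tau'' : {rmorphism k -> k''})
    (X Y Z : choiceType) (h : X -> Y) (h' : Y -> Z) (h'' : X -> Z) f :
  tau' \o tau =1 tau'' -> h' \o h =1 h'' ->
  smap (rename tau' h') (smap (rename tau h) f) = smap (rename tau'' h'') f.
Proof.
move=> tauE hE; apply: smap_comp.
apply: (@freealg_ext _ _ _ _ tau'') => [c a|c a|w].
- rewrite -tauE.
  exact: etrans (congr1 (rename tau' h') (renameZ tau h c a)) (renameZ tau' h' _ _).
- exact: renameZ.
- rewrite [RHS]rename_word -(eq_map hE) map_comp -(rename_word tau' h').
  by rewrite -(rename_word tau h).
Qed.

Lemma on_words_mapE (k : comUnitRingType) (X Y : choiceType) (h : X -> Y)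
    (f : series (freealg k X)) :
  smap (on_words (map h)) f = smap (rename idfun h) f.
Proof. by apply: seriesP => n; apply: on_words_map. Qed.

Lemma raddf_sub0 (U V : zmodType) (f : {additive U -> V}) a b : f a = f b -> f (a - b) = 0.
Proof. by move=> ab; rewrite raddfB ab subrr. Qed.

Lemma sinv_one (A : nzRingType) (u : A) : u = 1 -> sinv u 1 = 1.
Proof. by move=> ->; rewrite -[LHS]mul1r; apply: sinv1_mulr; rewrite coefS1. Qed.

Lemma RD_coef0 (k : comUnitRingType) (A : algType k) (d : nat -> nat -> series k)
    (y b a x : series A) : d 0%N 0%N = 1 ->
  ssum (fun m => ssum (fun n =>
    scal A (hbar ^+ (m + n) * d m n) * (y ^+ m * b ^+ n) * (a ^+ n * x ^+ m))) 0%N = 1.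
Proof.
by move=> d0; rewrite coef_ssum big_ord1 coef_ssum big_ord1 d0 !expr0 !mulr1 scal1.
Qed.

Lemma RU_coef0 (k : comUnitRingType) (A : algType k) (z : A) (d : nat -> series k)
    (y x : series A) : d 0%N = 1 ->
  (hexp z * ssum (fun n => scal A (d n) * (y ^+ n * x ^+ n))) 0%N = 1.
Proof.
by move=> d0; rewrite coef0M coef0_hexp coef_ssum big_ord1 d0 !expr0 !mulr1 scal1 mul1r.
Qed.

Lemma DR0 : DR 0%N = 1.
Proof.
apply: (RD_coef0 (d := fun m n => sinv (m`! * n`!)%:R^-1 (Dfact m * sconst n`!%:R))).
by rewrite /Dfact big_ord0 fact0 mul1n mul1r sconst1 sinv_one ?invr1.
Qed.

Lemma UR0 : UR 0%N = 1.
Proof.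
apply: (@RU_coef0 rat _ _ (fun n => qpow ((n * n.-1)%:R / 4%:R) *
            (qpow (1 / 2) - qpow (- (1 / 2))) ^+ n * sinv n`!%:R^-1 (Ufact n))).
by rewrite mul0n mul0r /qpow kexp0 expr0 !mul1r /Ufact big_ord0 fact0 sinv_one ?invr1.
Qed.

Local Notation I := (in_closed_ideal Urel).
Local Notation SA := (freealg rat (Useries * nat)%type).
Local Notation nullU := (@null (freealg rat Ugen) I).

(** The tensor factors of D and of quantum sl2 become comparable when each letter is
    replaced by its value in quantum sl2, in the same slot. *)
Definition embD : series (freealg {poly rat} (Dgen * nat)%type) -> series SA :=
  smap (rename at_eps1 (fun x : Dgen * nat => (phi_gen x.1, x.2))).
HB.instance Definition _ := GRing.RMorphism.on embD.
Definition embU : series (freealg rat (Ugen * nat)%type) -> series SA :=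
  smap (rename idfun (fun x : Ugen * nat => (gen rat x.1, x.2))).
HB.instance Definition _ := GRing.RMorphism.on embU.

Lemma merge_embD f : ev (merge (embD f)) = phi (merge f).
Proof. by apply: (congr1 (@ev _)); apply: merge_rename. Qed.

Lemma ev_gens (f : series (freealg rat Ugen)) : ev (smap (rename idfun (@gen rat Ugen)) f) = f.
Proof.
rewrite [RHS]series_expand; apply: eq_ssum => n; congr (_ * _).
apply: (@freealg_ext _ _ _ _ idfun (feval idfun id \o rename idfun (@gen rat Ugen))
  (@sconst (freealg rat Ugen))) => [c a|c a|w].
- exact: etrans (congr1 (feval idfun id) (renameZ _ _ _ _)) (fevalZ _ _ _ _).
- exact: sconstZ.
- rewrite [LHS]/= rename_word feval_word big_map word_prod.
  by rewrite [RHS](rmorph_prod (@sconst _)).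
Qed.

Lemma merge_embU f : ev (merge (embU f)) = merge f.
Proof. by apply: etrans (congr1 (@ev _) (merge_rename _ _ _)) (ev_gens _). Qed.

Lemma null_cl : closed_ideal nullU.
Proof. by apply: null_closed; apply: in_closed_ideal_closed. Qed.

(** For a negative crossing, congruent series with constant term 1 have congruent
    inverses. *)
Lemma null_crossing (K : long_knot) c : c \in crossings K ->
  nullU (embD (@crossing_elt _ D K c) - embU (@crossing_elt _ Uh_sl2 K c)).
Proof.
move=> cK; pose sl u := pass_slot K c.1 (~~ u).
have slN : sl false != sl true by apply: long_knot_slots.
have DE f : embD (@place_slots _ D _ sl f) = slotD sl f.
  apply: etrans (congr1 embD (on_words_mapE _ _)) _.
  exact: smap_rename_comp.
have UE f : embU (@place_slots _ Uh_sl2 _ sl f) = slotU sl f.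
  apply: etrans (congr1 embU (on_words_mapE _ _)) _.
  exact: smap_rename_comp.
have nR := slot_R slN.
have H f g : nullU (slotD sl f - slotU sl g) ->
    nullU (embD (@place_slots _ D _ sl f) - embU (@place_slots _ Uh_sl2 _ sl g)).
  by rewrite DE UE.
apply: H; case: c.2; first exact: nR.
have -> : slotD sl (sinv 1 (rmat D)) = sinv 1 (slotD sl DR) by apply: smap_sinv1 DR0.
have -> : slotU sl (sinv 1 (rmat Uh_sl2)) = sinv 1 (slotU sl UR) by apply: smap_sinv1 UR0.
apply: (cong_sinv1 null_cl) nR.
  by apply: etrans (congr1 _ DR0) _; apply: rmorph1.
by apply: etrans (congr1 _ UR0) _; apply: rmorph1.
Qed.

Lemma null_in_slot_eq s (f g : series (freealg rat Useries)) : ev f = ev g ->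
  nullU (in_slot s f - in_slot s g).
Proof.
move=> fg; rewrite -(raddfB (@in_slot _ s)); apply: null_in_slot.
  exact: in_closed_ideal_closed.
have -> : ev (f - g) = 0 by exact: (raddf_sub0 (f := @ev _) fg).
exact: in_closed_ideal0.
Qed.

(** The spinners correspond exactly, even before passing to the quotient. *)
Lemma null_edge e r : nullU (embD (@edge_elt _ D e r) - embU (@edge_elt _ Uh_sl2 e r)).
Proof.
have DE : embD (@edge_elt _ D e r) = in_slot e.*2 (spell (sexpz Dspin r)).
  apply: etrans (congr1 embD (on_words_mapE _ _)) _.
  apply: etrans (@smap_rename_comp _ _ _ _ _ at_eps1 _ _ _ _ _
    (fun g => (phi_gen g, e.*2)) _ _ _) _ => //.
  by apply/esym/smap_rename_comp.
have UE : embU (@edge_elt _ Uh_sl2 e r) =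
    in_slot e.*2 (smap (rename idfun (@gen rat Ugen)) (sexpz Uspin r)).
  apply: etrans (congr1 embU (on_words_mapE _ _)) _.
  have E1 := @smap_rename_comp rat rat rat idfun idfun idfun _ _ _ (fun g : Ugen => (g, e.*2))
    (fun x : Ugen * nat => (gen rat x.1, x.2)) (fun g => (gen rat g, e.*2)) (sexpz Uspin r)
    (frefl _) (frefl _).
  have E2 := @smap_rename_comp rat rat rat idfun idfun idfun _ _ _ (@gen rat Ugen)
    (fun t : Useries => (t, e.*2)) (fun g => (gen rat g, e.*2)) (sexpz Uspin r)
    (frefl _) (frefl _).
  exact: etrans E1 (esym E2).
rewrite DE UE; apply: null_in_slot_eq; apply: etrans _ (esym (ev_gens _)).
apply: etrans (congr1 (@ev _) (smap_sexpz _ _ (coef0_hexp _))) _.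
apply: etrans (ext_sexpz _ _ _) (congr1 (fun f => sexpz f r) phi_spin).
by apply: etrans (congr1 _ (coef0_hexp _)) _; apply: rmorph1.
Qed.

(** The products of all tensor factors are congruent modulo [null], hence so are their
    merged values. *)
Lemma phi_universal (K : long_knot) :
  I (phi (universal_rep D K) - universal_rep Uh_sl2 K).
Proof.
have cN := null_cl.
pose PD := (\prod_(c <- crossings K) @crossing_elt _ D K c) *
     (\prod_(e < size (rotations K)) @edge_elt _ D e (nth 0 (rotations K) e)).
pose PU := (\prod_(c <- crossings K) @crossing_elt _ Uh_sl2 K c) *
     (\prod_(e < size (rotations K)) @edge_elt _ Uh_sl2 e (nth 0 (rotations K) e)).
have nP : nullU (embD PD - embU PU).
  apply: (@cong_homM _ _ _ nullU embD embU cN).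
    by apply: (@cong_hom_prod _ _ _ nullU embD embU cN) => c; apply: null_crossing.
  by apply: (@cong_hom_prod _ _ _ nullU embD embU cN) => e _; apply: null_edge.
have := nP 1 1; rewrite mul1r mulr1 => IP.
have B2 f g : ev (merge (f - g)) = ev (merge f) - ev (merge g) :> Useries.
  exact: etrans (congr1 (@ev _) (raddfB (@merge rat _) f g)) (raddfB (@ev _) _ _).
have E f g : ev (merge (embD f - embU g)) = phi (merge f) - merge g.
  have sub_congr (x y x' y' : Useries) : x = x' -> y = y' -> x - y = x' - y' by move=> -> ->.
  exact: etrans (B2 _ _) (sub_congr _ _ _ _ (merge_embD f) (merge_embU g)).
by rewrite E in IP.
Qed.

Theorem universal_sl2 (K K' : long_knot) :
  universal_invariant D K = universal_invariant D K' ->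
  I (universal_rep Uh_sl2 K - universal_rep Uh_sl2 K').
Proof.
move/projP => IK.
have cI := in_closed_ideal_closed Urel.
have cphi : continuous phi.
  move=> N f g fg; apply: ext_upto => n ltnN; exact: (congr1 (rename at_eps1 phi_gen) (fg n ltnN)).
have cp : closed_ideal (fun f => I (phi f)) := closed_ideal_preim cphi cI.
have := closed_ideal_presented cp phi_rels IK.
rewrite (raddfB phi) => IphiK.
have tele (R : zmodType) (a b c d : R) : c - d = (a - b) - (a - c) + (b - d).
  by rewrite opprB [a - b + _]addrC subrKA subrKA.
rewrite (tele _ (phi (universal_rep D K)) (phi (universal_rep D K'))).
apply: (closed_idealD cI); last exact: phi_universal.
by apply: (closed_idealB cI) => //; apply: phi_universal.
Qed.

(** * The irreducible representations *)

(** The defining quotient of the symmetric quantum integer, cleared of denominators. *)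
Lemma Uint_telescope m : (qpow (1 / 2) - qpow (- (1 / 2))) * Uint m =
  kexp (m%:R / 2) - kexp (- (m%:R / 2)).
Proof.
rewrite /Uint mulr_sumr; case: m => [|m].
  by rewrite big_ord0 mul0r oppr0 subrr.
pose u i := kexp ((m.+1%:R - 2%:R * i%:R) / 2%:R : rat).
rewrite (eq_bigr (fun i : 'I_m.+1 => u i - u i.+1)) => [|i _]; last first.
  rewrite mulrBl /qpow -!kexpD /u; congr (kexp _ - kexp _).
    by rewrite -natr1; field.
  by rewrite /= -!natr1; field.
rewrite -(big_mkord xpredT (fun i => u i - u i.+1)) /=.
rewrite (eq_bigr (fun i => - (u i.+1 - u i))) => [|i _]; last by rewrite opprB.
rewrite sumrN telescope_sumr // opprB /u; congr (kexp _ - kexp _); first by rewrite mulr0 subr0.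
by field.
Qed.

(** The classical identity [i+1] [N-i-1] - [i] [N-i] = [N-1-2i].  Multiplied by
    (q^(1/2) - q^(-1/2))^2 it becomes an identity between exponentials; this factor
    can then be cancelled, being hbar^2 times an invertible series. *)
Lemma qint_commutator N i : (i < N)%N ->
  Uint i.+1 * Uint (N - i.+1) - Uint i * Uint (N - i) =
  sinv 1 Uden * hdiv (kexp ((1 / 2) * (N.-1%:R - 2%:R * i%:R)) -
                      kexp (- (1 / 2) * (N.-1%:R - 2%:R * i%:R))).
Proof.
case: N => // n; rewrite ltnS => lein; set h := n%:R - 2%:R * i%:R : rat.
set w := qpow (1 / 2) - qpow (- (1 / 2)); set L := LHS.
have wE : w = hbar * Uden by rewrite hbar_Uden.
have wwL : w * (w * L) = w * (kexp ((1 / 2) * h) - kexp (- (1 / 2) * h)).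
  have -> : w * (w * L) = (w * Uint i.+1) * (w * Uint (n.+1 - i.+1)) -
                          (w * Uint i) * (w * Uint (n.+1 - i)).
    by rewrite /L; ring.
  rewrite !Uint_telescope subSS !natrB ?(leqW lein) // /w /qpow.
  have iS : i.+1%:R = i%:R + 1 :> rat by rewrite natr1.
  have nS : n.+1%:R = n%:R + 1 :> rat by rewrite natr1.
  set a := kexp (i%:R / 2); set a' := kexp (- (i%:R / 2)).
  pose b := kexp (n%:R / 2 : rat); pose b' := kexp (- (n%:R / 2) : rat).
  set t := kexp (1 / 2); set t' := kexp (- (1 / 2)).
  have -> : kexp (i.+1%:R / 2) = a * t.
    by rewrite /a /t -kexpD iS; congr kexp; field.
  have -> : kexp (- (i.+1%:R / 2)) = a' * t'.
    by rewrite /a' /t' -kexpD iS; congr kexp; field.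
  have -> : kexp ((n%:R - i%:R) / 2) = b * a'.
    by rewrite /b /a' -kexpD; congr kexp; field.
  have -> : kexp (- ((n%:R - i%:R) / 2)) = b' * a.
    by rewrite /b' /a -kexpD; congr kexp; field.
  have -> : kexp ((n.+1%:R - i%:R) / 2) = b * t * a'.
    by rewrite /b /a' /t -!kexpD nS; congr kexp; field.
  have -> : kexp (- ((n.+1%:R - i%:R) / 2)) = b' * t' * a.
    by rewrite /b' /a /t' -!kexpD nS; congr kexp; field.
  have -> : kexp (1 / 2 * h) = b * a' * a'.
    by rewrite /b /a' /h -!kexpD; congr kexp; field.
  have -> : kexp (- (1 / 2) * h) = b' * a * a.
    by rewrite /b' /a /h -!kexpD; congr kexp; field.
  ring.
have d0 : (kexp ((1 / 2) * h) - kexp (- (1 / 2) * h)) 0%N = 0.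
  by rewrite coefSB !kexp0E subrr.
have UL : Uden * L = hdiv (kexp ((1 / 2) * h) - kexp (- (1 / 2) * h)).
  apply: hbar_inj; rewrite hdivK //; apply: hbar_inj.
  have uK : sinv 1 Uden * Uden = 1 by apply: sinv1_mull Uden0.
  rewrite -[RHS]mul1r -uK; move: wwL; rewrite wE => wwL.
  transitivity (sinv 1 Uden * (hbar * Uden * (hbar * Uden * L))).
    by rewrite -[LHS]mul1r -uK; ring.
  by rewrite wwL; ring.
by rewrite -UL mulrA sinv1_mull ?mul1r //; apply: Uden0.
Qed.

Lemma closed_ideal_zero (B : nzRingType) : closed_ideal (fun f : series B => f = 0).
Proof.
split=> [//|f g -> ->|h1 h2 f ->|f lim]; first by rewrite addr0.
  by rewrite mulr0 mul0r.
by apply: eq_uptoP => N; have [g -> fg] := lim N.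
Qed.

Section Irrep.
Variable n : nat.
Local Notation N := n.+1.
Local Notation M := 'M[rat]_N.

(** Matrices of series are series of matrices; the latter are the target that the
    extension of ring morphisms to series provides. *)
Definition mx_series (A : 'M[series rat]_N) : series M :=
  Series (fun d => \matrix_(i, j) A i j d).

Lemma coef_mx_series A d i j : mx_series A d i j = A i j d.
Proof. by rewrite mxE. Qed.

Fact mx_series_is_zmod_morphism : zmod_morphism mx_series.
Proof.
by move=> A B; apply: seriesP => d; apply/matrixP => i j; rewrite coefSB !mxE.
Qed.
HB.instance Definition _ := GRing.isZmodMorphism.Build 'M[series rat]_N (series M)
  mx_series mx_series_is_zmod_morphism.

Fact mx_series_is_monoid_morphism : monoid_morphism mx_series.
Proof.
split=> [|A B]; apply: seriesP => d; apply/matrixP => i j; rewrite mxE.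
  by rewrite mxE coefS1; case: d => [|d]; rewrite !mxE; case: eqP.
rewrite mxE coefS_sum coefSM summxE.
under [RHS]eq_bigr do rewrite mxE.
rewrite exchange_big /=; apply: eq_bigr => l _.
by apply: eq_bigr => k _; rewrite !mxE.
Qed.
HB.instance Definition _ := GRing.isMonoidMorphism.Build 'M[series rat]_N (series M)
  mx_series mx_series_is_monoid_morphism.

Lemma mx_seriesZ c A : mx_series (sconst c *: A) = c *: mx_series A.
Proof.
apply: seriesP => d; apply/matrixP => i j.
by rewrite coefSZ !mxE coef_sconstM.
Qed.

Definition irrep_letter (g : Ugen) : series M := mx_series (irrep N g).
Definition irrep_mor : freealg rat Ugen -> series M := feval idfun irrep_letter.
HB.instance Definition _ := GRing.RMorphism.on irrep_mor.

Lemma irrep_morE a : irrep_mor a = mx_series (irrep_free N a).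
Proof.
rewrite /irrep_free raddf_sum; apply: eq_bigr => w _ /=.
by rewrite mx_seriesZ rmorph_prod -scalerAl mul1r.
Qed.

Lemma irrep_seriesE f : ext irrep_mor f = mx_series (irrep_series N f).
Proof.
apply: seriesP => d; apply/matrixP => i j; rewrite coef_mx_series mxE !coef_ssum summxE.
apply: eq_bigr => m _; rewrite !coef_hbarXM; case: ifP => _; first by rewrite mxE.
by rewrite irrep_morE coef_mx_series.
Qed.

Definition diag_of (A : nzRingType) (v : 'I_N -> A) : 'M[A]_N :=
  \matrix_(i, j) if i == j then v j else 0.

Lemma diag_of_mull (A : nzRingType) v (B : 'M[A]_N) i j : (diag_of v * B) i j = v i * B i j.
Proof.
rewrite mxE (bigD1 i) //= mxE eqxx big1 ?addr0 // => l li.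
by rewrite mxE eq_sym (negPf li) mul0r.
Qed.

Lemma diag_of_mulr (A : nzRingType) v (B : 'M[A]_N) i j : (B * diag_of v) i j = B i j * v j.
Proof.
rewrite mxE (bigD1 j) //= mxE eqxx big1 ?addr0 // => l lj.
by rewrite mxE (negPf lj) mulr0.
Qed.

Lemma diag_ofM (A : nzRingType) (u v : 'I_N -> A) :
  diag_of u * diag_of v = diag_of (fun i => u i * v i).
Proof.
apply/matrixP => i j; rewrite diag_of_mull !mxE.
by case: eqP => [->|]; rewrite ?mulr0.
Qed.

Definition weight (j : 'I_N) : rat := N.-1%:R - 2%:R * j%:R.
Definition weight_mx : M := diag_of weight.

Lemma irrep_letter_H : irrep_letter UH = sconst weight_mx.
Proof.
apply: seriesP => d; apply/matrixP => i j; rewrite /irrep_letter coef_mx_series.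
by case: d => [|d]; rewrite /= !mxE; case: (i == j).
Qed.

Lemma hexp_weight_mx r : hexp (r *: weight_mx) = mx_series (diag_of (fun j => kexp (r * weight j))).
Proof.
have HX d : (r *: weight_mx) ^+ d = diag_of (fun j => (r * weight j) ^+ d).
  elim: d => [|d IHd].
    by apply/matrixP => i j; rewrite expr0 !mxE; case: (i == j).
  rewrite exprS IHd; apply/matrixP => i j.
  rewrite -scalerAl mxE diag_of_mull !mxE.
  by case: eqP => [->|_]; rewrite ?mulr0 // mulrA -exprS.
apply: seriesP => d; apply/matrixP => i j; rewrite coef_mx_series coef_hexp HX !mxE.
by case: (i == j); rewrite ?mulr0 //= mulrC.
Qed.

Lemma scal_mx c : scal M c = mx_series (diag_of (fun=> c)).
Proof.
apply: seriesP => d; apply/matrixP => i j; rewrite coef_mx_series !mxE /=.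
by rewrite mulr_natr; case: (i == j).
Qed.

Lemma hdiv_mx (v : 'I_N -> series rat) :
  hdiv (mx_series (diag_of v)) = mx_series (diag_of (fun i => hdiv (v i))).
Proof.
apply: seriesP => d; apply/matrixP => i j; rewrite coef_mx_series /= !mxE.
by case: (i == j).
Qed.

Lemma diag_ofB (A : nzRingType) (u v : 'I_N -> A) :
  diag_of u - diag_of v = diag_of (fun i => u i - v i).
Proof. by apply/matrixP => i j; rewrite !mxE; case: (i == j); rewrite ?subr0. Qed.

Lemma irrep_comm_H (g : Ugen) c :
  (forall i j : 'I_N, irrep N g i j != 0 -> weight i - weight j = c) ->
  irrep N UH * irrep N g - irrep N g * irrep N UH = sconst c *: irrep N g.
Proof.
move=> gc; have HE : irrep N UH = diag_of (fun j => sconst (weight j)) by [].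
apply/matrixP => i j; rewrite HE [LHS]mxE [X in _ + X]mxE diag_of_mull diag_of_mulr [RHS]mxE.
have [->|/gc <-] := eqVneq (irrep N g i j) 0; first by rewrite mulr0 mul0r subrr mulr0.
by rewrite [X in _ - X]mulrC -mulrBl -[sconst _ - _](raddfB (@sconst _)).
Qed.

Lemma irrep_EF : irrep N UE * irrep N UF - irrep N UF * irrep N UE =
  diag_of (fun i : 'I_N => sinv 1 Uden *
    hdiv (kexp ((1 / 2) * weight i) - kexp (- (1 / 2) * weight i))).
Proof.
apply/matrixP => i j; rewrite [LHS]mxE [X in _ + X]mxE [RHS]mxE -qint_commutator //.
have EF : (irrep N UE * irrep N UF) i j = if i == j then Uint j.+1 * Uint (N - j.+1) else 0.
  rewrite mxE; have [iN|iN] := ltnP i.+1 N.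
    rewrite (bigD1 (Ordinal iN)) //= big1 ?addr0 => [|l li]; last first.
      rewrite mxE ifN ?mul0r //; apply: contra li => /eqP il; exact/eqP/val_inj.
    rewrite !mxE /= eqxx eqSS; case: (eqVneq i j) => [->|ij]; first by rewrite eqxx mulr1.
    by rewrite (_ : (i == j :> nat) = false) ?mulr0 //; apply/negbTE.
  have iE : i.+1 = N by have := ltn_ord i; lia.
  rewrite big1 => [|l _]; last first.
    by rewrite mxE ifN ?mul0r // iE gtn_eqF.
  case: eqP => // <-; rewrite iE subnn [Uint 0]/Uint big_ord0 mulr0 //.
have FE : (irrep N UF * irrep N UE) i j = if i == j then Uint j * Uint (N - j) else 0.
  rewrite mxE; case i0: (nat_of_ord i) => [|k].
    rewrite big1 => [|l _]; last by rewrite mxE i0 mul0r.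
    by case: eqP => // <-; rewrite i0 [Uint 0]/Uint big_ord0 mul0r.
  have kN : (k < N)%N by have := ltn_ord i; lia.
  rewrite (bigD1 (Ordinal kN)) //= big1 ?addr0 => [|l li]; last first.
    rewrite mxE i0 eqSS ifN ?mul0r //; apply: contra li => /eqP il; exact/eqP/val_inj.
  rewrite !mxE /= i0 eqxx mul1r; case: (eqVneq i j) => [<-|ij]; first by rewrite i0 eqxx.
  by rewrite ifN // -i0; apply: contra ij => /eqP ij; apply/eqP/val_inj.
by rewrite EF [X in _ - X]FE; case: (i == j); rewrite ?subrr.
Qed.

Local Notation Psi := (ext irrep_mor).

Lemma Psi_gen g : Psi (gen rat g) = irrep_letter g.
Proof. exact: etrans (ext_sconst _ _) (feval_letter _ _ _). Qed.

Lemma Psi_qH (r : rat) :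
  Psi (hexp (r *: word_H)) = mx_series (diag_of (fun j => kexp (r * weight j))).
Proof.
rewrite -hexp_weight_mx; apply: ext_hexp => [c a|]; first exact: fevalZ.
apply: etrans (fevalZ _ _ _ _) _; rewrite sconstZ; congr (_ *: _).
by apply: etrans (feval_letter _ _ _) irrep_letter_H.
Qed.

Lemma Psi_scal c : Psi (scal (freealg rat Ugen) c) = mx_series (diag_of (fun=> c)).
Proof.
rewrite -scal_mx; apply: ext_scal => e a; exact: fevalZ.
Qed.

Lemma weight_comm (g : Ugen) c :
  (forall i j : 'I_N, irrep N g i j != 0 -> weight i - weight j = c) ->
  Psi (gen rat UH) * Psi (gen rat g) - Psi (gen rat g) * Psi (gen rat UH) = c *: Psi (gen rat g).
Proof.
move=> /irrep_comm_H gc; rewrite !Psi_gen /irrep_letter -!rmorphM -rmorphB /= gc.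
exact: mx_seriesZ.
Qed.

(** H is diagonal with eigenvalues n - 2 j, which E raises and F lowers by 2; for
    [E, F], see [qint_commutator]. *)
Lemma irrep_rels : {in Urel, forall r, Psi r = 0}.
Proof.
have PsiZ c f : Psi (c *: f) = c *: Psi f by apply: extZ => e a; apply: fevalZ.
rewrite /Urel; apply: forall_in_cons.
  rewrite scaler2; apply: etrans (hom_weight PsiZ _ erefl erefl) _.
  rewrite (@weight_comm UE 2%:R) ?subrr // => i j; rewrite mxE.
  case: ifP => [/eqP ij _|_]; last by rewrite eqxx.
  by rewrite /weight -ij -natr1; ring.
apply: forall_in_cons.
  rewrite scaler2 -[X in _ + X]opprK -scaleNr.
  apply: etrans (hom_weight PsiZ _ erefl erefl) _.
  rewrite (@weight_comm UF (- 2%:R)) ?subrr // => i j; rewrite mxE.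
  case: ifP => [/eqP ij _|_]; last by rewrite eqxx.
  by rewrite /weight ij -natr1; ring.
apply: forall_in_cons; last exact: forall_in_nil.
have comm_rel (R S : nzRingType) (f : {rmorphism R -> S}) x y s h x' y' s' h' :
  f x = x' -> f y = y' -> f s = s' -> f h = h' ->
  f (x * y - y * x - s * h) = x' * y' - y' * x' - s' * h'.
  by move=> <- <- <- <-; rewrite !rmorphB !rmorphM.
have hdivE : Psi (hdiv (qH (1 / 2) - qH (- (1 / 2)))) =
    mx_series (diag_of (fun i => hdiv (kexp (1 / 2 * weight i) - kexp (- (1 / 2) * weight i)))).
  have coef0_sub (A : nzRingType) (x y : series A) : x 0%N = 1 -> y 0%N = 1 -> (x - y) 0%N = 0.
    by move=> x0 y0; rewrite coefSB x0 y0 subrr.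
  apply: etrans (ext_hdiv _ (coef0_sub _ _ _ (qH0 (1 / 2)) (qH0 (- (1 / 2))))) _.
  rewrite -hdiv_mx; apply: (congr1 (@hdiv _)); rewrite -diag_ofB.
  have -> : mx_series (diag_of (fun j => kexp (1 / 2 * weight j)) -
                       diag_of (fun j => kexp (- (1 / 2) * weight j))) =
    mx_series (diag_of (fun j => kexp (1 / 2 * weight j))) -
    mx_series (diag_of (fun j => kexp (- (1 / 2) * weight j))).
    exact: raddfB.
  by rewrite -(Psi_qH (1 / 2)) -(Psi_qH (- (1 / 2))); apply: (raddfB (ext irrep_mor)).
apply: etrans (comm_rel _ _ (ext irrep_mor) _ _ _ _ _ _ _ _
  (Psi_gen UE) (Psi_gen UF) (Psi_scal _) hdivE) _.
by rewrite /irrep_letter -3!rmorphM -rmorphB irrep_EF diag_ofM subrr.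
Qed.

Lemma irrep_ideal f : in_closed_ideal Urel f -> Psi f = 0.
Proof.
have cphi : continuous Psi by move=> L g h gh; apply: ext_upto.
have cP : closed_ideal (fun f => Psi f = 0) := closed_ideal_preim cphi (closed_ideal_zero _).
exact: (closed_ideal_presented cP irrep_rels).
Qed.

Lemma mx_series_inj : injective mx_series.
Proof.
move=> A B AB; apply/matrixP => i j; apply: seriesP => d.
by rewrite -!coef_mx_series AB.
Qed.

Lemma irrep_series_eq f g : in_closed_ideal Urel (f - g) ->
  irrep_series N f = irrep_series N g.
Proof.
move=> /irrep_ideal; rewrite (raddfB (ext irrep_mor)) => /eqP; rewrite subr_eq0 => /eqP fg.
apply: mx_series_inj.
exact: etrans (esym (irrep_seriesE f)) (etrans fg (irrep_seriesE g)).
Qed.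
End Irrep.

Theorem theorem52 (K K' : long_knot)
  (hZ : universal_invariant D K = universal_invariant D K') :
  universal_invariant Uh_sl2 K = universal_invariant Uh_sl2 K' /\
  (forall N : nat, (1 <= N)%N -> colored_jones N K = colored_jones N K').
Proof.
have UK := universal_sl2 hZ; split; first exact/(@projP _ Urel).
case=> [N_gt0|n _]; first exact: False_ind (notF N_gt0).
pose jones (A : 'M[series rat]_n.+1) := sconst (n.+1%:R^-1) * \tr A.
exact: (congr1 jones (irrep_series_eq n UK)).
Qed.
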